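(* For any permutrees $T,T'$, the product $\mathbb Q_T\cdot\mathbb Q_{T'}$ in the dual permutree algebra $\mathsf{PT}^*$ is given by $$\mathbb Q_T\cdot\mathbb Q_{T'}=\sum_s\mathbb Q_{T\,{}_s\backslash T'},$$ where $s$ runs over all shuffles of the decorations of $T$ and $T'$.
   Context: Permutrees. A decoration of size $n$ is a word $\delta=\delta_1\cdots\delta_n$ in the symbols $\mathsf N$ (none), $\mathsf D$ (down), $\mathsf U$ (up), $\mathsf X$ (both). A permutree is a directed tree $T$ with $n$ vertices labeled bijectively by $[n]=\{1,\dots,n\}$ (vertices are identified with labels) in which each vertex has one or two parents (outgoing neighbors) and one or two children (incoming neighbors); a parent or child may be an unlabeled leaf (an up leaf, resp. down leaf). The ancestor (resp. descendant) subtree of $i$ through a given parent (resp. child) is the whole connected component, reached through it, of the tree with $i$ removed. If $i$ has two parents (resp. children), they are distinguished as left and right, and all labels in the left ancestor (resp. descendant) subtree of $i$ are smaller than $i$ while all labels in the right one are larger than $i$. The decoration of $T$ is given by $\delta(T)_i=\mathsf N,\mathsf D,\mathsf U,\mathsf X$ according to whether $i$ has (one parent, one child), (one parent, two children), (two parents, one child), (two parents, two children). Up labels are those decorated $\mathsf U$ or $\mathsf X$, down labels those decorated $\mathsf D$ or $\mathsf X$. Permutrees are drawn with edges oriented upwards and vertices from left to right by labels, so there is exactly one up (resp. down) leaf in each interval between consecutive up (resp. down) labels (including the two unbounded intervals). Gaps and laminations. A gap $\gamma$ of $[n]$ is one of the $n+1$ positions between two consecutive integers, before $1$, or after $n$.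 It defines the geodesic vertical path $\lambda(T,\gamma)$ in $T$ from the down leaf lying in the same interval between consecutive down labels as $\gamma$ to the up leaf lying in the same interval between consecutive up labels as $\gamma$. Cutting $T$ along $\lambda(T,\gamma)$ splits it into a left part containing the vertices with labels before $\gamma$ and a right part containing the vertices with labels after $\gamma$ (the path is doubled, its left copy running through the vertices of the path with labels before $\gamma$ and its right copy through the others). A multiset $\Gamma$ of gaps defines a lamination $\lambda(T,\Gamma)$, the multiset of the pairwise non-crossing paths $\lambda(T,\gamma)$, $\gamma\in\Gamma$; cutting $T$ along all these paths splits it into a forest, ordered from left to right (some trees may be bare strands without vertex, having one down leaf and one up leaf). The tree $T\,{}_s\backslash T'$. Let $T,T'$ be permutrees on $[n]$ and $[n']$ with decorations $\delta,\delta'$, and let $s$ be a shuffle of $\delta$ and $\delta'$ (i.e. one of the $\binom{n+n'}{n}$ interleavings of the letters of $\delta$ with those of $\delta'$, letters of $\delta$ and $\delta'$ being distinguished). Let $\Gamma$ be the multiset of gaps of $[n]$ given by the positions in $s$ of the down labels of $\delta'$, and $\Gamma'$ the multiset of gaps of $[n']$ given by the positions in $s$ of the up labels of $\delta$. Then $T\,{}_s\backslash T'$ is the permutree obtained by connecting, from left to right, the up leaves of the forest obtained from $T$ by cutting along $\lambda(T,\Gamma)$ to the down leaves of the forest obtained from $T'$ by cutting along $\lambda(T',\Gamma')$, each vertex being relabeled by the position in $s$ of the corresponding letter. Its decoration is $s$. Dual algebra. A decorated permutation is a permutation of some $[n]$ each of whose letters carries a decoration. $\mathsf{FQSym}^*_{\{\mathsf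 N,\mathsf D,\mathsf U,\mathsf X\}}$ has basis $(\mathbb G_\tau)$ indexed by decorated permutations, with product $\mathbb G_\tau\cdot\mathbb G_{\tau'}=\sum_\sigma\mathbb G_\sigma$ over all decorated permutations $\sigma$ of $[n+n']$ whose first $n$ letters standardize to $\tau$ and last $n'$ letters standardize to $\tau'$, letters keeping their decorations by position. $\mathsf{PT}^*$ is the quotient of this algebra identifying $\mathbb G_\tau$ and $\mathbb G_{\tau'}$ whenever $\tau,\tau'$ are linear extensions of the same permutree $T$, with each value $i$ decorated by $\delta(T)_i$ (a linear extension of $T$ is a permutation where $i$ appears before $j$ for each edge $i\to j$), and $\mathbb Q_T$ is the class of $\mathbb G_\tau$ for any linear extension $\tau$ of $T$ so decorated. *)

(* Defs.v *)
From HB Require Import structures.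
From mathcomp Require Import all_boot all_algebra.
From mathcomp Require Import boolp finmap.
From mathcomp.multinomials Require Import monalg.

Set Implicit Arguments.
Unset Strict Implicit.
Unset Printing Implicit Defensive.

Import GRing.Theory.

Local Open Scope ring_scope.

(** Labels are 0-based: the set [n] is rendered by ['I_n], and a gap of [n] is
    a natural number [g <= n], the gap lying just before label [g] (after the
    last label if [g = n]). *)

Inductive deco := DecoN | DecoD | DecoU | DecoX.

Definition is_up (c : deco) : bool :=
  match c with DecoU | DecoX => true | _ => false end.
Definition is_down (c : deco) : bool :=
  match c with DecoD | DecoX => true | _ => false end.

Definition deco_code (c : deco) : bool * bool := (is_up c, is_down c).
Definition deco_decode (b : bool * bool) : deco :=
  match b with
  | (false, false) => DecoN
  | (false, true) => DecoD
  | (true, false) => DecoU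
  | (true, true) => DecoX
  end.
Lemma deco_codeK : cancel deco_code deco_decode. Proof. by case. Qed.
HB.instance Definition _ := Finite.copy deco (can_type deco_codeK).

(** [rank P d g] counts the letters of [d] satisfying [P] before the gap [g];
    it is also the index, from the left, of the interval between consecutive
    [P]-labels in which [g] lies. *)
Definition rank (P : pred deco) (d : seq deco) (g : nat) : nat :=
  count P (take g d).

(** Leaves carry no label; they are named after the interval between
    consecutive down (resp. up) labels in which they are drawn, numbered from
    left to right. *)
Inductive node (d : seq deco) :=
  | Down of 'I_(count is_down d).+1
  | Vert of 'I_(size d)
  | Up of 'I_(count is_up d).+1.

Definition node_code d (x : node d) :
    'I_(count is_down d).+1 + 'I_(size d) + 'I_(count is_up d).+1 :=
  match x with
  | Down l => inl (inl l)
  | Vert i => inl (inr i)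
  | Up l => inr l
  end.
Definition node_decode d
    (x : 'I_(count is_down d).+1 + 'I_(size d) + 'I_(count is_up d).+1) :
    node d :=
  match x with
  | inl (inl l) => Down l
  | inl (inr i) => Vert i
  | inr l => Up l
  end.
Lemma node_codeK d : cancel (@node_code d) (@node_decode d).
Proof. by case. Qed.
HB.instance Definition _ d := Finite.copy (node d) (can_type (@node_codeK d)).

(** Candidate permutrees: a decoration and a directed graph, [edge x y] meaning
    that [y] is a parent of [x]. *)
Record pretree := Pretree { decor : seq deco; edge : rel (node decor) }.
Arguments edge : clear implicits.

Definition letter (d : seq deco) (i : nat) : deco := nth DecoN d i.

(** [before i x]: [x] lies to the left of the label [i]. An up (resp. down) leaf
    is compared only with up (resp. down) labels, as these are the labels which
    bound its interval. *)
Definition before d (i : 'I_(size d)) (x : node d) : bool :=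
  match x with
  | Vert j => j < i
  | Up l => is_up (letter d i) ==> (l <= rank is_up d i)
  | Down l => is_down (letter d i) ==> (l <= rank is_down d i)
  end%N.

Definition after d (i : 'I_(size d)) (x : node d) : bool :=
  match x with
  | Vert j => i < j
  | Up l => is_up (letter d i) ==> (rank is_up d i < l)
  | Down l => is_down (letter d i) ==> (rank is_down d i < l)
  end%N.

Section Trees.

Variable T : pretree.
Local Notation d := (decor T).
Local Notation e := (edge T).
Implicit Types (x y p q : node d) (i : 'I_(size d)).

Definition adj : rel (node d) := fun x y => e x y || e y x.

Definition is_tree : Prop :=
  [/\ forall x y, connect adj x y,
      forall x y, e x y -> ~~ e y x
    & forall c : seq (node d), (2 < size c)%N -> ~~ (cycle adj c && uniq c)].

(** The connected component of [p] once the vertex [i] is removed. *)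
Definition subtree i p : pred (node d) :=
  connect (fun x y => [&& adj x y, x != Vert i & y != Vert i]) p.

(** The neighbors of [i] in the direction [r] (parents or children): a left and
    a right one if [two], a single one otherwise. *)
Definition neighbors_ok i (r : pred (node d)) (two : bool) : Prop :=
  if two then
    exists p q, [/\ p != q,
                    forall x, r x = (x == p) || (x == q),
                    forall x, subtree i p x -> before i x
                  & forall x, subtree i q x -> after i x]
  else exists p, forall x, r x = (x == p).

Definition permutree : Prop :=
  [/\ is_tree,
      forall i, neighbors_ok i (e (Vert i)) (is_up (letter d i)),
      forall i, neighbors_ok i (e^~ (Vert i)) (is_down (letter d i)),
      forall l, (exists p, forall x, e (Down l) x = (x == p)) /\
                (forall x, ~~ e x (Down l))
    & forall l, (exists p, forall x, e x (Up l) = (x == p)) /\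
                (forall x, ~~ e (Up l) x)].

(** The geodesic between two nodes, endpoints included: in a tree, the unique
    simple path between them. *)
Definition geodesic x y : seq (node d) :=
  if [pick p : #|{: node d}|.-bseq (node d) |
        [&& path adj x p, last x p == y & uniq (x :: p)]] is Some p
  then x :: p else [::].

(** The leaves of the intervals containing the gap [g]; both indices are in
    range. *)
Definition lambda (g : nat) : seq (node d) :=
  geodesic (Down (inord (rank is_down d g))) (Up (inord (rank is_up d g))).

(** Below, [G] lists a multiset of gaps in nondecreasing order. Cutting along
    the corresponding paths gives the pieces number 0, ..., [size G] from left
    to right, the [k]-th of which lies between the gaps [lo G k] and [hi G k]
    (the extreme pieces being unbounded on one side). *)
Definition lo (G : seq nat) (k : nat) : nat := nth 0%N (0%N :: G) k.
Definition hi (G : seq nat) (k : nat) : nat := nth (size d) G k.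

(** A leaf of [T] has a copy in each piece which it touches, so that a leaf at
    which [m] of the paths end yields [m + 1] leaves of the forest. *)
Definition in_piece (G : seq nat) (k : nat) (x : node d) : bool :=
  match x with
  | Vert i => lo G k <= i < hi G k
  | Down l => rank is_down d (lo G k) <= l <= rank is_down d (hi G k)
  | Up l => rank is_up d (lo G k) <= l <= rank is_up d (hi G k)
  end%N.

(** Edges of the [k]-th piece: those of [T] inside the piece, together with the
    copies of the cutting paths, each copy of a path running, in order, through
    those of its nodes which are in the piece. *)
Definition forest_edge (G : seq nat) (k : nat) (x y : node d) : bool :=
  [&& in_piece G k x, in_piece G k y
    & e x y ||
      has (fun g => infix [:: x; y] [seq z <- lambda g | in_piece G k z]) G].

End Trees.

(** The leaf [l] of the [k]-th piece is number [k + l] among the leaves of its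
    kind (up or down) in the forest, ordered from left to right: each of the [l]
    labels and [k] cuts to its left accounts for exactly one earlier leaf. *)
Definition leaf_index (k l : nat) : nat := k + l.

Definition from_left (x : deco + deco) : option deco :=
  if x is inl c then Some c else None.
Definition from_right (x : deco + deco) : option deco :=
  if x is inr c then Some c else None.

(** Interleavings of [d] and [d'] whose letters remember their origin. *)
Definition shuffle (d d' : seq deco)
    (s : (size d + size d').-tuple (deco + deco)) : bool :=
  (pmap from_left s == d) && (pmap from_right s == d').

Definition word (s : seq (deco + deco)) : seq deco :=
  [seq match x with inl c => c | inr c => c end | x <- s].

Definition positions (P : pred (deco + deco)) (s : seq (deco + deco)) :
    seq nat :=
  [seq p <- iota 0 (size s) | P (nth (inl DecoN) s p)].

(** The gaps of [n] at the down letters of [d'], and those of [n'] at the up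
    letters of [d], listed in nondecreasing order. *)
Definition left_gaps (s : seq (deco + deco)) : seq nat :=
  [seq count (isSome \o from_left) (take p s)
     | p <- positions (fun x => oapp is_down false (from_right x)) s].
Definition right_gaps (s : seq (deco + deco)) : seq nat :=
  [seq count (isSome \o from_right) (take p s)
     | p <- positions (fun x => oapp is_up false (from_left x)) s].

Section Glue.

Variables (T T' : pretree) (s : seq (deco + deco)).
Local Notation G := (left_gaps s).
Local Notation G' := (right_gaps s).

(** [lower z k x] (resp. [upper z k x]): the node [z] of the glued tree comes
    from the node [x] of the [k]-th piece of [T] (resp. [T']). *)
Definition lower (z : node (word s)) (k : nat) (x : node (decor T)) : bool :=
  match z, x with
  | Down j, Down l => j == leaf_index k l :> nat
  | Vert p, Vert i => p == nth 0 (positions (isSome \o from_left) s) i :> nat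
  | _, _ => false
  end%N.
Definition upper (z : node (word s)) (k : nat) (x : node (decor T')) : bool :=
  match z, x with
  | Up j, Up l => j == leaf_index k l :> nat
  | Vert p, Vert i => p == nth 0 (positions (isSome \o from_right) s) i :> nat
  | _, _ => false
  end%N.

(** An edge of the glued tree is an edge of the lower forest, an edge of the
    upper forest, or is obtained by joining the edge to an up leaf of the lower
    forest with the edge from the down leaf of same index of the upper one. *)
Definition glue_edge (z z' : node (word s)) : bool :=
  [|| [exists k : 'I_(size G).+1, exists x, exists y,
         [&& forest_edge G k x y, lower z k x & lower z' k y]],
      [exists k : 'I_(size G').+1, exists x, exists y,
         [&& forest_edge G' k x y, upper z k x & upper z' k y]]
    | [exists k : 'I_(size G).+1, exists x, exists l,
         [exists k' : 'I_(size G').+1, exists l', exists y,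
            [&& @forest_edge T G k x (Up l), @forest_edge T' G' k' (Down l') y,
                leaf_index k l == leaf_index k' l',
                lower z k x & upper z' k' y]]]].

Definition glue : pretree := Pretree glue_edge.

End Glue.

(** A decorated permutation of [n], as the word of its (0-based) values with
    their decorations. *)
Record dperm := DPerm {
  dperm_val :> seq (nat * deco);
  _ : perm_eq (unzip1 dperm_val) (iota 0 (size dperm_val)) }.
HB.instance Definition _ := [isSub for dperm_val].
HB.instance Definition _ := [Choice of dperm by <:].

(** Standardization; letters keep their decorations. *)
Definition std (w : seq (nat * deco)) : seq (nat * deco) :=
  [seq (count (fun y => (y.1 < x.1)%N) w, x.2) | x <- w].

Definition dperms (n : nat) : seq dperm :=
  pmap insub [seq [seq (nat_of_ord x.1, x.2) | x <- t]
                | t : n.-tuple ('I_n * deco)].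

Definition linear_extension (T : pretree) (t : dperm) : bool :=
  [&& size t == size (decor T),
      all (fun x => x.2 == letter (decor T) x.1) t
    & [forall i, forall j, edge T (Vert i) (Vert j) ==>
         (index (i : nat) (unzip1 t) < index (j : nat) (unzip1 t))%N]].

Lemma dpermP (t : dperm) : perm_eq (unzip1 t) (iota 0 (size t)).
Proof. by case: t. Qed.

Lemma dperm_uniq (t : dperm) : uniq (unzip1 t).
Proof. by rewrite (perm_uniq (dpermP t)) iota_uniq. Qed.

Lemma size_std w : size (std w) = size w.
Proof. exact: size_map. Qed.

Lemma count_lt_mono (s : seq nat) (x y : nat) : y \in s ->
  (count (fun z => (z < y)%N) s < count (fun z => (z < x)%N) s)%N = (y < x)%N.
Proof.
move=> ys; case: (ltnP y x) => [ltyx|lexy]; last first.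
  by apply/negbTE; rewrite -leqNgt sub_count // => z /= zx; apply: leq_trans lexy.
have -> : count (fun z => (z < x)%N) s =
  (count (fun z => (z < y)%N) s + count (fun z => (y <= z < x)%N) s)%N.
  elim: s {ys} => //= z s ->; rewrite addnACA; congr addn.
  case: (ltnP z y) => [zy|yz] /=; last by rewrite add0n.
  by rewrite (ltn_trans zy ltyx).
rewrite -addn1 leq_add2l -has_count; apply/hasP; exists y => //.
by rewrite leqnn.
Qed.

Lemma std_sub (w u : seq (nat * deco)) : {subset u <= w} ->
  std [seq (count (fun y => (y.1 < x.1)%N) w, x.2) | x <- u] = std u.
Proof.
move=> uw; rewrite /std -map_comp; apply/eq_in_map => x xu /=.
rewrite count_map; congr pair; apply: eq_in_count => y yu /=.
have cE v : count (fun y => (y.1 < v)%N) w =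
  count (fun z => (z < v)%N) (unzip1 w) by rewrite /unzip1 count_map.
by rewrite !cE count_lt_mono //; apply: map_f; apply: uw.
Qed.

Lemma std_take i w : std (take i (std w)) = std (take i w).
Proof. by rewrite -map_take std_sub // => x /mem_take. Qed.

Lemma std_drop i w : std (drop i (std w)) = std (drop i w).
Proof. by rewrite -map_drop std_sub // => x /mem_drop. Qed.

Lemma std_perm w : uniq (unzip1 w) ->
  perm_eq (unzip1 (std w)) (iota 0 (size (std w))).
Proof.
move=> uw; have stdE : unzip1 (std w) =
    [seq count (fun z => (z < v)%N) (unzip1 w) | v <- unzip1 w].
  rewrite /unzip1 /std -!map_comp; apply: eq_map => x /=.
  by rewrite count_map.
have uN : uniq (unzip1 (std w)).
  rewrite stdE map_inj_in_uniq // => x y xw yw eqxy.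
  have := count_lt_mono x yw; have := count_lt_mono y xw.
  by rewrite eqxy ltnn; case: ltngtP.
have sub : {subset unzip1 (std w) <= iota 0 (size (std w))}.
  move=> y; rewrite stdE => /mapP[x xw ->]; rewrite mem_iota size_std /= add0n.
  rewrite -(size_map fst w) ltn_neqAle count_size andbT.
  by rewrite -all_count; apply/negP => /allP /(_ x xw) /=; rewrite ltnn.
have le : (size (iota 0 (size (std w))) <= size (unzip1 (std w)))%N.
  by rewrite size_iota /unzip1 size_map.
have [_ eqi] := uniq_min_size uN sub le.
by apply: uniq_perm => //; apply: iota_uniq.
Qed.

Lemma std_id (t : dperm) : std t = t.
Proof.
rewrite -[RHS]map_id; apply/eq_in_map => x xt.
rewrite [RHS]surjective_pairing; congr pair.
have -> : count (fun y => (y.1 < x.1)%N) t =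
  count (fun z => (z < x.1)%N) (unzip1 t) by rewrite /unzip1 count_map.
have /permP -> := dpermP t.
have : (x.1 < size t)%N.
  have : x.1 \in unzip1 t by apply: map_f.
  by rewrite (perm_mem (dpermP t)) mem_iota.
elim: (size t) => // n IH; rewrite ltnS leq_eqVlt -[n.+1]addn1 iotaD count_cat /=.
rewrite add0n addn0; case/predU1P => [->|xn].
  rewrite ltnn addn0 (eq_in_count (a2 := predT)) ?count_predT ?size_iota //.
  by move=> y; rewrite mem_iota.
by rewrite IH // ltnNge (ltnW xn) addn0.
Qed.

Lemma take_std_subproof i (s : dperm) :
  perm_eq (unzip1 (std (take i s))) (iota 0 (size (std (take i s)))).
Proof. by apply: std_perm; rewrite /unzip1 map_take take_uniq ?dperm_uniq. Qed.
Definition take_std i (s : dperm) : dperm := DPerm (take_std_subproof i s).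

Lemma drop_std_subproof i (s : dperm) :
  perm_eq (unzip1 (std (drop i s))) (iota 0 (size (std (drop i s)))).
Proof. by apply: std_perm; rewrite /unzip1 map_drop drop_uniq ?dperm_uniq. Qed.
Definition drop_std i (s : dperm) : dperm := DPerm (drop_std_subproof i s).

Lemma take_take_std j i (s : dperm) : (j <= i)%N ->
  take_std j (take_std i s) = take_std j s.
Proof. by move=> ji; apply: val_inj; rewrite /= std_take take_takel. Qed.

Lemma drop_take_std j i (s : dperm) : (j <= i)%N ->
  drop_std j (take_std i s) = take_std (i - j) (drop_std j s).
Proof.
move=> ji; apply: val_inj; rewrite /= std_take std_drop take_drop.
by rewrite subnK.
Qed.

Lemma drop_drop_std j i (s : dperm) : (j <= i)%N ->
  drop_std (i - j) (drop_std j s) = drop_std i s.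
Proof. by move=> ji; apply: val_inj; rewrite /= std_drop drop_drop subnK. Qed.

Lemma mem_dperms n (s : dperm) : (s \in dperms n) = (size s == n).
Proof.
rewrite mem_pmap_sub; apply/imageP/eqP => [[t _ ->]|sn].
  by rewrite size_map size_tuple.
have lts : all (fun x => x.1 < n)%N s.
  apply/allP => x xs; have : x.1 \in unzip1 s by apply: map_f.
  by rewrite (perm_mem (dpermP s)) mem_iota sn.
case: n sn lts => [|n] sn lts.
  by exists (in_tuple [::]) => //=; apply: size0nil.
have szt : size [seq (inord x.1 : 'I_n.+1, x.2) | x <- s] == n.+1.
  by rewrite size_map sn.
exists (Tuple szt) => //=; rewrite -map_comp -[LHS]map_id.
apply/eq_in_map => x xs /=; rewrite inordK; first by case: x {xs}.
by have /allP/(_ x xs) := lts.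
Qed.

Lemma dperms_uniq n : uniq (dperms n).
Proof.
apply: pmap_sub_uniq; rewrite map_inj_uniq ?enum_uniq // => t u /inj_map eqtu.
by apply: val_inj; apply: eqtu => -[x c] [y c'] [/val_inj -> ->].
Qed.

Lemma dperm0_subproof :
  perm_eq (unzip1 (Nil (nat * deco))) (iota 0 (size (Nil (nat * deco)))).
Proof. by []. Qed.
Definition dperm0 : dperm := DPerm dperm0_subproof.

Definition FQSym (k : comNzRingType) : Type := {malg k[dperm]}.

Section FQSym.

Variable k : comNzRingType.
Implicit Types (x y z : FQSym k) (s t : dperm).

HB.instance Definition _ := GRing.Lmodule.copy (FQSym k) {malg k[dperm]}.

Definition fqG t : FQSym k := << t >>.

Definition fqGmul t t' : FQSym k :=
  \sum_(s <- dperms (size t + size t') |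
          (std (take (size t) s) == t) && (std (drop (size t) s) == t')) fqG s.

Definition fqmul x y : FQSym k :=
  \sum_(t <- msupp x) \sum_(t' <- msupp y) (x@_t * y@_t') *: fqGmul t t'.

Lemma mcoeff_fqG t s : (fqG t)@_s = (t == s)%:R.
Proof. by rewrite mcoeffU. Qed.

Lemma fqP x y : (forall s, x@_s = y@_s) <-> x = y.
Proof. exact: malgP. Qed.

Lemma mcoeff_fqGmul t t' s :
  (fqGmul t t')@_s =
  \sum_(i < (size s).+1) ((t == take_std i s) && (t' == drop_std i s))%:R.
Proof.
rewrite raddf_sum /= (eq_bigr (fun r => (r == s)%:R)); last first.
  by move=> r _; rewrite mcoeff_fqG.
rewrite big_mkcond /=.
transitivity (((std (take (size t) s) == t :> seq _) &&
               (std (drop (size t) s) == t' :> seq _))%:R : k).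
  have [sin|sout] := boolP (s \in dperms (size t + size t')).
    rewrite (bigD1_seq s) ?dperms_uniq //= eqxx big1 ?addr0; first by case: ifP.
    by move=> r /negbTE ->; case: ifP.
  rewrite big1_seq; last first.
    move=> r /= rin; case: ifP => // _; case: eqP => // rs.
    by rewrite rs (negbTE sout) in rin.
  case: andP => //= -[/eqP et /eqP et']; case/negP: sout.
  have := congr1 size et; have := congr1 size et'; rewrite !size_std => sd st.
  by rewrite mem_dperms -[s in size s](cat_take_drop (size t)) size_cat st sd.
have szT i : (i < (size s).+1)%N -> t == take_std i s -> i = size t.
  by move=> li /eqP ->; rewrite /= size_std size_takel.
case: (ltnP (size t) (size s).+1) => [lt|ge].
  rewrite (bigD1 (Ordinal lt)) //= big1 ?addr0 => [|i ne].
    rewrite -!val_eqE /=; congr (_ && _)%:R; exact: eq_sym.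
  case: (t =P take_std i s) => //= /eqP /(szT _ (ltn_ord i)) ei.
  by case/eqP: ne; apply: val_inj.
rewrite big1 => [|i _]; last first.
  case: (t =P take_std i s) => //= /eqP /(szT _ (ltn_ord i)) ei.
  by move: (ltn_ord i); rewrite ei ltnNge ge.
case: eqP => //= et; have := size_std (take (size t) s).
rewrite et take_oversize; last exact: ltnW.
by move=> ets; rewrite ets ltnn in ge.
Qed.

Lemma mcoeff_sum_supp x s : \sum_(t <- msupp x) x@_t * (t == s)%:R = x@_s.
Proof.
rewrite [in RHS](monalgE x) raddf_sum /=; apply: eq_bigr => t _.
by rewrite mcoeffU mulr_natr.
Qed.

Lemma mcoeff_fqmul x y s :
  (fqmul x y)@_s =
  \sum_(i < (size s).+1) x@_(take_std i s) * y@_(drop_std i s).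
Proof.
have -> : (fqmul x y)@_s = \sum_(t <- msupp x) \sum_(t' <- msupp y)
    \sum_(i < (size s).+1)
      (x@_t * (t == take_std i s)%:R) * (y@_t' * (t' == drop_std i s)%:R).
  rewrite raddf_sum; apply: eq_bigr => t _.
  rewrite raddf_sum; apply: eq_bigr => t' _.
  rewrite /= mcoeffZ mcoeff_fqGmul mulr_sumr; apply: eq_bigr => i _.
  by rewrite -mulnb natrM mulrACA.
under eq_bigr do rewrite exchange_big /=.
rewrite exchange_big; apply: eq_bigr => i _.
rewrite -!mcoeff_sum_supp mulr_suml; apply: eq_bigr => t _.
by rewrite mulr_sumr.
Qed.

Lemma fqmulA : associative fqmul.
Proof.
move=> x y z; apply/fqP => s; rewrite !mcoeff_fqmul.
pose F (j i : nat) :=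
  x@_(take_std j s) * (y@_(take_std (i - j) (drop_std j s)) * z@_(drop_std i s)).
transitivity (\sum_(j < (size s).+1) \sum_(i < (size s).+1 | (j <= i)%N) F j i).
  apply: eq_bigr => j _; rewrite mcoeff_fqmul mulr_sumr.
  have js : (j <= size s)%N by rewrite -ltnS.
  have -> : size (drop_std j s) = (size s - j)%N by rewrite size_std size_drop.
  rewrite -(big_geq_mkord j _ predT) -[in RHS](add0n (j : nat)) big_addn subSn //.
  rewrite big_mkord; apply: eq_bigr => l _.
  by rewrite /F -(drop_drop_std s (leq_addl l j)) addnK.
rewrite (exchange_big_dep predT) //=; apply: eq_bigr => i _.
have si : (i <= size s)%N by rewrite -ltnS.
rewrite mcoeff_fqmul mulr_suml.
have -> : size (take_std i s) = i by rewrite size_std size_takel.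
rewrite (big_ord_widen_cond (size s).+1 predT (fun j => 
  x@_(take_std j (take_std i s)) * y@_(drop_std j (take_std i s)) *
   z@_(drop_std i s))) ?ltnS //.
apply: eq_big => [j|j ji]; first by rewrite ltnS.
by rewrite /F mulrA take_take_std // drop_take_std.
Qed.

Lemma fqmul1l : left_id (fqG dperm0) fqmul.
Proof.
move=> x; apply/fqP => s; rewrite mcoeff_fqmul big_ord_recl big1 => [|i _].
  rewrite mcoeff_fqG addr0.
  have -> : take_std 0 s = dperm0 by apply: val_inj; rewrite /= take0.
  have -> : drop_std 0 s = s by apply: val_inj; rewrite /= drop0 std_id.
  by rewrite eqxx mul1r.
rewrite mcoeff_fqG; case: eqP => [e|_]; last by rewrite mul0r.
have := congr1 (fun t : dperm => size t) e.
by rewrite /= size_std size_takel //= lift0.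
Qed.

Lemma fqmul1r : right_id (fqG dperm0) fqmul.
Proof.
move=> x; apply/fqP => s; rewrite mcoeff_fqmul big_ord_recr big1 => [|i _] /=.
  rewrite mcoeff_fqG add0r.
  have -> : take_std (size s) s = s.
    by apply: val_inj; rewrite /= take_size std_id.
  have -> : drop_std (size s) s = dperm0 by apply: val_inj; rewrite /= drop_size.
  by rewrite eqxx mulr1.
rewrite mcoeff_fqG; case: eqP => [e|_]; last by rewrite mulr0.
have := congr1 (fun t : dperm => size t) e.
by rewrite /= size_std size_drop => /esym/eqP; rewrite subn_eq0 leqNgt ltn_ord.
Qed.

Lemma fqmulDl : left_distributive fqmul +%R.
Proof.
move=> x y z; apply/fqP => s; rewrite mcoeffD !mcoeff_fqmul -big_split /=.
by apply: eq_bigr => i _; rewrite mcoeffD mulrDl.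
Qed.

Lemma fqmulDr : right_distributive fqmul +%R.
Proof.
move=> x y z; apply/fqP => s; rewrite mcoeffD !mcoeff_fqmul -big_split /=.
by apply: eq_bigr => i _; rewrite mcoeffD mulrDr.
Qed.

Lemma fq1_neq0 : fqG dperm0 != 0.
Proof.
apply/eqP => /(congr1 (mcoeff dperm0)); rewrite mcoeff_fqG eqxx mcoeff0.
by apply/eqP; apply: oner_neq0.
Qed.

HB.instance Definition _ := GRing.Zmodule_isNzRing.Build (FQSym k)
  fqmulA fqmul1l fqmul1r fqmulDl fqmulDr fq1_neq0.

Lemma mcoeffM x y s :
  (x * y)@_s = \sum_(i < (size s).+1) x@_(take_std i s) * y@_(drop_std i s).
Proof. exact: mcoeff_fqmul. Qed.

Lemma fq_scalerAl (c : k) x y : c *: (x * y) = (c *: x) * y.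
Proof.
apply/fqP => s; rewrite mcoeffZ !mcoeffM mulr_sumr.
by apply: eq_bigr => i _; rewrite mcoeffZ mulrA.
Qed.

Lemma fq_scalerAr (c : k) x y : c *: (x * y) = x * (c *: y).
Proof.
apply/fqP => s; rewrite mcoeffZ !mcoeffM mulr_sumr.
by apply: eq_bigr => i _; rewrite mcoeffZ mulrCA.
Qed.

HB.instance Definition _ :=
  GRing.Lmodule_isLalgebra.Build k (FQSym k) fq_scalerAl.
HB.instance Definition _ :=
  GRing.Lalgebra_isAlgebra.Build k (FQSym k) fq_scalerAr.

Lemma fqG_mul t t' : fqG t * fqG t' = fqGmul t t'.
Proof.
apply/fqP => s; rewrite mcoeffM mcoeff_fqGmul; apply: eq_bigr => i _.
by rewrite !mcoeff_fqG -natrM mulnb.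
Qed.

(** The two-sided ideal generated by the differences of the basis elements to
    be identified. *)
Inductive pt_ideal : FQSym k -> Prop :=
  | pt_ideal_gen T t t' of permutree T & linear_extension T t
      & linear_extension T t' : pt_ideal (fqG t - fqG t')
  | pt_ideal0 : pt_ideal 0
  | pt_idealD x y of pt_ideal x & pt_ideal y : pt_ideal (x + y)
  | pt_idealMl x y of pt_ideal y : pt_ideal (x * y)
  | pt_idealMr x y of pt_ideal x : pt_ideal (x * y).

Definition pt_idealb : pred (FQSym k) := fun x => `[< pt_ideal x >].

Lemma pt_idealP x : reflect (pt_ideal x) (x \in pt_idealb).
Proof. exact: asboolP. Qed.

Lemma pt_ideal_zmod : zmod_closed pt_idealb.
Proof.
split=> [|x y /pt_idealP ix /pt_idealP iy]; apply/pt_idealP; first exact: pt_ideal0.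
by apply: pt_idealD => //; rewrite -mulN1r; apply: pt_idealMl.
Qed.

HB.instance Definition _ :=
  GRing.isZmodClosed.Build (FQSym k) pt_idealb pt_ideal_zmod.

Lemma pt_ideal_neq1 : ~ pt_ideal 1.
Proof.
have eps_ideal x : pt_ideal x -> x@_dperm0 = 0.
  have M0 y z : (y * z)@_dperm0 = y@_dperm0 * z@_dperm0.
    rewrite mcoeffM /= big_ord1.
    have -> : take_std (@ord0 0) dperm0 = dperm0 by exact: val_inj.
    by have -> : drop_std (@ord0 0) dperm0 = dperm0 by exact: val_inj.
  elim=> {x} [T t t' _ lt lt'||x y _ x0 _ y0|x y _ y0|x y _ x0].
  - have e0 u : linear_extension T u -> (u == dperm0) = (size (decor T) == 0%N).
      by case/andP => /eqP su _; rewrite -su size_eq0 -val_eqE.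
    by rewrite mcoeffB !mcoeff_fqG !e0 // subrr.
  - exact: mcoeff0.
  - by rewrite mcoeffD x0 y0 addr0.
  - by rewrite M0 y0 mulr0.
  - by rewrite M0 x0 mul0r.
move/eps_ideal; rewrite mcoeff_fqG eqxx => /eqP.
by rewrite oner_eq0.
Qed.

Local Open Scope quotient_scope.

Definition PT : Type := 
  Quotient.quot (GRing.ZmodClosed.clone (FQSym k) pt_idealb _).

HB.instance Definition _ := GRing.Zmodule.on PT.
HB.instance Definition _ := Quotient.on PT.

Lemma ptP x y : reflect (\pi_PT x = \pi_PT y) (x - y \in pt_idealb).
Proof. by rewrite Quotient.idealrBE; apply: eqP. Qed.

Lemma pi_ptD x y : \pi_PT (x + y) = \pi_PT x + \pi_PT y.
Proof. by rewrite !piE. Qed.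

Lemma pt_repr x : pt_ideal (repr (\pi_PT x) - x).
Proof. by apply/pt_idealP/ptP; rewrite reprK. Qed.

Definition pt_one : PT := \pi_PT 1.
Definition pt_mul (a b : PT) : PT := \pi_PT (repr a * repr b).
Definition pt_scale (c : k) (a : PT) : PT := \pi_PT (c *: repr a).

Lemma pi_ptM x y : \pi_PT (x * y) = pt_mul (\pi_PT x) (\pi_PT y).
Proof.
apply/esym/ptP/pt_idealP; set x' := repr _; set y' := repr _.
have -> : x' * y' - x * y = (x' - x) * y' + x * (y' - y).
  by rewrite mulrBl mulrBr addrA subrK.
by apply: pt_idealD; [apply: pt_idealMr | apply: pt_idealMl]; apply: pt_repr.
Qed.

Lemma pi_ptZ c x : \pi_PT (c *: x) = pt_scale c (\pi_PT x).
Proof.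
apply/esym/ptP/pt_idealP; rewrite -scalerBr -[_ - _]mul1r scalerAl.
by apply: pt_idealMl; apply: pt_repr.
Qed.

Lemma pt_ind (P : PT -> Prop) : (forall x, P (\pi_PT x)) -> forall a, P a.
Proof. by move=> Pp a; rewrite -[a]reprK. Qed.

Lemma pt_mulA : associative pt_mul.
Proof.
by elim/pt_ind=> x; elim/pt_ind=> y; elim/pt_ind=> z; rewrite -!pi_ptM mulrA.
Qed.

Lemma pt_mul1l : left_id pt_one pt_mul.
Proof. by elim/pt_ind=> x; rewrite -pi_ptM mul1r. Qed.

Lemma pt_mul1r : right_id pt_one pt_mul.
Proof. by elim/pt_ind=> x; rewrite -pi_ptM mulr1. Qed.

Lemma pt_mulDl : left_distributive pt_mul +%R.
Proof.
elim/pt_ind=> x; elim/pt_ind=> y; elim/pt_ind=> z.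
by rewrite -!(pi_ptM, pi_ptD) mulrDl.
Qed.

Lemma pt_mulDr : right_distributive pt_mul +%R.
Proof.
elim/pt_ind=> x; elim/pt_ind=> y; elim/pt_ind=> z.
by rewrite -!(pi_ptM, pi_ptD) mulrDr.
Qed.

Lemma pt_one_neq0 : pt_one != 0.
Proof.
apply/eqP; rewrite -[0](_ : \pi_PT 0 = 0); last by rewrite !piE.
by move/ptP/pt_idealP; rewrite subr0; apply: pt_ideal_neq1.
Qed.

HB.instance Definition _ := GRing.Zmodule_isNzRing.Build PT
  pt_mulA pt_mul1l pt_mul1r pt_mulDl pt_mulDr pt_one_neq0.

Lemma pt_scalerA c c' a : pt_scale c (pt_scale c' a) = pt_scale (c * c') a.
Proof. by elim/pt_ind: a => x; rewrite -!pi_ptZ scalerA. Qed.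

Lemma pt_scale1r : left_id 1 pt_scale.
Proof. by elim/pt_ind=> x; rewrite -pi_ptZ scale1r. Qed.

Lemma pt_scalerDr : right_distributive pt_scale +%R.
Proof.
by move=> c; elim/pt_ind=> x; elim/pt_ind=> y; rewrite -!(pi_ptZ, pi_ptD) scalerDr.
Qed.

Lemma pt_scalerDl a : {morph pt_scale^~ a : c c' / c + c'}.
Proof.
by elim/pt_ind: a => x c c'; rewrite -!(pi_ptZ, pi_ptD) scalerDl.
Qed.

HB.instance Definition _ := GRing.Zmodule_isLmodule.Build k PT
  pt_scalerA pt_scale1r pt_scalerDr pt_scalerDl.

Lemma pt_scalerAl (c : k) (a b : PT) : c *: (a * b) = (c *: a) * b.
Proof.
elim/pt_ind: a => x; elim/pt_ind: b => y; change (pt_scale c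
  (pt_mul (\pi_PT x) (\pi_PT y)) = pt_mul (pt_scale c (\pi_PT x)) (\pi_PT y)).
by rewrite -!(pi_ptM, pi_ptZ) scalerAl.
Qed.

Lemma pt_scalerAr (c : k) (a b : PT) : c *: (a * b) = a * (c *: b).
Proof.
elim/pt_ind: a => x; elim/pt_ind: b => y; change (pt_scale c
  (pt_mul (\pi_PT x) (\pi_PT y)) = pt_mul (\pi_PT x) (pt_scale c (\pi_PT y))).
by rewrite -!(pi_ptM, pi_ptZ) scalerAr.
Qed.

HB.instance Definition _ := GRing.Lmodule_isLalgebra.Build k PT pt_scalerAl.
HB.instance Definition _ := GRing.Lalgebra_isAlgebra.Build k PT pt_scalerAr.

(** The class of [fqG t] for a linear extension [t] of [T]; which one is
    irrelevant if [T] is a permutree, by definition of the ideal. The value 0 is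
    then never used, as the edges of a directed tree have no directed cycle. *)
Definition ptQ (T : pretree) : PT :=
  if [seq t <- dperms (size (decor T)) | linear_extension T t] is t :: _
  then \pi_PT (fqG t) else 0.

Lemma ptQ_E T t : permutree T -> linear_extension T t ->
  ptQ T = \pi_PT (fqG t).
Proof.
move=> pT lt; rewrite /ptQ.
have : t \in [seq t <- dperms (size (decor T)) | linear_extension T t].
  by rewrite mem_filter lt mem_dperms; case/andP: lt.
case E: filter => [//|t' r] _; apply/ptP/pt_idealP.
apply: (pt_ideal_gen pT) => //.
have : t' \in t' :: r by rewrite mem_head.
by rewrite -E mem_filter => /andP[].
Qed.

End FQSym.

(* Main.v *)
(** Fix a linear extension of a permutree and read it as a sweep from bottom to
    top. At each time the walls are the up labels already processed and the down
    labels not yet processed; a node is visible from a gap if no wall at its time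
    stands strictly between them. The edges of the tree are exactly the pairs of
    nodes that are consecutive, in time, among the nodes visible from some gap:
    in a permutree the last turning point of the path from a vertex to an edge is
    a wall between them, and conversely the edges so defined form a permutree. In
    these terms the path through a gap is the list of the nodes visible from it.

    If a word of the product processes the letters of [T] before those of [T'],
    the nodes visible from a gap of the shuffle are the nodes of [T] visible from
    the corresponding gap within one piece of the forest of [T], followed by the
    analogous nodes of [T']. Hence the glued tree is the tree of the sweep of
    this word, which is thus one of its linear extensions. *)
Require Import Defs.
From mathcomp Require Import all_boot all_algebra zify.
From mathcomp Require Import boolp.
Import GRing.Theory.

Set Implicit Arguments.
Unset Strict Implicit.
Unset Printing Implicit Defensive.

(** * Sweeps *)

(** Since [ptQ] can be read off any linear extension, one extension of each factor is enough: the
    words in the product of the two basis elements then correspond one to one to the shuffles, and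
    everything reduces to comparing, for each shuffle, the glued tree with one sweep. The obstacle
    is that gluing mixes geodesics, pieces and copies of leaves, and that gaps of the factors are
    not gaps of the shuffle. What a gap of the shuffle determines is, in each factor, a piece
    together with a gap of that piece; every such pair arises in this way. One gap of the shuffle
    thus controls the lower and the upper forest at once. Sweeps are kept abstract so that time can
    be reversed: the reversal of the sweep of a decoration is not of that form, its [Down] leaves
    being on top, yet it yields every statement on children from the one on parents. *)

Definition between (a b w : nat) := (a <= w < b) || (b <= w < a).

(* A time order on [n] labels, processed one at a time. The vertical line of the
   label [i] is a wall below the node [vx i] if [lw i], above it if [uw i].
   The position of a node [x] is the interval of gaps from [hl x] to [hr x]: the two
   gaps around [i] for [vx i], and an arbitrary gap of its interval for a leaf. *)
Record sweep (N : finType) (n : nat) := Sweep {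
  vx : 'I_n -> N;
  hl : N -> nat;
  hr : N -> nat;
  tm : N -> nat;
  top : nat;
  lw : pred 'I_n;
  uw : pred 'I_n;
  hl_vx : forall i, hl (vx i) = i;
  hr_vx : forall i, hr (vx i) = i.+1;
  tm_vx : forall i, 0 < tm (vx i) < top;
  tm_vx_inj : injective (fun i => tm (vx i));
  nodeP : forall x, (exists i, x = vx i) \/
    [/\ hl x = hr x, hr x <= n & tm x = 0 \/ tm x = top];
  bot_uniq : forall x y, tm x = 0 -> tm y = 0 ->
    (forall w : 'I_n, between (hl x) (hl y) w -> ~~ lw w) -> x = y;
  top_uniq : forall x y, tm x = top -> tm y = top ->
    (forall w : 'I_n, between (hl x) (hl y) w -> ~~ uw w) -> x = y;
  bot_ex : forall g, g <= n ->
    exists2 x, tm x = 0 & forall w : 'I_n, between g (hl x) w -> ~~ lw w;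
  top_ex : forall g, g <= n ->
    exists2 x, tm x = top & forall w : 'I_n, between g (hl x) w -> ~~ uw w;
  top_gt0 : 0 < top }.

Section Sweep.
Variables (N : finType) (n : nat).

Lemma tm_le_top (S : sweep N n) x : tm S x <= top S.
Proof.
case: (nodeP S x) => [[i ->]|[_ _ [] ->]] //.
by have /andP[_ /ltnW] := tm_vx S i.
Qed.

Lemma flip_tm_vx (S : sweep N n) i : 0 < top S - tm S (vx S i) < top S.
Proof. have := tm_vx S i; lia. Qed.

Lemma flip_tm_inj (S : sweep N n) : injective (fun i => top S - tm S (vx S i)).
Proof.
move=> i j e; apply: (@tm_vx_inj _ _ S) => /=; move: e.
have := tm_vx S i; have := tm_vx S j; lia.
Qed.

Lemma flip_nodeP (S : sweep N n) x : (exists i, x = vx S i) \/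
    [/\ hl S x = hr S x, hr S x <= n &
        top S - tm S x = 0 \/ top S - tm S x = top S].
Proof.
case: (nodeP S x) => [|[h1 h2 h3]]; [by left | right]; split => //.
by case: h3 => ->; [right; rewrite subn0 | left; rewrite subnn].
Qed.

Lemma flip_bot_uniq (S : sweep N n) x y :
  top S - tm S x = 0 -> top S - tm S y = 0 ->
  (forall w : 'I_n, between (hl S x) (hl S y) w -> ~~ uw S w) -> x = y.
Proof.
move=> hx hy; apply: top_uniq.
- have := tm_le_top S x; lia.
- have := tm_le_top S y; lia.
Qed.

Lemma flip_top_uniq (S : sweep N n) x y :
  top S - tm S x = top S -> top S - tm S y = top S ->
  (forall w : 'I_n, between (hl S x) (hl S y) w -> ~~ lw S w) -> x = y.
Proof.
have := top_gt0 S => h0 hx hy; apply: bot_uniq.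
- have := tm_le_top S x; lia.
- have := tm_le_top S y; lia.
Qed.

Lemma flip_bot_ex (S : sweep N n) g : g <= n ->
  exists2 x, top S - tm S x = 0 & forall w : 'I_n, between g (hl S x) w -> ~~ uw S w.
Proof.
move=> /(top_ex S)[x hx hw]; exists x => //.
by rewrite hx subnn.
Qed.

Lemma flip_top_ex (S : sweep N n) g : g <= n ->
  exists2 x, top S - tm S x = top S & forall w : 'I_n, between g (hl S x) w ->
    ~~ lw S w.
Proof.
move=> /(bot_ex S)[x hx hw]; exists x => //.
by rewrite hx subn0.
Qed.

(* Time reversal, which exchanges parents and children. *)
Definition flip (S : sweep N n) : sweep N n :=
  Sweep (hl_vx S) (hr_vx S) (flip_tm_vx S) (@flip_tm_inj S) (flip_nodeP S)
    (@flip_bot_uniq S) (@flip_top_uniq S) (@flip_bot_ex S) (@flip_top_ex S)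
    (top_gt0 S).

Section Def.
Variable S : sweep N n.
(* [w] lies strictly between the gap [g] and the node [x]. *)
Definition blocked (g w : nat) (x : N) := (g <= w < hl S x) || (hr S x <= w < g).
(* The value at [x = vx w] is irrelevant, as [w] never blocks its own node. *)
Definition wall (x : N) (w : 'I_n) :=
  if tm S (vx S w) < tm S x then uw S w else lw S w.
Definition visible (g : nat) (x : N) := [forall w, wall x w ==> ~~ blocked g w x].
(** The predicate [P] is [predT] for a whole tree and [in_piece] for a piece of a cut tree, where
    consecutive nodes may skip nodes lying in other pieces. *)
Definition consecutive (P : pred N) (g : nat) (x y : N) :=
  [&& P x, P y, visible g x, visible g y & (tm S x < tm S y) &&
      [forall z, P z && visible g z ==> ~~ (tm S x < tm S z < tm S y)]].
Definition sweep_edge (x y : N) := [exists g : 'I_n.+1, consecutive predT g x y].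
End Def.

Lemma visibleP S g x : reflect (forall w : 'I_n, wall S x w -> blocked S g w x ->
  False) (visible S g x).
Proof.
apply: (iffP forallP) => H w; last by apply/implyP => h; apply/negP => /(H w h).
by move=> h1 h2; have := H w; rewrite h1 h2.
Qed.

Lemma consecutiveP S (P : pred N) g x y :
  reflect ([/\ P x, P y, visible S g x & visible S g y] /\ tm S x < tm S y /\
     forall z, P z -> visible S g z -> tm S x < tm S z -> tm S z < tm S y -> False)
   (consecutive S P g x y).
Proof.
apply: (iffP and5P) => [[h1 h2 h3 h4 /andP[h5 /forallP h6]]|[[h1 h2 h3 h4] [h5 h6]]].
  do 2!split=> //; move=> z pz vz l1 l2; have := h6 z.
  by rewrite pz vz l1 l2.
split=> //; rewrite h5; apply/forallP => z; apply/implyP => /andP[pz vz].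
by apply/negP => /andP[l1 l2]; apply: (h6 z).
Qed.

Lemma flip_lt (S : sweep N n) x y : (tm (flip S) x < tm (flip S) y) = (tm S y < tm S x).
Proof. rewrite /=; have := tm_le_top S x; have := tm_le_top S y; lia. Qed.

Lemma blocked_vx (S : sweep N n) g (i : 'I_n) : blocked S g i (vx S i) = false.
Proof. rewrite /blocked hl_vx hr_vx; lia. Qed.

Lemma tm_vx_eq (S : sweep N n) x (i : 'I_n) : tm S (vx S i) = tm S x -> x = vx S i.
Proof.
case: (nodeP S x) => [[j ->]|[_ _ h]] e.
  by congr vx; apply: (@tm_vx_inj _ _ S).
have := tm_vx S i; rewrite e; case: h => ->; lia.
Qed.

Lemma flip_wall (S : sweep N n) x (w : 'I_n) g : blocked S g w x -> wall (flip S) x w =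
  wall S x w.
Proof.
move=> b; rewrite /wall flip_lt.
case: (ltngtP (tm S x) (tm S (vx S w))) => //= e.
by move: b; rewrite (tm_vx_eq (esym e)) blocked_vx.
Qed.

Lemma flip_visible (S : sweep N n) g x : visible (flip S) g x = visible S g x.
Proof.
apply/visibleP/visibleP => H w h b; apply: (H w) => //.
  by rewrite (@flip_wall S x w g b).
by rewrite -(@flip_wall S x w g b).
Qed.

Lemma flip_consecutive (S : sweep N n) P g x y : consecutive (flip S) P g x y =
  consecutive S P g y x.
Proof.
apply/consecutiveP/consecutiveP => -[[h1 h2 h3 h4] [h5 h6]].
  rewrite flip_lt in h5; rewrite !flip_visible in h3 h4; do 2!split=> //.
  by move=> z pz vz l1 l2; apply: (h6 z); rewrite ?flip_visible ?flip_lt.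
rewrite flip_lt !flip_visible; do 2!split=> //.
by move=> z pz; rewrite flip_visible !flip_lt => vz l1 l2; apply: (h6 z).
Qed.

Lemma flip_sweep_edge (S : sweep N n) x y : sweep_edge (flip S) x y = sweep_edge S y x.
Proof. by apply: eq_existsb => g; rewrite flip_consecutive. Qed.

Section Strand.
Variable S : sweep N n.
Local Notation tm := (tm S).
Local Notation vx := (vx S).
Local Notation visible := (visible S).
Local Notation hl := (hl S).
Local Notation hr := (hr S).
Local Notation wall := (wall S).
Local Notation blocked := (blocked S).
Implicit Types (x y z : N) (g : nat) (w : 'I_n).

(* The walls just after the time [m]. *)
Definition wall_at (m : nat) w := if tm (vx w) <= m then uw S w else lw S w.

Lemma blocked_trans g g' w x : blocked g w x -> blocked g' w x || between g g' w.
Proof. rewrite /blocked /between; lia. Qed.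

Lemma between_sym a b w : between a b w = between b a w.
Proof. by rewrite /between orbC. Qed.

(* The earliest label between the two gaps would be visible from [g]. *)
Lemma strand_idle g g' m y : (forall w : 'I_n, between g g' w -> ~~ wall_at m w) ->
    (forall z, visible g z -> m < tm z -> tm z < tm y -> False) ->
  forall w : 'I_n, between g g' w -> m < tm (vx w) -> tm (vx w) < tm y -> False.
Proof.
move=> Hl Hy w0 b0 m0 y0.
pose Q w := [&& between g g' w, m < tm (vx w) & tm (vx w) < tm y].
have Q0 : Q w0 by rewrite /Q b0 m0 y0.
case: (arg_minnP (fun w => tm (vx w)) Q0) => w /and3P[b1 m1 y1] wmin.
apply: (Hy (vx w)) => //; apply/visibleP => u wu; rewrite /blocked hl_vx hr_vx => bu.
have bb : between g g' u by move: bu b1; rewrite /between; lia.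
have := Hl u bb; rewrite /wall_at.
move: wu; rewrite /wall; case: ifP => [lt uu|ge lu]; case: ifP => //.
- by rewrite uu.
- move=> /negbT; rewrite -ltnNge => mu _.
  have := wmin u; rewrite /Q bb mu (ltn_trans lt y1) => /(_ isT).
  by rewrite leqNgt lt.
- by move=> um; rewrite (leq_ltn_trans um m1) in ge.
- by rewrite lu.
Qed.

(** By [strand_idle] no label between the two gaps is processed after [m] and before [y], so none of
    them becomes a wall in that time and both gaps see the same nodes up to [y]. *)
Lemma strand_next g g' m y : (forall w : 'I_n, between g g' w -> ~~ wall_at m w) ->
    m < tm y -> visible g y ->
    (forall z, visible g z -> m < tm z -> tm z < tm y -> False) ->
  visible g' y /\ (forall z, visible g' z -> m < tm z -> tm z < tm y -> False).
Proof.
move=> Hl my vy Hy; have idle := strand_idle Hl Hy.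
have still z w : m < tm z -> tm z <= tm y -> between g g' w -> vx w != z ->
    ~~ wall z w.
  move=> mz zy b ne; have := Hl w b; rewrite /wall_at /wall.
  case: (leqP (tm (vx w)) m) => wm; first by rewrite (leq_ltn_trans wm mz).
  case: ltnP => // wz _.
  by case: (idle w b wm (leq_trans wz zy)).
have ne g0 w z : blocked g0 w z -> vx w != z.
  by move=> b; apply/eqP => e; rewrite -e blocked_vx in b.
split.
  apply/visibleP => w hw b; case/orP: (blocked_trans g b) => b'.
    by move/visibleP: vy => /(_ w hw b').
  by move/negP: (still y w my (leqnn _) (etrans (between_sym _ _ _) b') (ne _ _ _ b)).
move=> z vz mz zy; apply: (Hy z) => //; apply/visibleP => w hw b.
case/orP: (blocked_trans g' b) => b'.
  by move/visibleP: vz => /(_ w hw b').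
by move/negP: (still z w mz (ltnW zy) b' (ne _ _ _ b)).
Qed.

End Strand.
End Sweep.

(** * The tree of a sweep *)

Section Graph.
Variables (V : finType) (e : rel V).
Definition sadj : rel V := fun x y => e x y || e y x.
Definition avoid (i : V) : rel V := fun x y => [&& sadj x y, x != i & y != i].
Definition acyclic := forall c : seq V, 2 < size c -> ~~ (cycle sadj c && uniq c).

Lemma sadjC x y : sadj x y = sadj y x.
Proof. by rewrite /sadj orbC. Qed.

Lemma avoidC i x y : avoid i x y = avoid i y x.
Proof. by rewrite /avoid sadjC; congr (_ && _); rewrite andbC. Qed.

Lemma avoid_connect_sym i : connect_sym (avoid i).
Proof. by apply: sym_connect_sym => x y; rewrite avoidC. Qed.

Lemma avoid_path_notin i x p : x != i -> path (avoid i) x p -> i \notin x :: p.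
Proof.
elim: p x => [|y p IH] x xi /=; first by rewrite inE eq_sym xi.
case/andP=> /and3P[_ _ yi] /(IH y yi); rewrite !inE => /norP[h1 h2].
by rewrite eq_sym (negbTE xi) (negbTE h1) (negbTE h2).
Qed.

Lemma avoid_sub i : subrel (avoid i) sadj.
Proof. by move=> x y /and3P[]. Qed.

Lemma connect_avoid x a p : x \notin a :: p -> path sadj a p ->
  connect (avoid x) a (last a p).
Proof.
elim: p a => [|b p IH] a /=; first by rewrite connect0.
rewrite inE negb_or => /andP[xa xp] /andP[ab pp].
apply: connect_trans (IH b xp pp); apply: connect1; rewrite /avoid ab eq_sym xa.
by move: xp; rewrite inE negb_or eq_sym => /andP[->].
Qed.

(** A simple path from [p] to [q] avoiding [i] closes up through [i] to a cycle, of length at least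
    3 because [p] and [q] differ. *)
Lemma acyclic_branches i p q : acyclic -> p != q -> p != i ->
  sadj i p -> sadj i q -> connect (avoid i) p q -> False.
Proof.
move=> ac pq pi ip iq /connectP[s0 /shortenP[s ps us _] e0].
have ni := avoid_path_notin pi ps.
have sz : 2 < size (i :: p :: s) by case: s e0 {ps us ni} => //= e0;
  rewrite e0 eqxx in pq.
have /negP := ac _ sz; apply; rewrite cons_uniq ni us /= !andbT ip /=.
by rewrite rcons_path -e0 [sadj q i]sadjC iq (sub_path (@avoid_sub i) ps).
Qed.
End Graph.

(** Transitivity of lying on the same side of a label: [b] and [b'] place the middle node on the
    left and on the right, and it cannot be on both sides. *)
Lemma bool_trans (a b c a' b' c' : bool) : ~~ (b && b') ->
  a && b || a' && b' -> b && c || b' && c' -> a && c || a' && c'.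
Proof. by move: a b c a' b' c' => [] [] [] [] [] []. Qed.

Section Tree.
Variables (N : finType) (n : nat).
Implicit Types (S : sweep N n) (x y z : N) (g : nat) (i w : 'I_n).

Lemma side S g i x : x != vx S i -> ~~ blocked S g i x ->
  (g <= i -> hr S x <= i) /\ (i < g -> i < hl S x).
Proof.
case: (nodeP S x) => [[j ->]|[e _ _] _]; rewrite /blocked ?hl_vx ?hr_vx;
  last by rewrite e; lia.
move=> ne; have : i != j by apply: contraNneq ne => ->.
rewrite -val_eqE /=; lia.
Qed.

Lemma hl_le_hr S x : hl S x <= hr S x <= (hl S x).+1.
Proof. case: (nodeP S x) => [[j ->]|[-> _ _]]; rewrite ?hl_vx ?hr_vx; lia. Qed.

Lemma hr_le S x : hl S x <= n.
Proof.
case: (nodeP S x) => [[j ->]|[-> ? _] //]; rewrite ?hl_vx ?hr_vx.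
exact: ltnW.
Qed.

Lemma wall_at_blocked S g w x : blocked S g w x -> wall_at S (tm S x) w = wall S x w.
Proof.
move=> b; rewrite /wall_at /wall; case: (ltngtP (tm S (vx S w)) (tm S x)) => // e.
by rewrite (tm_vx_eq e) blocked_vx in b.
Qed.

Lemma visible_wall_at S g w x : visible S g x -> blocked S g w x ->
  ~~ wall_at S (tm S x) w.
Proof. by move=> /visibleP v b; rewrite (wall_at_blocked b); apply/negP => h; apply:
  (v w). Qed.

Lemma visible_home S x : visible S (hl S x) x.
Proof. apply/visibleP => w _; rewrite /blocked; have := hl_le_hr S x; lia. Qed.

Lemma visible_vx S i : visible S i (vx S i).
Proof. by have := visible_home S (vx S i); rewrite hl_vx. Qed.

Lemma visible_vxS S i : visible S i.+1 (vx S i).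
Proof. apply/visibleP => w _; rewrite /blocked hl_vx hr_vx; lia. Qed.

Lemma bot_wall S x w : tm S x = 0 -> wall S x w = lw S w.
Proof. by rewrite /wall => ->. Qed.

Lemma top_wall S x w : tm S x = top S -> wall S x w = uw S w.
Proof. by rewrite /wall => ->; have /andP[_ ->] := tm_vx S w. Qed.

Lemma end_node S x : tm S x = 0 \/ tm S x = top S -> hl S x = hr S x.
Proof.
move=> h; case: (nodeP S x) => [[j e]|[-> _ _] //].
move: h; rewrite e; have := tm_vx S j; lia.
Qed.

Lemma visible_bot_uniq S g x y : visible S g x -> visible S g y ->
  tm S x = 0 -> tm S y = 0 -> x = y.
Proof.
move=> /visibleP vx /visibleP vy x0 y0; apply: (bot_uniq x0 y0) => w b.
apply/negP => l; have hx := end_node (or_introl x0); have hy := end_node (or_introl y0).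
have : blocked S g w x || blocked S g w y by move: b;
  rewrite /blocked /between -hx -hy; lia.
by case/orP => h; [apply: (vx w) | apply: (vy w)]; rewrite ?bot_wall.
Qed.

Lemma visible_uniq S g x y : visible S g x -> visible S g y -> tm S x = tm S y -> x = y.
Proof.
move=> vx vy e; case: (nodeP S x) => [[i ex]|[_ _]].
  by rewrite ex; apply/esym/tm_vx_eq; rewrite -ex e.
case=> h; first by apply: (visible_bot_uniq vx vy h); rewrite -e.
apply: (@visible_bot_uniq (flip S) g); rewrite ?flip_visible //= -?e h subnn //.
Qed.

Lemma visible_bot S g : g <= n -> exists2 x, tm S x = 0 & visible S g x.
Proof.
case/(bot_ex S) => x x0 h; exists x => //; apply/visibleP => w.
rewrite bot_wall // => l b; have hx := end_node (or_introl x0).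
suff /h/negP : between g (hl S x) w by apply.
by move: b; rewrite /blocked /between -hx; lia.
Qed.

Lemma visible_top S g : g <= n -> exists2 x, tm S x = top S & visible S g x.
Proof.
move=> gn; have [x /= x0] := visible_bot (flip S) gn; rewrite flip_visible => v.
exists x => //; have := tm_le_top S x; lia.
Qed.

Lemma consecutive_sweep_edge S g x y : g <= n -> consecutive S predT g x y ->
  sweep_edge S x y.
Proof. by move=> gn h; apply/existsP; exists (Ordinal (gn : g < n.+1)). Qed.

Lemma sweep_edgeP S x y : reflect (exists2 g, g <= n &
  consecutive S predT g x y) (sweep_edge S x y).
Proof.
apply: (iffP existsP) => [[g h]|[g h1 h2]]; first by exists g => //; rewrite -ltnS.
by exists (Ordinal (h1 : g < n.+1)).
Qed.

Lemma sweep_edge_lt S x y : sweep_edge S x y -> tm S x < tm S y.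
Proof. by case/sweep_edgeP => g _ /consecutiveP[_ []]. Qed.

Lemma next_ex S (P : pred N) g x y : P x -> P y -> visible S g x -> visible S g y ->
  tm S x < tm S y ->
  exists2 z, consecutive S P g x z & tm S z <= tm S y.
Proof.
move=> px py vx vy xy.
have Q0 : [&& P y, visible S g y & tm S x < tm S y] by rewrite py vy xy.
case: (arg_minnP (P := fun z => [&& P z, visible S g z &
  tm S x < tm S z]) (tm S) Q0) => z /and3P[pz vz xz] zmin.
exists z; last exact: zmin.
apply/consecutiveP; split; [by split | split => // u pu vu xu].
by have := zmin u; rewrite pu vu xu => /(_ isT); rewrite leqNgt => /negP.
Qed.

Lemma consecutive_uniq S P g x y y' : consecutive S P g x y ->
  consecutive S P g x y' -> y = y'.
Proof.
case/consecutiveP => -[_ py _ vy] [xy h] /consecutiveP[[_ py' _ vy'] [xy' h']].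
apply: (visible_uniq vy vy'); case: (ltngtP (tm S y) (tm S y')) => // l.
  by case: (h' y).
by case: (h y').
Qed.

(** The bound on the heads of the edges keeps the path away from [y]; [branch_no_cross] needs this
    to stay in one branch of the vertex [y]. *)
Lemma visible_connect S g x y : g <= n -> visible S g x -> visible S g y ->
  tm S x < tm S y ->
  exists2 z, consecutive S predT g z y &
    connect (fun a b => sweep_edge S a b && (tm S b < tm S y)) x z.
Proof.
move=> gn; have [k le] := ubnP (tm S y - tm S x).
elim: k x le => // k IH x le vx vy xy.
have [z nz zy] := @next_ex S predT g x y isT isT vx vy xy.
have /consecutiveP[[_ _ _ vz] [xz hz]] := nz.
case: (ltngtP (tm S z) (tm S y)) zy => // [zy _|e _].
  have [|u nu cu] := IH z _ vz vy zy; first by lia.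
  exists u => //; apply: connect_trans cu; apply: connect1.
  by rewrite zy (consecutive_sweep_edge gn nz).
by exists x => //; rewrite -(visible_uniq vz vy e).
Qed.

Lemma consecutive_strand S g g' x y : consecutive S predT g x y -> visible S g' x ->
  (forall w, between g g' w -> ~~ wall_at S (tm S x) w) -> consecutive S predT g' x y.
Proof.
case/consecutiveP => [[_ _ vx vy] [xy h]] vx' hl.
have [|vy' h'] := strand_next hl xy vy; first by move=> z; apply: h.
by apply/consecutiveP; split; [split | split=> // z _; apply: h'].
Qed.

(* Otherwise [i], or an earlier label between [i] and [g], would be visible
   from [g] between [x] and [y]. *)
Lemma edge_above_side S i g x y : uw S i -> consecutive S predT g x y ->
    tm S (vx S i) < tm S y -> x != vx S i ->
  (hr S x <= i) && (hr S y <= i) || (i < hl S x) && (i < hl S y).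
Proof.
move=> ui /consecutiveP[[_ _ vgx vgy] [xy h]] iy xi.
have yi : y != vx S i by apply: contraTneq iy => ->; rewrite ltnn.
have by_ : ~~ blocked S g i y.
  by apply/negP => b; move/visibleP: vgy => /(_ i); rewrite /wall iy; apply.
have bx : ~~ blocked S g i x.
  apply/negP => b.
  case: (ltngtP (tm S (vx S i)) (tm S x)) => [ix|ix|/tm_vx_eq e].
  - by move/visibleP: vgx => /(_ i); rewrite /wall ix; apply.
  - have idle g' : (forall w, between g g' w -> blocked S g w x) -> between g g' i ->
    False.
      move=> hb bi; apply: (@strand_idle _ _ S g g' (tm S x) y _ _ i bi ix iy).
        by move=> w /hb; apply: visible_wall_at.
      by move=> z; apply: h.
    case/orP: b => b.
      apply: (idle i.+1) => [w|]; move: b; rewrite /between /blocked; lia.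
    apply: (idle i) => [w|]; move: b; rewrite /between /blocked; lia.
  - by rewrite e eqxx in xi.
have [y1 y2] := side yi by_; have [x1 x2] := side xi bx.
by case: (leqP g i) => gi; [rewrite x1 ?y1 | rewrite x2 ?y2 ?orbT].
Qed.

Lemma edge_below_side S i g x y : lw S i -> consecutive S predT g x y ->
    tm S x < tm S (vx S i) -> y != vx S i ->
  (hr S x <= i) && (hr S y <= i) || (i < hl S x) && (i < hl S y).
Proof.
move=> li h xi yi; have := @edge_above_side (flip S) i g y x li.
by rewrite flip_consecutive flip_lt => /(_ h xi yi) /=; rewrite andbC [(i < _) &&
  _]andbC.
Qed.

(* An edge passing below [i] belongs to the strand through the gap [i]. *)
Lemma edge_below_cross S i g x y : consecutive S predT g x y ->
    (hr S x <= i < hl S y) || (hr S y <= i < hl S x) -> visible S i y.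
Proof.
case/consecutiveP => [[_ _ vgx vgy] [xy h]] c.
have [b|b] := boolP ((g <= i < hl S y) || (hr S y <= i < g)).
  apply/visibleP => w hw bw; move/visibleP: vgy => /(_ w hw); apply.
  by move: b bw; rewrite /blocked; lia.
have [||//] := @strand_next _ _ S g i (tm S x) y _ xy vgy.
  move=> w bw; apply: (visible_wall_at vgx); move: b c bw.
  have := hl_le_hr S y; have := hl_le_hr S x; rewrite /blocked /between; lia.
by move=> z; apply: h.
Qed.

Lemma visible_next S g x : g <= n -> visible S g x -> tm S x < top S ->
  exists y, consecutive S predT g x y.
Proof.
move=> gn vx xt; have [y yt vy] := visible_top S gn.
by have [|z] := @next_ex S predT g x y isT isT vx vy; [rewrite yt | exists z].
Qed.

(** All gaps that see [vx i] from its left follow the same strand upwards from it, that of the gap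
    [i], as no wall just after [i] separates them; likewise on the right with the gap [i.+1]. *)
Lemma vx_next S i : exists p q, [/\ consecutive S predT i (vx S i) p,
  consecutive S predT i.+1 (vx S i) q & forall x, sweep_edge S (vx S i) x = (x == p) ||
    (x == q)].
Proof.
have /andP[_ it] := tm_vx S i.
have [p np] := visible_next (ltnW (ltn_ord i)) (visible_vx S i) it.
have [q nq] := visible_next (ltn_ord i) (visible_vxS S i) it.
exists p, q; split=> // x; apply/idP/orP => [/sweep_edgeP[g gn ng]|[] /eqP->];
  last 2 first.
- exact: consecutive_sweep_edge (ltnW (ltn_ord i)) np.
- exact: consecutive_sweep_edge (ltn_ord i) nq.
have /consecutiveP[[_ _ vgi _] _] := ng.
case: (leqP g i) => gi; [left | right]; apply/eqP.
  apply: (consecutive_uniq _ np); apply: (consecutive_strand ng (visible_vx S i)) =>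
    w b.
  by apply: (visible_wall_at vgi); move: b; rewrite /blocked /between hl_vx hr_vx; lia.
apply: (consecutive_uniq _ nq); apply: (consecutive_strand ng (visible_vxS S i)) => w b.
by apply: (visible_wall_at vgi); move: b; rewrite /blocked /between hl_vx hr_vx; lia.
Qed.

(** Without a wall above [i], the strands through the two gaps around [i] agree after it. *)
Lemma vx_next1 S i : ~~ uw S i -> exists p, forall x, sweep_edge S (vx S i) x = (x ==
  p).
Proof.
move=> ui; have [p [q [np nq e]]] := vx_next S i; exists p => x.
rewrite e; suff -> : q = p by rewrite orbb.
apply: (consecutive_uniq nq); apply: (consecutive_strand np (visible_vxS S i)) => w b.
have -> : w = i by apply: val_inj; move: b; rewrite /between /=; lia.
by rewrite /wall_at leqnn.
Qed.

Lemma vx_next_side S i x : uw S i -> 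
  (consecutive S predT i (vx S i) x -> hr S x <= i) /\
  (consecutive S predT i.+1 (vx S i) x -> i < hl S x).
Proof.
move=> ui; split=> /consecutiveP[[_ _ _ /visibleP v] [l _]].
  have [||h _] := @side S i i x; last exact: h.
    by apply: contraTneq l => ->; rewrite ltnn.
  by apply/negP; apply: v; rewrite /wall l ui.
have [||_ h] := @side S i.+1 i x; last exact: h.
  by apply: contraTneq l => ->; rewrite ltnn.
by apply/negP; apply: v; rewrite /wall l ui.
Qed.

Lemma bot_next S x : tm S x = 0 -> exists p, forall y, sweep_edge S x y = (y == p).
Proof.
move=> x0; have hx := end_node (or_introl x0).
have [|p np] := visible_next (hr_le S x) (visible_home S x);
  first by rewrite x0 top_gt0.
exists p => y; apply/idP/eqP => [/sweep_edgeP[g gn ng]|->]; last exact: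
  consecutive_sweep_edge (hr_le S x) np.
apply: (consecutive_uniq _ np); apply: (consecutive_strand ng (visible_home S x)) =>
  w b.
have /consecutiveP[[_ _ v _] _] := ng; apply: (visible_wall_at v).
by move: b; rewrite /blocked /between -hx; lia.
Qed.

Lemma vx_prev S i : exists p q, [/\ consecutive S predT i p (vx S i),
  consecutive S predT i.+1 q (vx S i) & forall x, sweep_edge S x (vx S i) = (x == p) ||
    (x == q)].
Proof.
have [p [q [h1 h2 h3]]] := vx_next (flip S) i; exists p, q.
by split=> [||x]; [rewrite -flip_consecutive | rewrite -flip_consecutive |
  rewrite -h3 flip_sweep_edge].
Qed.

Lemma vx_prev1 S i : ~~ lw S i -> exists p, forall x, sweep_edge S x (vx S i) = (x ==
  p).
Proof.
move=> /(@vx_next1 (flip S) i)[p h]; exists p => x.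
by rewrite -h flip_sweep_edge.
Qed.

Lemma vx_prev_side S i x : lw S i -> 
  (consecutive S predT i x (vx S i) -> hr S x <= i) /\
  (consecutive S predT i.+1 x (vx S i) -> i < hl S x).
Proof.
by move=> /(@vx_next_side (flip S) i x)[h1 h2]; split=> h;
  [apply: h1|apply: h2]; rewrite flip_consecutive.
Qed.

Lemma top_prev S x : tm S x = top S -> exists p, forall y, sweep_edge S y x = (y == p).
Proof.
move=> xt; have [|p h] := @bot_next (flip S) x; first by rewrite /= xt subnn.
by exists p => y; rewrite -h flip_sweep_edge.
Qed.

(** The latest node of a cycle has two children on it, so it is a vertex with a wall below it, and
    this wall stands during the whole rest of the cycle. By [edge_below_side] no other edge of the
    cycle crosses the wall, yet the two children lie on opposite sides of it. *)
Lemma sweep_edge_acyclic S : acyclic (sweep_edge S).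
Proof.
move=> c sz; apply/negP => /andP[cc uc].
have [x0 x0c] : exists x, x \in c by case: c sz {cc uc} => // x c _; exists x;
  rewrite mem_head.
case: (arg_maxnP (P := fun z => z \in c) (tm S) x0c) => x xc xmax {x0 x0c}.
have [k s es] := rot_to xc.
have {}uc : uniq (x :: s) by rewrite -es rot_uniq.
have {}cc : cycle (sadj (sweep_edge S)) (x :: s) by rewrite -es rot_cycle.
have {}sz : 1 < size s by move: sz; rewrite -(size_rot k) es.
have {}xmax z : z \in s -> tm S z <= tm S x.
  by move=> zs; apply: xmax; rewrite -(mem_rot k) es inE zs orbT.
have child z : z \in s -> sadj (sweep_edge S) x z -> sweep_edge S z x.
  by move=> /xmax le /orP[/sweep_edge_lt|//]; rewrite ltnNge le.
case: s sz uc cc xmax child {es xc} => // y s sz uc cc xmax child.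
have [z [s' es]] : exists z s', s = rcons s' z.
  by case/lastP: s sz {uc cc xmax child} => // s' z _; exists z, s'.
have yz : y != z by move: uc; rewrite es /= mem_rcons !inE; case: (y == z) => //=;
  rewrite andbF.
have ex : sweep_edge S y x by apply: child; [rewrite mem_head | case/andP: cc].
have zx : sweep_edge S z x.
  apply: child; first by rewrite es inE mem_rcons mem_head orbT.
  by move: cc; rewrite es -rcons_cons /cycle rcons_path last_rcons sadjC => /andP[].
have uniq_child : (exists p, forall u, sweep_edge S u x = (u == p)) -> False.
  case=> p h; move: ex zx; rewrite !h => /eqP ey /eqP ez.
  by rewrite ey ez eqxx in yz.
case: (nodeP S x) => [[i xi]|[_ _ [x0|xt]]]; last 2 first.
- by have := sweep_edge_lt ex; rewrite x0.
- by apply: uniq_child; apply: top_prev.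
have [li|nli] := boolP (lw S i); last by apply: uniq_child; rewrite xi; apply: vx_prev1.
have [p [q [np nq h]]] := vx_prev S i.
have [/(_ np) sp _] := vx_prev_side p li.
have [_ /(_ nq) sq] := vx_prev_side q li.
have neq_x u : u \in y :: s -> u != vx S i.
  by move=> us; apply: contraTneq uc => e; rewrite -xi in e; rewrite -e /= us.
have tm_x u : u \in y :: s -> tm S u < tm S (vx S i).
  move=> us; have := xmax u us; rewrite xi leq_eqVlt => /orP[/eqP/esym/tm_vx_eq e|//].
  by have := neq_x u us; rewrite e eqxx.
have step u v : u \in y :: s -> v \in y :: s -> sadj (sweep_edge S) u v ->
    (hr S u <= i) && (hr S v <= i) || (i < hl S u) && (i < hl S v).
  move=> us vs /orP[] /sweep_edgeP[g _ ng].
    by apply: (edge_below_side li ng) => //; [apply: tm_x | apply: neq_x].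
  rewrite andbC [(i < _) && _]andbC.
  by apply: (edge_below_side li ng) => //; [apply: tm_x | apply: neq_x].
have same u t : {subset u :: t <= y :: s} -> path (sadj (sweep_edge S)) u t ->
    (hr S u <= i) && (hr S (last u t) <= i) || (i < hl S u) && (i < hl S (last u t)).
  elim: t u => [|v t IH] u sub /=.
    have us := sub u (mem_head _ _); have := neq_x u us.
    case: (nodeP S u) => [[j ->]|[-> _ _] _]; last by case: leqP.
    rewrite hr_vx hl_vx => ne; have : j != i by apply: contraNneq ne => ->.
    by rewrite -val_eqE /=; clear; lia.
  case/andP => uv pt; have vs : v \in y :: s by apply: sub; rewrite !inE eqxx orbT.
  have sub' : {subset v :: t <= y :: s} by move=> w ws; apply: sub; rewrite inE ws orbT.
  have vb : ~~ ((hr S v <= i) && (i < hl S v)) by move: (hl_le_hr S v); clear; lia.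
  apply: (bool_trans vb); first exact: (step u v (sub _ (mem_head _ _)) vs uv).
  exact: IH.
have := same y s (fun _ => id).
have -> : path (sadj (sweep_edge S)) y s by move: cc => /=; rewrite rcons_path =>
  /and3P[].
rewrite es last_rcons => /(_ isT).
have := hl_le_hr S p; have := hl_le_hr S q.
move: ex zx yz; rewrite xi !h => /orP[] /eqP-> /orP[] /eqP->; rewrite ?eqxx //; move:
  sp sq; clear; lia.
Qed.

(* A crossing edge lies below [i] on a directed path to [i], so reaching it from
   a parent of [i] would close a cycle. *)
Lemma branch_no_cross S i p x y : uw S i -> sweep_edge S (vx S i) p ->
    connect (avoid (sweep_edge S) (vx S i)) p x -> avoid (sweep_edge S) (vx S i) x y ->
  ~~ ((hr S x <= i < hl S y) || (hr S y <= i < hl S x)).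
Proof.
move=> ui ip cx xy; apply/negP => cross.
have pi : p != vx S i by apply: contraTneq (sweep_edge_lt ip) => ->; rewrite ltnn.
have [u [v [uv cu ui' vi cv]]] : exists u v, [/\ sweep_edge S u v,
    (hr S u <= i < hl S v) || (hr S v <= i < hl S u), u != vx S i, v != vx S i
    & connect (avoid (sweep_edge S) (vx S i)) p v].
  have cy := connect_trans cx (connect1 xy).
  case/and3P: xy => /orP[xy|yx] xi yi; [exists x, y | exists y, x]; split=> //.
  by rewrite orbC.
have [g gn ng] := sweep_edgeP _ _ _ uv.
case: (ltngtP (tm S (vx S i)) (tm S v)) => [iv|iv|/tm_vx_eq e].
- have := edge_above_side ui ng iv ui'; have := hl_le_hr S u; have := hl_le_hr S v.
  by move: cu; clear; lia.
- have vv := edge_below_cross ng cu.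
  have [c nc cc] := visible_connect (ltnW (ltn_ord i)) vv (visible_vx S i) iv.
  have ci := consecutive_sweep_edge (ltnW (ltn_ord i)) nc.
  apply: (@acyclic_branches _ (sweep_edge S) (vx S i) p c (@sweep_edge_acyclic S) _ pi).
  + apply: contraTneq (sweep_edge_lt ip) => ->; rewrite -leqNgt ltnW //.
    exact: sweep_edge_lt ci.
  + by rewrite /sadj ip.
  + by rewrite /sadj ci orbT.
  apply: connect_trans cv _; move: cc; case/connectP => s ps ->.
  elim: s v vi {uv cu iv vv ng} ps => [|b s IH] v vi /=; first by rewrite connect0.
  case/andP => /andP[vb bi] ps; apply: connect_trans (IH b _ ps); last first.
    by apply: contraTneq bi => ->; rewrite ltnn.
  apply: connect1; rewrite /avoid /sadj vb vi /=.
  by apply: contraTneq bi => ->; rewrite ltnn.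
- by rewrite e eqxx in vi.
Qed.

Lemma branch_side S i p x : uw S i -> sweep_edge S (vx S i) p ->
    connect (avoid (sweep_edge S) (vx S i)) p x ->
  (hr S p <= i -> hr S x <= i) /\ (i < hl S p -> i < hl S x).
Proof.
move=> ui ip; have pi : p != vx S i by apply: contraTneq (sweep_edge_lt ip) => ->;
  rewrite ltnn.
have sided u : u != vx S i -> (hr S u <= i) || (i < hl S u).
  case: (nodeP S u) => [[j ->]|[-> _ _] _]; last by case: leqP.
  rewrite hr_vx hl_vx => ne; have : j != i by apply: contraNneq ne => ->.
  by rewrite -val_eqE /=; clear; lia.
case/connectP => s ps ->; elim/last_ind: s ps => [//|s v IH].
rewrite rcons_path last_rcons => /andP[ps lv].
have [h1 h2] := IH ps; have cl : connect (avoid (sweep_edge S) (vx S i)) p (last p s).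
  by apply/connectP; exists s.
have := branch_no_cross ui ip cl lv; have /and3P[_ _ /sided] := lv.
have := hl_le_hr S v; have := hl_le_hr S (last p s).
by split=> [/h1|/h2]; lia.
Qed.

Lemma vx_parents S i : uw S i -> exists p q, [/\ p != q,
  forall x, sweep_edge S (vx S i) x = (x == p) || (x == q),
  forall x, connect (avoid (sweep_edge S) (vx S i)) p x -> hr S x <= i &
  forall x, connect (avoid (sweep_edge S) (vx S i)) q x -> i < hl S x].
Proof.
move=> ui; have [p [q [np nq h]]] := vx_next S i; exists p, q.
have [/(_ np) sp _] := vx_next_side p ui.
have [_ /(_ nq) sq] := vx_next_side q ui.
split=> // [|x cx|x cx].
- apply: contraTneq sp => ->; have := hl_le_hr S q; lia.
- by have [|/(_ sp)] := branch_side ui _ cx; rewrite ?h ?eqxx.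
- by have [|_ /(_ sq)] := branch_side ui _ cx; rewrite ?h ?eqxx ?orbT.
Qed.

Lemma flip_sadj S : sadj (sweep_edge (flip S)) =2 sadj (sweep_edge S).
Proof. by move=> x y; rewrite /sadj !flip_sweep_edge orbC. Qed.

Lemma vx_children S i : lw S i -> exists p q, [/\ p != q,
  forall x, sweep_edge S x (vx S i) = (x == p) || (x == q),
  forall x, connect (avoid (sweep_edge S) (vx S i)) p x -> hr S x <= i &
  forall x, connect (avoid (sweep_edge S) (vx S i)) q x -> i < hl S x].
Proof.
move=> li; have [p [q [h1 h2 h3 h4]]] := @vx_parents (flip S) i li; exists p, q.
have ae x : connect (avoid (sweep_edge S) (vx S i)) x =1
            connect (avoid (sweep_edge (flip S)) (vx S i)) x.
  by apply: eq_connect => a b; rewrite /avoid flip_sadj.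
by split=> // x; rewrite ?ae; [rewrite -h2 flip_sweep_edge | apply: h3 | apply: h4].
Qed.

(** The gaps [g] and [g.+1] both see the vertex of the label [g], which joins their strands; every
    node is on the strand of its own position. *)
Lemma sweep_edge_connected S x y : connect (sadj (sweep_edge S)) x y.
Proof.
have sc : connect_sym (sadj (sweep_edge S)) by apply: sym_connect_sym; apply: sadjC.
have lt g u v : g <= n -> visible S g u -> visible S g v -> tm S u < tm S v ->
    connect (sadj (sweep_edge S)) u v.
  move=> gn vu vv uv; have [z nz cz] := visible_connect gn vu vv uv.
  apply: connect_trans (_ : connect _ z v); last first.
    by apply: connect1; rewrite /sadj (consecutive_sweep_edge gn nz).
  by apply: connect_sub cz => a b /andP[ab _]; rewrite connect1 // /sadj ab.
have same g u v : g <= n -> visible S g u -> visible S g v ->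
  connect (sadj (sweep_edge S)) u v.
  move=> gn vu vv; case: (ltngtP (tm S u) (tm S v)) => [uv|vu'|e].
  - exact: (lt g).
  - by rewrite sc; apply: (lt g).
  - by rewrite (visible_uniq vu vv e).
have all0 g u v : g <= n -> visible S 0 u -> visible S g v ->
  connect (sadj (sweep_edge S)) u v.
  elim: g v => [|g IH] v gn vu vv; first exact: (same 0).
  apply: connect_trans (IH _ (ltnW gn) vu (visible_vx S (Ordinal gn))) _.
  exact: (same g.+1 _ _ gn (visible_vxS S (Ordinal gn)) vv).
have [b _ vb] := visible_bot S (leq0n n).
by apply: (@connect_trans _ _ b); [rewrite sc|]; apply: all0 (visible_home _ _);
  rewrite ?hr_le.
Qed.

Lemma sweep_edge_asym S x y : sweep_edge S x y -> ~~ sweep_edge S y x.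
Proof. by move/sweep_edge_lt => h; apply/negP => /sweep_edge_lt;
  rewrite ltnNge ltnW. Qed.

End Tree.

(** * The sweep of a decoration *)

Section Rank.
Variables (P : pred deco) (d : seq deco).
Local Notation rank := (rank P d).

Lemma rank0 : rank 0 = 0. Proof. by rewrite /Defs.rank take0. Qed.

Lemma rank_size : rank (size d) = count P d.
Proof. by rewrite /Defs.rank take_size. Qed.

Lemma rankS g : g < size d -> rank g.+1 = rank g + P (letter d g).
Proof.
by move=> gd; rewrite /Defs.rank (take_nth DecoN gd) -cats1 count_cat /= addn0.
Qed.

Lemma leq_rank g g' : g <= g' -> rank g <= rank g'.
Proof.
move=> gg; rewrite /Defs.rank -(subnKC gg) takeD count_cat.
exact: leq_addr.
Qed.

Lemma rank_le_count g : rank g <= count P d.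
Proof.
case: (leqP g (size d)) => h; first by rewrite -rank_size leq_rank.
by rewrite /Defs.rank take_oversize // ltnW.
Qed.

Lemma rank_lt g w g' : g <= w -> w < g' -> w < size d -> P (letter d w) ->
  rank g < rank g'.
Proof.
move=> gw wg wd pw; apply: leq_trans (leq_rank wg).
by rewrite rankS // pw addn1 ltnS leq_rank.
Qed.

Lemma rank_step g g' : g <= g' -> g' <= size d -> rank g < rank g' ->
  exists w : 'I_(size d), [/\ g <= w < g', P (letter d w) & rank w = rank g].
Proof.
elim: g' => [|g' IH]; first by rewrite leqn0 => /eqP->; rewrite ltnn.
rewrite leq_eqVlt => /orP[/eqP->|]; first by rewrite ltnn.
rewrite ltnS => gg gd; rewrite rankS //.
case: (ltngtP (rank g) (rank g')) => [lt|gt|e]; last first.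
- case pw: (P _); last by rewrite e addn0 ltnn.
  by exists (Ordinal gd); rewrite /= gg leqnn pw e.
- by have := leq_rank gg; rewrite leqNgt gt.
- have [w [h1 h2 h3] _] := IH gg (ltnW gd) lt.
  by exists w; split=> //; case/andP: h1 => -> /= h; rewrite ltnW.
Qed.

Lemma rank_eqP g g' : g <= size d -> g' <= size d ->
  (rank g = rank g') <-> (forall w : 'I_(size d), between g g' w -> ~~ P (letter d w)).
Proof.
wlog gg : g g' / g <= g' => [H|].
  move=> h h'; case: (leqP g g') => gg; first exact: H.
  have [H1 H2] := H g' g (ltnW gg) h' h.
  split=> [e w|H0]; first by rewrite between_sym; apply: H1.
  by apply/esym/H2 => w; rewrite between_sym; apply: H0.
move=> gd gd'; split=> [e w|H].
  rewrite /between => /orP[/andP[gw wg]|]; last by lia.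
  by apply/negP => /(rank_lt gw wg (ltn_ord w)); rewrite e ltnn.
have := leq_rank gg; rewrite leq_eqVlt => /orP[/eqP//|lt].
have [w [gw pw _]] := rank_step gg gd' lt.
by have := H w; rewrite /between gw pw => /(_ isT).
Qed.

(** The leftmost gap of the interval number [l], taken as the position of the leaf [l] in the
    sweep. *)
Definition hgap (l : nat) := find (fun g => rank g == l) (iota 0 (size d).+1).

Lemma hgapP l : l <= count P d -> hgap l <= size d /\ rank (hgap l) = l.
Proof.
move=> lc; have h : has (fun g => rank g == l) (iota 0 (size d).+1).
  apply/hasP; have : exists g, l <= rank g by exists (size d); rewrite rank_size.
  move/ex_minnP => [g lg gmin]; have gd : g <= size d by apply: gmin; rewrite rank_size.
  exists g; first by rewrite mem_iota.
  case: g lg gmin gd => [|g] lg gmin gd; first by rewrite eqn_leq lg rank0.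
  have : ~~ (l <= rank g) by apply/negP => /gmin; rewrite ltnn.
  move: lg; rewrite rankS //; case: (P _) => /=; lia.
have lt := h; rewrite has_find size_iota in lt.
have := nth_find 0 h; rewrite nth_iota // add0n => /eqP e.
by split.
Qed.

(** Translates the comparisons of leaf numbers in [before] and [after] into comparisons of
    positions. *)
Lemma rank_hgap_lt l w : l <= count P d -> w < size d -> P (letter d w) ->
  (l <= rank w) = (hgap l <= w).
Proof.
move=> lc wd pw; have [hd e] := hgapP lc.
case: (leqP (hgap l) w) => h; first by rewrite -e leq_rank.
by apply/negbTE; rewrite -ltnNge -e (rank_lt (leqnn w) h).
Qed.

End Rank.

Section NodeSweep.
Variables (d : seq deco) (s : seq nat).
Hypothesis perm_s : perm_eq s (iota 0 (size d)).

Definition nhl (x : node d) : nat := match x with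
  | Down l => hgap is_down d l | Vert i => i | Up l => hgap is_up d l end.
Definition nhr (x : node d) : nat := match x with
  | Down l => hgap is_down d l | Vert i => i.+1 | Up l => hgap is_up d l end.
Definition ntm (x : node d) : nat := match x with
  | Down l => 0 | Vert i => (index (i : nat) s).+1 | Up l => (size d).+1 end.

Lemma mem_perm_s (i : 'I_(size d)) : (i : nat) \in s.
Proof. by rewrite (perm_mem perm_s) mem_iota ltn_ord. Qed.

Lemma size_perm_s : size s = size d.
Proof. by rewrite (perm_size perm_s) size_iota. Qed.

Lemma ntm_vx i : 0 < ntm (Vert i) < (size d).+1.
Proof. by rewrite /= ltnS -[X in _ < X]size_perm_s index_mem mem_perm_s. Qed.

Lemma ntm_inj : injective (fun i => ntm (Vert i)).
Proof.
move=> i j [e]; apply: val_inj; rewrite -[LHS](nth_index 0 (mem_perm_s i)) e.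
by rewrite nth_index ?mem_perm_s.
Qed.

Lemma leaf_le c (l : 'I_c.+1) : l <= c. Proof. by rewrite -ltnS. Qed.

Lemma nnodeP (x : node d) : (exists i, x = Vert i) \/
  [/\ nhl x = nhr x, nhr x <= size d & ntm x = 0 \/ ntm x = (size d).+1].
Proof.
case: x => [l|i|l]; [right|left; by exists i|right]; split=> //=; auto;
  by have [] := hgapP (leaf_le l).
Qed.

Lemma nbot_uniq (x y : node d) : ntm x = 0 -> ntm y = 0 ->
  (forall w : 'I_(size d), between (nhl x) (nhl y) w -> ~~ is_down (letter d w)) -> x =
    y.
Proof.
case: x => // l; case: y => //= l' _ _ h; congr Down; apply: val_inj => /=.
have [h1 <-] := hgapP (leaf_le l); have [h2 <-] := hgapP (leaf_le l').
exact/rank_eqP.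
Qed.

Lemma ntop_uniq (x y : node d) : ntm x = (size d).+1 -> ntm y = (size d).+1 ->
  (forall w : 'I_(size d), between (nhl x) (nhl y) w -> ~~ is_up (letter d w)) -> x = y.
Proof.
have nv i : ntm (Vert i) <> (size d).+1 by have := ntm_vx i; lia.
case: x => [//|i /nv//|l]; case: y => [//|i _ /nv//|l'] /= _ _ h.
congr Up; apply: val_inj => /=.
have [h1 <-] := hgapP (leaf_le l); have [h2 <-] := hgapP (leaf_le l').
exact/rank_eqP.
Qed.

Lemma nbot_ex g : g <= size d -> exists2 x, ntm x = 0 &
  forall w : 'I_(size d), between g (nhl x) w -> ~~ is_down (letter d w).
Proof.
move=> gd; exists (Down (inord (rank is_down d g))) => //=; apply/rank_eqP => //.
  by have [] := hgapP (leaf_le (inord (rank is_down d g) : 'I_(count is_down d).+1)).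
have [_ ->] := hgapP (leaf_le (inord (rank is_down d g) : 'I_(count is_down d).+1)).
by rewrite inordK // ltnS rank_le_count.
Qed.

Lemma ntop_ex g : g <= size d -> exists2 x, ntm x = (size d).+1 &
  forall w : 'I_(size d), between g (nhl x) w -> ~~ is_up (letter d w).
Proof.
move=> gd; exists (Up (inord (rank is_up d g))) => //=; apply/rank_eqP => //.
  by have [] := hgapP (leaf_le (inord (rank is_up d g) : 'I_(count is_up d).+1)).
have [_ ->] := hgapP (leaf_le (inord (rank is_up d g) : 'I_(count is_up d).+1)).
by rewrite inordK // ltnS rank_le_count.
Qed.

Definition nsweep : sweep (node d) (size d) :=
  @Sweep _ _ (@Vert d) nhl nhr ntm (size d).+1
    (fun w => is_down (letter d w)) (fun w => is_up (letter d w))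
    (fun=> erefl) (fun=> erefl) ntm_vx ntm_inj nnodeP nbot_uniq ntop_uniq
    nbot_ex ntop_ex isT.

Local Notation S := nsweep.

Lemma before_home (i : 'I_(size d)) x : hr S x <= i -> before i x.
Proof.
by case: x => [l|j|l] //= h; apply/implyP => p; rewrite rank_hgap_lt ?leaf_le.
Qed.

Lemma after_home (i : 'I_(size d)) x : i < hl S x -> after i x.
Proof.
by case: x => [l|j|l] //= h; apply/implyP => p;
  rewrite ltnNge rank_hgap_lt ?leaf_le // -ltnNge.
Qed.

(** For a leaf, [before] is vacuous unless [w] has the decoration of the matching kind; a wall at
    the time of the leaf has it, so the comparison becomes exact. *)
Lemma wall_before (w : 'I_(size d)) x : wall S x w -> before w x = (hr S x <= w).
Proof.
case: x => [l|j|l] //=; rewrite /wall /=.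
  by move=> h; rewrite h rank_hgap_lt ?leaf_le.
by have /= -> := ntm_vx w => h; rewrite h rank_hgap_lt ?leaf_le.
Qed.

Lemma wall_after (w : 'I_(size d)) x : wall S x w -> after w x = (w < hl S x).
Proof.
case: x => [l|j|l] //=; rewrite /wall /=.
  by move=> h; rewrite h ltnNge rank_hgap_lt ?leaf_le // -ltnNge.
by have /= -> := ntm_vx w => h; rewrite h ltnNge rank_hgap_lt ?leaf_le // -ltnNge.
Qed.

Lemma visible_Down g l : g <= size d -> visible S g (Down l) = (rank is_down d g == l).
Proof.
move=> gd; have [hd hl] := hgapP (leaf_le l).
apply/visibleP/eqP => [h|h w].
  rewrite -hl; apply/rank_eqP => // w b; apply/negP => p.
  exact: (h w).
rewrite /wall /= => p b; rewrite -hl in h.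
by have /rank_eqP/(_ w b)/negP := h; apply.
Qed.

Lemma visible_Up g l : g <= size d -> visible S g (Up l) = (rank is_up d g == l).
Proof.
move=> gd; have [hd hl] := hgapP (leaf_le l).
apply/visibleP/eqP => [h|h w].
  rewrite -hl; apply/rank_eqP => // w b; apply/negP => p.
  by apply: (h w) => //; rewrite top_wall.
rewrite top_wall //= => p b; rewrite -hl in h.
by have /rank_eqP/(_ w b)/negP := h; apply.
Qed.

Lemma permutree_sweep : permutree (Pretree (sweep_edge S)).
Proof.
split.
- split; [exact: sweep_edge_connected | exact: sweep_edge_asym | exact:
  sweep_edge_acyclic].
- move=> i; rewrite /neighbors_ok; case: ifP => ui.
    have [p [q [h1 h2 h3 h4]]] := @vx_parents _ _ S i ui; exists p, q; split=> // x.
      by move/h3/before_home.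
    by move/h4/after_home.
  by have [p h] := @vx_next1 _ _ S i (negbT ui); exists p.
- move=> i; rewrite /neighbors_ok; case: ifP => ui.
    have [p [q [h1 h2 h3 h4]]] := @vx_children _ _ S i ui; exists p, q; split=> // x.
      by move/h3/before_home.
    by move/h4/after_home.
  by have [p h] := @vx_prev1 _ _ S i (negbT ui); exists p.
- move=> l; split; first exact: (@bot_next _ _ S (Down l)).
  by move=> x; apply/negP => /sweep_edge_lt.
- move=> l; split; first exact: (@top_prev _ _ S (Up l)).
  by move=> x; apply/negP => /sweep_edge_lt; rewrite ltnNge (tm_le_top S x).
Qed.

End NodeSweep.

(** * Edges of a permutree *)

Section Turn.
Variables (T : pretree) (r : rel (node (decor T))) (two : pred 'I_(size (decor T))).
Local Notation d := (decor T).
Implicit Types (x y z u c : node d) (v : 'I_(size d)).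

Hypothesis r_adj : forall x y, sadj r x y = adj x y.
Hypothesis r_neighbors : forall v, neighbors_ok v (r (Vert v)) (two v).
Hypothesis r_leaf : forall x, (forall v, x <> Vert v) ->
  forall y z, r x y -> r x z -> y = z.

Definition sep v x y := before v x && after v y || after v x && before v y.

Lemma subtree_path v c p : path (@adj T) c p -> Vert v \notin c :: p ->
  subtree v c (last c p).
Proof.
by move=> pp nv; apply: (connect_avoid (e := edge T) nv pp).
Qed.

Lemma subtree_sym v c z : subtree v c z = subtree v z c.
Proof.
apply: sym_connect_sym => x y; rewrite /adj orbC; congr (_ && _); exact: andbC.
Qed.

Lemma path_r_adj x p : path r x p -> path (@adj T) x p.
Proof. by apply: sub_path => a b ab; rewrite -r_adj /sadj ab. Qed.

Lemma branch_one v c : two v -> r (Vert v) c ->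
  (forall z, subtree v c z -> before v z) \/ (forall z, subtree v c z -> after v z).
Proof.
move=> tv vc; have := r_neighbors v; rewrite /neighbors_ok tv => -[p [q [_ h bp aq]]].
by move: vc; rewrite h => /orP[]/eqP->; [left | right].
Qed.

Lemma branch_two x u c : r x u -> r x c -> u != c -> exists v, [/\ x = Vert v, two v &
  forall a b, subtree v u a -> subtree v c b -> sep v a b].
Proof.
move=> xu xc uc; case: x xu xc => [l|v|l] xu xc.
- by rewrite (r_leaf _ xu xc) ?eqxx in uc.
- exists v; have := r_neighbors v; rewrite /neighbors_ok; case: ifP => tv; last first.
    case=> p h; move: xu xc uc; rewrite !h => /eqP-> /eqP->.
    by rewrite eqxx.
  case=> p [q [_ h bp aq]]; split=> // a b.
  move: xu xc uc; rewrite !h => /orP[]/eqP-> /orP[]/eqP->; rewrite ?eqxx // => _ ha hb.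
    by rewrite /sep (bp _ ha) (aq _ hb).
  by rewrite /sep (aq _ ha) (bp _ hb) orbT.
- by rewrite (r_leaf _ xu xc) ?eqxx in uc.
Qed.

(* The vertex produced is the last turning point of the path, counted from [x]. *)
Lemma path_turn z p x y q : path (@adj T) z p -> last z p = x -> path r x (y :: q) ->
    uniq (z :: p ++ y :: q) ->
  connect r z x \/ exists v, [/\ two v, Vert v != z, connect r (Vert v) x &
    sep v z (last y q)].
Proof.
(* The directed part [y :: q] is extended backwards along the path until an edge points the wrong
   way; the node reached then has two distinct [r]-neighbors on the path. *)
elim/last_ind: p x y q => [|p x' IH] x y q; first by move=> _ /= ->; left; apply:
  connect0.
rewrite rcons_path last_rcons => /andP[pp ux] <- {x} pr un.
set x := x' in ux pr un; set u := last z p in ux.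
have {}un : uniq (z :: p ++ x :: y :: q) by rewrite -cat_rcons.
have [rux|nrux] := boolP (r u x).
  have [|cz|[v [h1 h2 h3 h4]]] := IH u x (y :: q) pp erefl _ un.
  - by rewrite /= rux.
  - by left; apply: connect_trans cz (connect1 rux).
  - by right; exists v; split=> //; apply: connect_trans h3 (connect1 rux).
have rxu : r x u by move: ux; rewrite -r_adj /sadj (negbTE nrux).
have rxy : r x y by case/andP: pr.
move: un; rewrite -cat_cons cat_uniq => /and3P[u1 /hasPn u2 u3].
have uin : u \in z :: p by apply: mem_last.
have uy : u != y.
  by apply: contraTneq uin => ->; apply: u2; rewrite !inE eqxx orbT.
have [v [xv tv sv]] := branch_two rxu rxy uy; right; exists v.
have vzp : Vert v \notin z :: p by rewrite -xv; apply: u2; rewrite mem_head.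
split=> //; first by apply: contraNneq vzp => ->; rewrite mem_head.
  by rewrite -xv; apply: connect0.
apply: sv; first by rewrite subtree_sym; apply: subtree_path.
apply: subtree_path; first by apply: path_r_adj; case/andP: pr.
by rewrite -xv; case/andP: u3.
Qed.

Hypothesis r_acyclic : forall x y, r x y -> ~~ connect r y x.

(* Both ends of an arc lie in the same branch above a vertex below it. *)
Lemma same_branch v x y : two v -> Vert v != x -> connect r (Vert v) x -> r x y ->
  before v x && before v y || after v x && after v y.
Proof.
move=> tv vx /connectP[p0 /shortenP[p pp up _] ex] xy.
case: p pp up ex => [|c p] /=; first by move=> _ _ e; rewrite e eqxx in vx.
case/andP=> vc pp /andP[vn up] ex.
have sx : subtree v c x by rewrite ex; apply: subtree_path => //; apply: path_r_adj.
have yv : Vert v != y.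
  apply: contraTneq (r_acyclic xy) => <-; rewrite negbK.
  by apply: connect_trans (connect1 vc) _; rewrite ex; apply/connectP; exists p.
have sy : subtree v c y.
  apply: connect_trans sx (connect1 _); rewrite -r_adj /sadj xy /=.
  by rewrite ![_ == Vert v]eq_sym vx yv.
by case: (branch_one tv vc) => h; rewrite !h // orbT.
Qed.
End Turn.

(** * A permutree is the tree of the sweep of any of its linear extensions *)

Section Permutree.
Variables (T : pretree) (s : seq nat).
Local Notation d := (decor T).
Local Notation e := (edge T).
Hypotheses (pT : permutree T) (perm_s : perm_eq s (iota 0 (size d))).
Hypothesis ext_s : forall i j : 'I_(size d), e (Vert i) (Vert j) ->
  index (i : nat) s < index (j : nat) s.
Local Notation S := (nsweep perm_s).
Local Notation up v := (is_up (letter d v)).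
Local Notation down v := (is_down (letter d v)).
Local Notation ec := (fun x y => e y x).
Implicit Types (x y z : node d) (g : nat) (v w : 'I_(size d)).

Lemma edge_tm x y : e x y -> tm S x < tm S y.
Proof.
case: pT => _ _ _ hD hU; case: x => [l|i|l]; case: y => [l'|j|l'] // h.
- by have [_ /(_ (Down l))] := hD l'; rewrite h.
- by have [_ /(_ (Vert i))] := hD l'; rewrite h.
- exact: ext_s.
- by rewrite /= ltnS; have /andP[_ ] := ntm_vx perm_s i.
- by have [_ /(_ (Down l'))] := hU l; rewrite h.
- by have [_ /(_ (Vert j))] := hU l; rewrite h.
- by have [_ /(_ (Up l'))] := hU l; rewrite h.
Qed.

Lemma connect_tm x y : connect e x y -> tm S x <= tm S y.
Proof.
case/connectP => p; elim: p x => [|z p IH] x /=; first by move=> _ ->.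
by case/andP => /edge_tm xz pp ey; apply: leq_trans (ltnW xz) (IH _ pp ey).
Qed.

Lemma connect_ec x y : connect ec x y = connect e y x.
Proof. exact: (connect_rev e). Qed.

Lemma edge_acyclic x y : e x y -> ~~ connect e y x.
Proof. by move/edge_tm => h; apply/negP => /connect_tm; rewrite leqNgt h. Qed.

Lemma ec_acyclic x y : ec x y -> ~~ connect ec y x.
Proof. by rewrite connect_ec; apply: edge_acyclic. Qed.

Lemma up_neighbors v : neighbors_ok v (e (Vert v)) (up v).
Proof. by case: pT. Qed.

Lemma down_neighbors v : neighbors_ok v (ec (Vert v)) (down v).
Proof. by case: pT. Qed.

Lemma up_leaf x : (forall v, x <> Vert v) -> forall y z, e x y -> e x z -> y = z.
Proof.
case: pT => _ _ _ hD hU; case: x => [l|i|l] h y z; last 2 first.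
- by case: (h i).
- by have [_ /(_ y)/negbTE->] := hU l.
by have [[p hp] _] := hD l; rewrite !hp => /eqP-> /eqP->.
Qed.

Lemma down_leaf x : (forall v, x <> Vert v) -> forall y z, ec x y -> ec x z -> y = z.
Proof.
case: pT => _ _ _ hD hU; case: x => [l|i|l] h y z.
- by have [_ /(_ y)/negbTE->] := hD l.
- by case: (h i).
by have [[p hp] _] := hU l; rewrite !hp => /eqP-> /eqP->.
Qed.

Lemma e_adj x y : sadj e x y = adj x y. Proof. by []. Qed.
Lemma ec_adj x y : sadj ec x y = adj x y. Proof. exact: orbC. Qed.

(* The relation [e], resp. its converse, is used when the path from [w] reaches
   the edge at its lower end [x], resp. at its upper end [y]. *)
Lemma edge_sep x y w : e x y -> Vert w != x -> Vert w != y ->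
  [\/ connect e (Vert w) x, connect e y (Vert w),
      exists v, [/\ up v, connect e (Vert v) x & sep v (Vert w) y] |
      exists v, [/\ down v, connect e y (Vert v) & sep v (Vert w) x]].
Proof.
move=> xy wx wy.
have [[/(_ (Vert w) x)/connectP[p0 /shortenP[p pp up _] ex] _ _] _ _ _ _] := pT.
have xny : x != y by apply: contraTneq (edge_tm xy) => ->; rewrite ltnn.
have [yp|ynp] := boolP (y \in Vert w :: p).
  case/splitPl: yp ex pp up => p1 p2 ly; rewrite last_cat ly => ex.
  rewrite cat_path => /andP[pp1 _] up.
  have xp2 : x \in p2.
    by case: p2 ex {up} => [e0|a b -> ] /=; [rewrite e0 eqxx in xny | rewrite mem_last].
  have u1 : uniq (Vert w :: p1 ++ [:: x]).
    rewrite -cat_cons cats1 rcons_uniq; move: up; rewrite -cat_cons cat_uniq.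
    case/and3P => -> /hasPn/(_ x xp2) nx _; by rewrite andbT.
  have [| |h] := path_turn ec_adj down_neighbors down_leaf pp1 ly _ u1.
  - by rewrite /= xy.
  - by rewrite connect_ec => h; apply: Or42.
  - case: h => v [h1 _ h2 h3]; apply: Or44; exists v; split=> //.
    by rewrite -connect_ec.
have u1 : uniq (Vert w :: p ++ [:: y]).
  by rewrite -cat_cons cats1 rcons_uniq ynp.
have [| |h] := path_turn e_adj up_neighbors up_leaf pp (esym ex) _ u1.
- by rewrite /= xy.
- by move=> h; apply: Or41.
- by case: h => v [h1 _ h2 h3]; apply: Or43; exists v.
Qed.

Lemma not_same_side v x y : wall S x v -> wall S y v ->
    before v x && before v y || after v x && after v y ->
  ~~ ((hr S x <= v < hl S y) || (hr S y <= v < hl S x)).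
Proof.
move=> wx wy; rewrite (wall_before wx) (wall_before wy) (wall_after wx) (wall_after wy).
have := hl_le_hr S x; have := hl_le_hr S y; clear; lia.
Qed.

Lemma up_wall v x : up v -> tm S (Vert v) < tm S x -> wall S x v.
Proof. by rewrite /wall => uv ->. Qed.

Lemma down_wall v x : down v -> tm S x < tm S (Vert v) -> wall S x v.
Proof. by rewrite /wall => dv /ltnW; rewrite leqNgt => /negbTE->. Qed.

Lemma up_no_cross v x y : e x y -> up v -> connect e (Vert v) x -> Vert v != x ->
  ~~ ((hr S x <= v < hl S y) || (hr S y <= v < hl S x)).
Proof.
move=> xy uv vx nvx.
have lt : tm S (Vert v) < tm S x.
  rewrite ltn_neqAle connect_tm // andbT.
  by apply: contraNneq nvx => /(@tm_vx_eq _ _ S) ->.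
apply: not_same_side; [exact: up_wall | | exact:
  (same_branch e_adj up_neighbors edge_acyclic)].
exact: up_wall (ltn_trans lt (edge_tm xy)).
Qed.

Lemma down_no_cross v x y : e x y -> down v -> connect e y (Vert v) -> Vert v != y ->
  ~~ ((hr S x <= v < hl S y) || (hr S y <= v < hl S x)).
Proof.
move=> xy uv vy nvy.
have lt : tm S y < tm S (Vert v).
  rewrite ltn_neqAle connect_tm // andbT eq_sym.
  by apply: contraNneq nvy => /(@tm_vx_eq _ _ S) ->.
rewrite orbC; apply: not_same_side; [exact: down_wall | | ].
  exact: down_wall (ltn_trans (edge_tm xy) lt).
apply: (same_branch ec_adj down_neighbors ec_acyclic) => //.
by rewrite connect_ec.
Qed.

(** If [w] is below or above the edge, its own branches would keep the edge on one side were it a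
    wall there. Otherwise the path from [w] turns at a wall [v] separating [w] from an end of the
    edge; as [w] lies between the two ends, the edge would have to cross [v]. *)
Lemma cross_no_wall w x y : e x y -> Vert w != x -> Vert w != y ->
    (hr S x <= w < hl S y) || (hr S y <= w < hl S x) ->
  ~~ wall S x w /\ ~~ wall S y w.
Proof.
move=> xy wx wy c; have lxy := edge_tm xy.
case: (edge_sep xy wx wy) => [cw|cw|[v [uv cv sv]]|[v [dv cv sv]]].
- have lt : tm S (Vert w) < tm S x.
    rewrite ltn_neqAle connect_tm // andbT.
    by apply: contraNneq wx => /(@tm_vx_eq _ _ S) ->.
  have nu : ~~ up w by apply/negP => uw; have := up_no_cross xy uw cw wx; rewrite c.
  by rewrite /wall /= in lt lxy *; rewrite lt (ltn_trans lt lxy) (negbTE nu).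
- have lt : tm S y < tm S (Vert w).
    rewrite ltn_neqAle connect_tm // andbT eq_sym.
    by apply: contraNneq wy => /(@tm_vx_eq _ _ S) ->.
  have nd : ~~ down w by apply/negP => dw; have := down_no_cross xy dw cw wy; rewrite c.
  rewrite /wall ltnNge (ltnW (ltn_trans lxy lt)) ltnNge (ltnW lt) /=.
  by rewrite (negbTE nd).
- have wv : wall S y v by apply: up_wall (leq_ltn_trans (connect_tm cv) lxy).
  have vx : Vert v != x.
    apply: contraTneq sv => ev; rewrite /sep (wall_before wv) (wall_after wv).
    move: c; rewrite -ev /= ; have := hl_le_hr S y; clear; rewrite /=; lia.
  have := up_no_cross xy uv cv vx.
  move: sv; rewrite /sep (wall_before wv) (wall_after wv); move: c.
  have := hl_le_hr S y; have := hl_le_hr S x; clear; rewrite /=; lia.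
- have wv : wall S x v by apply: down_wall (leq_trans lxy (connect_tm cv)).
  have vy : Vert v != y.
    apply: contraTneq sv => ev; rewrite /sep (wall_before wv) (wall_after wv).
    move: c; rewrite -ev /= ; have := hl_le_hr S x; clear; rewrite /=; lia.
  have := down_no_cross xy dv cv vy.
  move: sv; rewrite /sep (wall_before wv) (wall_after wv); move: c.
  have := hl_le_hr S y; have := hl_le_hr S x; clear; rewrite /=; lia.
Qed.

Lemma hr_le_size x : hr S x <= size d.
Proof. by case: (nodeP S x) => [[i ->]|[]] //=. Qed.

(** The gap is the right end of whichever node lies further left: a wall hiding the other node from
    it would lie between the ends of the edge, against [cross_no_wall]. *)
Lemma edge_common_gap x y : e x y -> exists g, [/\ g <= size d, visible S g x &
  visible S g y].
Proof.
move=> xy; have := edge_tm xy => lxy.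
have nb u u' w : hr S u <= w < hl S u' -> Vert w != u /\ Vert w != u'.
  by move=> h; split; apply: contraTneq h => <- /=; rewrite ?ltnn ?andbF.
case: (leqP (hr S x) (hl S y)) => h1.
  exists (hr S x); split; first exact: hr_le_size.
    by apply/visibleP => w _; rewrite /blocked; have := hl_le_hr S x; lia.
  apply/visibleP => w wy b.
  have c : hr S x <= w < hl S y.
    by move: b h1; rewrite /blocked; have := hl_le_hr S y; clear; lia.
  have [nx ny] := nb _ _ _ c.
  have [|_] := cross_no_wall xy nx ny; first by rewrite c.
  by rewrite wy.
case: (leqP (hr S y) (hl S x)) => h2.
  exists (hr S y); split; first exact: hr_le_size.
    apply/visibleP => w wx b.
    have c : hr S y <= w < hl S x.
      by move: b h2; rewrite /blocked; have := hl_le_hr S x; clear; lia.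
    have [ny nx] := nb _ _ _ c.
    have [|+ _] := cross_no_wall xy nx ny; first by rewrite c orbT.
    by rewrite wx.
  by apply/visibleP => w _; rewrite /blocked; have := hl_le_hr S y; lia.
(* Overlapping positions would be those of one and the same vertex: a leaf occupies a single gap and
   a vertex two adjacent ones. *)
exfalso; case: (nodeP S x) => [[i ex]|[ex _ _]]; case: (nodeP S y) => [[j ey]|[ey _ _]].
- have ij : i = j by apply: val_inj; move: h1 h2; rewrite ex ey /=; clear; lia.
  by move: lxy; rewrite ex ey ij ltnn.
- move: h1 h2; rewrite ex ey /=; clear; lia.
- move: h1 h2; rewrite -ex ey /=; clear; lia.
- move: h1 h2; rewrite ex ey /=; clear; lia.
Qed.

(** A vertex seen from the common gap strictly between the times of [x] and [y] is neither below nor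
    above the edge, so a turning vertex separates it from one end. That vertex is a wall at both
    times and would hide one of the two nodes from the gap. *)
Lemma edge_sub_sweep_edge x y : e x y -> sweep_edge S x y.
Proof.
move=> xy; have [g [gd vx vy]] := edge_common_gap xy; have lxy := edge_tm xy.
apply/sweep_edgeP; exists g => //; apply/consecutiveP; split=> //; split=>
  // z _ vz xz zy.
case: (nodeP S z) => [[w ez]|[_ _ [z0|zt]]]; last 2 first.
- by rewrite z0 in xz.
- by have := tm_le_top S y; rewrite -zt leqNgt zy.
have wx : Vert w != x by apply: contraTneq xz => <-; rewrite ez ltnn.
have wy : Vert w != y by apply: contraTneq zy => <-; rewrite ez ltnn.
rewrite {}ez in vz xz zy.
have no_separator v u : wall S (Vert w) v -> wall S u v -> visible S g u ->
  sep v (Vert w) u -> False.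
  move=> wv wu vu; rewrite /sep (wall_before wv) (wall_before wu) (wall_after wv)
    (wall_after wu) => h.
  have : blocked S g v (Vert w) || blocked S g v u.
    move: h; rewrite /blocked; have := hl_le_hr S (Vert w); have := hl_le_hr S u.
    clear; lia.
  by case/orP; [apply: (elimT (visibleP _ _ _) vz) | apply:
    (elimT (visibleP _ _ _) vu)].
case: (edge_sep xy wx wy) => [/connect_tm|/connect_tm|[v [uv cv sv]]|[v [dv cv sv]]].
- by rewrite leqNgt xz.
- by rewrite leqNgt zy.
- have vlx := connect_tm cv; apply: (no_separator v y) sv => //.
    exact: up_wall (leq_ltn_trans vlx xz).
  exact: up_wall (leq_ltn_trans vlx lxy).
- have vly := connect_tm cv; apply: (no_separator v x) sv => //.
    exact: down_wall (leq_trans zy vly).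
  exact: down_wall (leq_trans lxy vly).
Qed.

(* Two trees on the same nodes, one contained in the other, are equal. *)
Lemma edge_sweep_edge x y : e x y = sweep_edge S x y.
Proof.
apply/idP/idP => [|h]; first exact: edge_sub_sweep_edge.
have [[/(_ x y)/connectP[p0 /shortenP[p pp up _] ey] _ _] _ _ _ _] := pT.
have pS : path (sadj (sweep_edge S)) x p.
  apply: sub_path pp => a b /orP[/edge_sub_sweep_edge ab|/edge_sub_sweep_edge ab];
    rewrite /sadj ab ?orbT //.
case: p pp up ey pS => [|z [|z' p]] /=.
- by move=> _ _ e0; move: (sweep_edge_lt h); rewrite e0 ltnn.
- rewrite /adj andbT => /orP[xz _ -> //|zx _ ey _].
  by have := sweep_edge_asym h; rewrite ey (edge_sub_sweep_edge zx).
- move=> _ up ey pS; have /negP[] := @sweep_edge_acyclic _ _ S (x :: z :: z' :: p) isT.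
  apply/andP; split; last exact: up.
  rewrite /cycle -[rcons _ _]/(rcons (z :: z' :: p) x) rcons_path; apply/andP; split.
    exact: pS.
  by rewrite /= -ey /sadj h orbT.
Qed.

End Permutree.

(** * Cutting paths and forests *)

Section UniquePath.
Variables (V : finType) (e : rel V).
Hypothesis ace : acyclic e.

Lemma unique_path x p q : path (sadj e) x p -> path (sadj e) x q ->
  uniq (x :: p) -> uniq (x :: q) -> last x p = last x q -> p = q.
Proof.
elim: p x q => [|a p IH] x [|b q] //=.
- by move=> _ _ _ /andP[xq _] e0; rewrite e0 mem_last in xq.
- by move=> _ _ /andP[xp _] _ e0; rewrite -e0 mem_last in xp.
case/andP=> xa pp /andP[xb pq] /andP[xnp up] /andP[xnq uq] el.
have [ab|ab] := eqVneq a b; first by subst b; rewrite (IH a q).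
have ax : a != x by apply: contraNneq xnp => ->; rewrite mem_head.
case: (acyclic_branches ace ab ax xa xb).
apply: connect_trans (connect_avoid xnp pp) _.
by rewrite el avoid_connect_sym connect_avoid.
Qed.
End UniquePath.

Section SortedInfix.
Variables (V : eqType) (t : V -> nat).
Local Notation lt := (relpre t ltn).

Lemma lt_trans : transitive lt.
Proof. by move=> b a c; apply: ltn_trans. Qed.

Lemma infix2P L x y : sorted lt L ->
  reflect ([/\ x \in L, y \in L & t x < t y] /\
           forall z, z \in L -> t x < t z -> t z < t y -> False)
          (infix [:: x; y] L).
Proof.
rewrite (sorted_pairwise lt_trans) => sL; apply: (iffP idP).
  case/infixP => s1 [s2 eL]; move: sL; rewrite {}eL pairwise_cat /=.
  rewrite allrel_consr allrel_consr =>
    /and4P[/and3P[a1 a2 a3] p1 /andP[xy a4] /andP[a5 p2]].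
  split; first by rewrite !mem_cat !inE !eqxx !orbT; split.
  move=> z; rewrite mem_cat !inE => /or4P[zs|/eqP->|/eqP->|zs].
  - by move/allP: a1 => /(_ z zs) /= h1 h2; rewrite ltnNge (ltnW h1) in h2.
  - by rewrite ltnn.
  - by rewrite ltnn.
  - by move/allP: a5 => /(_ z zs) /= h1 _ h2; rewrite ltnNge (ltnW h1) in h2.
case=> -[xL yL xy] h; case/splitPr: xL sL yL h => s1 s2.
rewrite pairwise_cat allrel_consr /= => /and3P[/andP[a1 a2] p1 /andP[a3 p2]] yL h.
have ys2 : y \in s2.
  move: yL; rewrite mem_cat inE => /or3P[ys|/eqP e|//].
    by move/allP: a1 => /(_ y ys) /= h1; rewrite ltnNge (ltnW h1) in xy.
  by rewrite e ltnn in xy.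
case: s2 a3 p2 h ys2 {a2 yL} => // y' s2 a3 p2 h ys2.
have <- : y' = y.
  move: ys2; rewrite inE => /orP[/eqP//|ys2].
  case: (h y'); first by rewrite mem_cat !inE eqxx !orbT.
    by case/andP: a3.
  by case/andP: p2 => /allP/(_ y ys2).
by apply/infixP; exists s1, s2.
Qed.

Lemma sorted_infix (R : rel V) L :
  (forall x y, infix [:: x; y] L -> R x y) -> sorted R L.
Proof.
elim: L => // x [|y L] IH H //; apply/andP; split.
  by apply: H; apply/infixP; exists [::], L.
apply: IH => a b /infixP[s1 [s2 e]]; apply: H.
by apply/infixP; exists (x :: s1), s2; rewrite e.
Qed.
End SortedInfix.

(** * Moving a strand of a piece to another gap *)

Section Clamp.
Variables (N : finType) (n : nat).
Implicit Types (S : sweep N n) (P : pred N) (x y z : N) (g c : nat) (w u : 'I_n).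

Lemma consecutive_sub S P g x y : P x -> P y -> consecutive S predT g x y ->
  consecutive S P g x y.
Proof.
move=> px py /consecutiveP[[_ _ vgx vgy] [xy h]]; apply/consecutiveP; split=> //;
  split=> // z _.
exact: h.
Qed.

(** A label changes state only once, so a wall at the time of [z] was already one at [x] or is still
    one at [y]. *)
Lemma wall_between S x y z w : tm S x < tm S z -> tm S z < tm S y -> wall S z w ->
  wall S x w || wall S y w.
Proof.
move=> xz zy; rewrite /wall; case: (ltnP _ (tm S z)) => h hw.
  by rewrite (ltn_trans h zy) hw orbT.
by rewrite ltnNge (leq_trans (ltnW xz) h) /= hw.
Qed.

Lemma consecutive_clamp S P g c x y : consecutive S P g x y ->
  (forall w, between g c w -> ~~ wall S x w) -> (forall w, between g c w ->
    ~~ wall S y w) ->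
  consecutive S P c x y.
Proof.
case/consecutiveP=> -[px py /visibleP vgx /visibleP vgy] [xy h] hx hy;
  apply/consecutiveP.
split; first split=> //.
- apply/visibleP => w ww; case/(blocked_trans g)/orP => b; first exact: (vgx w).
  by have := hx w; rewrite between_sym b ww => /(_ isT).
- apply/visibleP => w ww; case/(blocked_trans g)/orP => b; first exact: (vgy w).
  by have := hy w; rewrite between_sym b ww => /(_ isT).
split=> // z pz /visibleP vz xz zy; apply: (h z) => //; apply/visibleP => w ww.
case/(blocked_trans c)/orP => b; first exact: (vz w).
by case/orP: (wall_between xz zy ww) => hw; [have := hx w b | have := hy w b];
  rewrite hw.
Qed.

(** The latest such label would be visible from [g] and lie in [P], between [x] and [y]: a wall
    hiding it would hide [z] as well, or be a later such label. *)
Lemma idle_before S P g c x y z : consecutive S P g x y -> visible S g z ->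
    tm S z < tm S y ->
    (forall w, between g c w -> blocked S g w z) -> (forall w, between g c w ->
      P (vx S w)) ->
  forall w, between g c w -> tm S x < tm S (vx S w) -> tm S (vx S w) < tm S z -> False.
Proof.
case/consecutiveP=> -[_ _ _ _] [_ h] /visibleP vz zy hb hP w0 b0 x0 z0.
pose Q w := [&& between g c w, tm S x < tm S (vx S w) & tm S (vx S w) < tm S z].
have Q0 : Q w0 by rewrite /Q b0 x0 z0.
case: (arg_maxnP (fun w => tm S (vx S w)) Q0) => w /and3P[b1 x1 z1] wmax.
apply: (h (vx S w)) => //; first exact: hP; last exact: ltn_trans z1 zy.
apply/visibleP => u wu; rewrite /blocked hl_vx hr_vx => bu.
have bb : between g c u by move: bu b1; rewrite /between; clear; lia.
apply: (vz u); last exact: hb.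
move: wu; rewrite /wall; case: (ltnP (tm S (vx S u)) (tm S (vx S w))) => uw.
  by rewrite (ltn_trans uw z1).
case: ltnP => // uz lu; have := wmax u; rewrite /Q bb uz (leq_trans x1 uw) =>
  /(_ isT) le.
have e : u = w by apply: (@tm_vx_inj _ _ S); apply/eqP; rewrite eqn_leq uw andbT.
by move: bu; rewrite e; lia.
Qed.

Lemma idle_after S P g c x y z : consecutive S P g x y -> visible S g z ->
    tm S x < tm S z ->
    (forall w, between g c w -> blocked S g w z) -> (forall w, between g c w ->
      P (vx S w)) ->
  forall w, between g c w -> tm S z < tm S (vx S w) -> tm S (vx S w) < tm S y -> False.
Proof.
rewrite -flip_consecutive -flip_visible -flip_lt => hn vz xz hb hP w b zw wy.
by apply: (idle_before hn vz xz hb hP b); rewrite flip_lt.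
Qed.

(** Meant for a node [z] beyond the boundary gap [c] of a piece, seen from inside between [x] and
    [y]. As [g] sees [z] across all labels between [g] and [c], and none of these is processed
    strictly between [x] and [y], none is a wall in that time; hence [x] and [y] are also
    consecutive in the piece along the cut at [c]. *)
Lemma consecutive_piece S P g c x y z : consecutive S P g x y -> visible S g z ->
    tm S x < tm S z -> tm S z < tm S y ->
    (forall w, between g c w -> blocked S g w z) -> (forall w, between g c w ->
      P (vx S w)) ->
  consecutive S P c x y.
Proof.
move=> hn vgz xz zy hb hP.
have ib := idle_before hn vgz zy hb hP; have ia := idle_after hn vgz xz hb hP.
have /visibleP vz := vgz.
have far w : between g c w -> tm S (vx S w) <= tm S x \/ tm S y <= tm S (vx S w).
  move=> b; case: (leqP (tm S (vx S w)) (tm S x)) => h1; [by left|right].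
  rewrite leqNgt; apply/negP => h2.
  case: (ltngtP (tm S (vx S w)) (tm S z)) => h.
  - exact: (ib w).
  - exact: (ia w).
  - by have := hb w b; rewrite (tm_vx_eq h) blocked_vx.
case/consecutiveP: hn => -[px py /visibleP vgx /visibleP vgy] [xy h].
have nw (u : N) w : tm S x < tm S u -> tm S u < tm S y -> between g c w ->
  ~~ wall S u w.
  move=> xu uy b; apply/negP => ww; apply: (vz w) (hb w b).
  move: ww; rewrite /wall; case: (far w b) => le.
    by rewrite (leq_ltn_trans le xu) (leq_ltn_trans le xz).
  by rewrite !ltnNge (ltnW (leq_trans uy le)) (ltnW (leq_trans zy le)).
apply/consecutiveP; split; first split=> //.
- apply/visibleP => w ww bw; case/orP: (blocked_trans g bw) => b; first exact: (vgx w).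
  rewrite between_sym in b; apply: (vz w) (hb w b); move: ww; rewrite /wall.
  case: (far w b) => le; last first.
    by rewrite !ltnNge (ltnW (leq_trans xy le)) (ltnW (leq_trans zy le)).
  move: le; rewrite leq_eqVlt => /orP[/eqP/tm_vx_eq e|le];
    first by rewrite e blocked_vx in bw.
  by rewrite le (ltn_trans le xz).
- apply/visibleP => w ww bw; case/orP: (blocked_trans g bw) => b; first exact: (vgy w).
  rewrite between_sym in b; apply: (vz w) (hb w b); move: ww; rewrite /wall.
  case: (far w b) => le.
    by rewrite (leq_ltn_trans le xy) (leq_ltn_trans le xz).
  by rewrite ltnNge le ltnNge (ltnW (leq_trans zy le)).
split=> // u pu /visibleP vu xu uy; apply: (h u) => //; apply/visibleP => w ww.
case/(blocked_trans c)/orP => b; first exact: (vu w).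
by have := nw u w xu uy b; rewrite ww.
Qed.

End Clamp.

Section Lambda.
Variables (T : pretree) (s : seq nat).
Local Notation d := (decor T).
Local Notation e := (edge T).
Hypotheses (pT : permutree T) (perm_s : perm_eq s (iota 0 (size d))).
Local Notation S := (nsweep perm_s).
Hypothesis edgeE : forall x y, e x y = sweep_edge S x y.
Implicit Types (x y z : node d) (g : nat) (v w : 'I_(size d)).

Definition strand g : seq (node d) :=
  sort (relpre (tm S) leq) [seq x <- enum {: node d} | visible S g x].

Lemma mem_strand g x : (x \in strand g) = visible S g x.
Proof. by rewrite mem_sort mem_filter mem_enum inE andbT. Qed.

Lemma strand_sorted g : sorted (relpre (tm S) ltn) (strand g).
Proof.
rewrite -sorted_map ltn_sorted_uniq_leq; apply/andP; split.
  rewrite map_inj_in_uniq; first by rewrite sort_uniq filter_uniq ?enum_uniq.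
  by move=> x y; rewrite !mem_strand; apply: visible_uniq.
by rewrite sorted_map; apply: sort_sorted => x y; apply: leq_total.
Qed.

(** With [P] a piece, the filtered strand is the copy of a cutting path in that piece. *)
Lemma strand_filterP (P : pred (node d)) g x y :
  infix [:: x; y] [seq z <- strand g | P z] = consecutive S P g x y.
Proof.
have sf : sorted (relpre (tm S) ltn) [seq z <- strand g | P z].
  by apply: sorted_filter (strand_sorted g); apply: lt_trans.
apply/(infix2P _ _ sf)/consecutiveP.
  rewrite !mem_filter !mem_strand => -[[/andP[px vgx] /andP[py vgy] xy] h].
  split=> //; split=> // z pz vz; apply: h.
  by rewrite mem_filter mem_strand pz.
case=> -[px py vgx vgy] [xy h]; rewrite !mem_filter !mem_strand px py; split=> // z.
by rewrite mem_filter mem_strand => /andP[]; apply: h.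
Qed.

Lemma geodesic_unique x y p : path (@adj T) x p -> last x p = y -> uniq (x :: p) ->
  geodesic x y = x :: p.
Proof.
move=> pp lp up; have [[_ _ ac] _ _ _ _] := pT.
have sz : size p <= #|{: node d}|.
  have := max_card (mem (x :: p)); rewrite (card_uniqP up) => /ltnW.
  by rewrite /=; move=> h; apply: leq_trans h.
rewrite /geodesic; case: pickP => [q /and3P[pq /eqP lq uq]|/(_ (Bseq sz))/=].
  by congr cons; apply: (unique_path ac pq pp uq up); rewrite lq.
by rewrite pp lp eqxx; move: up => /= ->.
Qed.

(** Sorted by time, the nodes visible from [g] form a simple path of the tree between the two leaves
    of [g]; a tree has only one. *)
Lemma lambda_strand g : g <= size d -> lambda T g = strand g.
Proof.
move=> gd; have ss := strand_sorted g.
have vD : Down (inord (rank is_down d g)) \in strand g.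
  by rewrite mem_strand visible_Down // inordK // ltnS rank_le_count.
have vU : Up (inord (rank is_up d g)) \in strand g.
  by rewrite mem_strand visible_Up // inordK // ltnS rank_le_count.
have sR : sorted (@adj T) (strand g).
  apply: sorted_infix => x y; rewrite -[strand g]filter_predT strand_filterP => h.
  by rewrite /adj edgeE (consecutive_sweep_edge gd h).
have uS : uniq (strand g) by rewrite sort_uniq filter_uniq ?enum_uniq.
rewrite /lambda; set a := Down _ in vD *; set b := Up _ in vU *.
case es : (strand g) vD vU ss sR uS => [|x p] // vD vU ss sR uS.
(* In a list strictly sorted by time, a node of time 0 can only come first; similarly, below, a node
   of the top time can only come last. *)
have ax : x = a.
  apply/eqP; move: vD; rewrite inE eq_sym => /orP[//|ap].
  move: ss; rewrite (sorted_pairwise (@lt_trans _ (tm S))) /= => /andP[/allP/(_ _ ap)].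
  by [].
rewrite -ax; apply: geodesic_unique => //.
move: vU; rewrite inE => /orP[/eqP e|bp].
  by move: ax; rewrite -e.
case/lastP: p bp ss {es vD sR uS} => // p z; rewrite last_rcons mem_rcons inE.
case/orP=> [/eqP//|bp]; rewrite -rcons_cons (sorted_pairwise (@lt_trans _ (tm S))).
rewrite -cats1 pairwise_cat allrel_consr allrel0r andbT => /and3P[/allP/(_ b) h _ _].
have := h _; rewrite inE bp orbT => /(_ isT).
by rewrite /= ltnNge (tm_le_top S z).
Qed.


Variables (G : seq nat) (k : nat).
Hypotheses (sortG : sorted leq G) (leG : forall g, g \in G -> g <= size d)
  (leGk : k <= size G).
Local Notation lo := (lo G k).
Local Notation hi := (hi T G k).
Local Notation piece := (@in_piece T G k).

Lemma hi_le_size : hi <= size d.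
Proof.
rewrite /Defs.hi; case: (ltnP k (size G)) => h; last by rewrite nth_default.
exact/leG/mem_nth.
Qed.

Lemma lo_mem : 0 < lo -> lo \in G.
Proof. by move: leGk; rewrite /Defs.lo; case: k => //= k' h _; apply: mem_nth. Qed.

Lemma hi_mem : hi < size d -> hi \in G.
Proof.
rewrite /Defs.hi; case: (ltnP k (size G)) => h; first by move=> _; apply: mem_nth.
by rewrite nth_default // ltnn.
Qed.

Lemma lo_le_hi : lo <= hi.
Proof.
rewrite /Defs.lo /Defs.hi; move: leGk; case: k => //= k' h.
case: (ltnP k'.+1 (size G)) => h'; last first.
  by rewrite (nth_default _ h') leG ?mem_nth.
rewrite (set_nth_default 0 _ h').
exact: (sorted_leq_nth leq_trans leqnn 0 sortG).
Qed.

(* A path leaving the piece can be pushed to the boundary of the piece. *)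
Lemma piece_no_wall g c x w : (c == lo) && (g < lo) || (c == hi) && (hi < g) ->
  g <= size d -> piece x -> visible S g x -> between g c w -> ~~ wall S x w.
Proof.
move=> hc gd px vgx b; apply/negP => ww.
have lh := lo_le_hi; have hd := hi_le_size.
have cd : c <= size d.
  by case/orP: hc => /andP[/eqP-> _]; rewrite ?hi_le_size // (leq_trans lh hd).
have leafE Q l : rank Q d lo <= l <= rank Q d hi -> rank Q d g = l ->
    rank Q d g = rank Q d c.
  move=> h1 h2; case/orP: hc => /andP[/eqP-> h3].
    have := leq_rank Q d (ltnW h3); lia.
  have := leq_rank Q d (ltnW h3); lia.
case: x px vgx ww => [l|j|l] /= px vgx ww.
- move: vgx; rewrite visible_Down // => /eqP e.
  have := leafE _ _ px e => /(rank_eqP _ gd cd)/(_ w b).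
  by rewrite [is_down _]ww.
- apply: (elimT (visibleP S g (Vert j)) vgx w ww); rewrite /blocked /=.
  by move: b hc px; rewrite /between; clear; lia.
- move: vgx; rewrite visible_Up // => /eqP e.
  have := leafE _ _ px e => /(rank_eqP _ gd cd)/(_ w b).
  by rewrite top_wall // in ww; rewrite [is_up _]ww.
Qed.

(** This treats the edges of [T] and those of the copied paths uniformly. Towards the right-hand
    side, a strand outside the piece is pushed to the nearest boundary. Conversely, if nothing
    interrupts the strand, the edge is one of [T]; otherwise the interrupting node is a vertex
    outside the piece, and [consecutive_piece] moves the edge to the cut on that side. *)
Lemma forest_edgeP x y :
  reflect (exists2 g, lo <= g <= hi & consecutive S piece g x y) (forest_edge G k x y).
Proof.
have lh := lo_le_hi; have hd := hi_le_size.
have lamE g : g \in G -> infix [:: x; y] [seq z <- lambda T g | piece z] =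
  consecutive S piece g x y.
  by move=> gG; rewrite lambda_strand ?leG // strand_filterP.
apply: (iffP idP) => [|[g /andP[log ghi] hn]].
  case/and3P => px py h.
  have [g gd hn] : exists2 g, g <= size d & consecutive S piece g x y.
    case/orP: h => [|/hasP[g gG]]; last by rewrite lamE // => hn; exists g;
      rewrite ?leG.
    rewrite edgeE => /sweep_edgeP[g gd hn]; exists g => //.
    exact: consecutive_sub hn.
  have /consecutiveP[[_ _ vgx vgy] _] := hn.
  case: (ltnP g lo) => gl.
    exists lo; first by rewrite leqnn.
    apply: (consecutive_clamp hn) => w; apply: piece_no_wall => //; by rewrite eqxx gl.
  case: (ltnP hi g) => gh; last by exists g; rewrite ?gl.
  exists hi; first by rewrite leqnn lh.
  by apply: (consecutive_clamp hn) => w; apply: piece_no_wall => //;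
    rewrite eqxx gh orbT.
have gd := leq_trans ghi hd.
have /consecutiveP[[px py vgx vgy] [xy hz]] := hn.
rewrite /forest_edge px py /=.
have [/existsP[z /and3P[vz xz zy]]|nz] :=
  boolP [exists z, [&& visible S g z, tm S x < tm S z & tm S z < tm S y]]; last first.
  rewrite edgeE (@consecutive_sweep_edge _ _ S g) //; apply/consecutiveP; split=> //;
    split=> // z _ vz xz zy.
  by move/existsP: nz; apply; exists z; rewrite vz xz.
have at_gap c : c \in G -> consecutive S piece c x y ->
    e x y || has (fun g => infix [:: x; y] [seq z <- lambda T g | piece z]) G.
  by move=> cG hc; apply/orP; right; apply/hasP; exists c; rewrite ?lamE.
case: (nodeP S z) => [[w ez]|[_ _ [z0|zt]]]; last 2 first.
- by rewrite z0 in xz.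
- by have := tm_le_top S y; rewrite -zt leqNgt zy.
subst z; have : ~~ piece (Vert w) by apply/negP => pw; apply: (hz (Vert w)).
rewrite /= negb_and -ltnNge -leqNgt => /orP[wlo|whi].
  (* The boundary is a genuine cut: a label before [lo] makes [lo] positive, hence a member of [G].
     On the other side, a label at or after [hi] makes [hi] less than [size d]. *)
  apply: (at_gap lo); first by apply: lo_mem; apply: leq_ltn_trans wlo.
  apply: (consecutive_piece hn vz xz zy) => u; rewrite /between ?/blocked /=; move:
    log ghi lh wlo; clear; lia.
apply: (at_gap hi); first by apply: hi_mem; apply: leq_ltn_trans whi _.
apply: (consecutive_piece hn vz xz zy) => u; rewrite /between ?/blocked /=; move:
  log ghi lh whi; clear; lia.
Qed.

End Lambda.

(** * Gaps of a shuffle *)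

Lemma count_lt_nth (l : seq nat) i : sorted ltn l -> i < size l ->
  count (fun q => q < nth 0 l i) l = i.
Proof.
elim: l i => // q l IH [|i] /= sl h.
  rewrite ltnn add0n; apply/eqP; rewrite -leqn0 leqNgt -has_count; apply/hasPn => r rl.
  by rewrite -leqNgt ltnW //; move: (order_path_min ltn_trans sl) => /allP/(_ r rl).
rewrite (IH i) ?(path_sorted sl) //.
by move: (order_path_min ltn_trans sl) => /allP/(_ _ (mem_nth 0 h)) ->.
Qed.

Section Merge.
Variable s : seq (deco + deco).
Implicit Types (P Q A B : pred (deco + deco)).
Local Notation at_ p := (nth (inl DecoN) s p).

Definition nbefore P g := count P (take g s).

Lemma nbefore0 P : nbefore P 0 = 0. Proof. by rewrite /nbefore take0. Qed.

Lemma nbefore_size P : nbefore P (size s) =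
  count P s. Proof. by rewrite /nbefore take_size. Qed.

Lemma nbeforeS P g : g < size s -> nbefore P g.+1 = nbefore P g + P (at_ g).
Proof. by move=> h; rewrite /nbefore (take_nth (inl DecoN) h) -cats1 count_cat /=
  addn0. Qed.

Lemma leq_nbefore P g g' : g <= g' -> nbefore P g <= nbefore P g'.
Proof. by move=> gg; rewrite /nbefore -(subnKC gg) takeD count_cat leq_addr. Qed.

Lemma nbefore_le_count P g : nbefore P g <= count P s.
Proof.
case: (leqP g (size s)) => h; first by rewrite -nbefore_size leq_nbefore.
by rewrite /nbefore take_oversize // ltnW.
Qed.

Lemma nbefore_lt P p g : p < g -> p < size s -> P (at_ p) -> nbefore P p < nbefore P g.
Proof. by move=> pg ps pp; apply: leq_trans (leq_nbefore P pg);
  rewrite nbeforeS // pp addn1. Qed.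

Lemma nbefore_ltW P g g' : nbefore P g < nbefore P g' -> g < g'.
Proof. by move=> h; rewrite ltnNge; apply: contraL h => /(leq_nbefore P);
  rewrite -leqNgt. Qed.

Lemma nbefore_step P g g' : g' <= size s -> nbefore P g < nbefore P g' ->
  exists p, [/\ g <= p < g', P (at_ p) & nbefore P p = nbefore P g].
Proof.
elim: g' => [|g' IH]; first by rewrite nbefore0.
move=> gs; rewrite nbeforeS //; case: (ltnP (nbefore P g) (nbefore P g')) => [lt _|ge].
  have [p [h1 h2 h3]] := IH (ltnW gs) lt; exists p; split=> //.
  by case/andP: h1 => -> /= h; apply: ltnW.
case pp: (P _); last by rewrite addn0 ltnNge ge.
rewrite addn1 ltnS => le; have e : nbefore P g' = nbefore P g by apply/eqP;
  rewrite eqn_leq ge le.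
exists g'; split=> //; rewrite ltnSn andbT leqNgt; apply/negP => h.
by have := nbefore_lt h gs pp; rewrite e; rewrite ltnn.
Qed.

Lemma size_positions P : size (positions P s) = count P s.
Proof.
rewrite size_filter -[in RHS](mkseq_nth (inl DecoN) s) /mkseq count_map.
exact: eq_count.
Qed.

Lemma nbefore_positions P p : p <= size s -> nbefore P p = count (fun q =>
  q < p) (positions P s).
Proof.
move=> ps; rewrite /positions count_filter /nbefore.
rewrite -[s in take p s](mkseq_nth (inl DecoN) s) /mkseq -map_take take_iota count_map.
rewrite -[size s in RHS](subnKC ps) iotaD count_cat [X in _ + X](_ : _ = 0).
  rewrite addn0 (minn_idPl ps); apply: eq_in_count => q; by rewrite mem_iota /= => ->.
apply/eqP; rewrite -leqn0 leqNgt -has_count; apply/hasPn => q.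
by rewrite mem_iota /= negb_and -leqNgt => /andP[-> _].
Qed.

Lemma mem_positions P p : (p \in positions P s) = P (at_ p) && (p < size s).
Proof. by rewrite mem_filter mem_iota. Qed.

Lemma positions_sorted P : sorted ltn (positions P s).
Proof. by apply: sorted_filter (iota_ltn_sorted _ _); apply: ltn_trans. Qed.

Lemma positionsP P i : i < count P s ->
  let p := nth 0 (positions P s) i in [/\ p < size s, P (at_ p) & nbefore P p = i].
Proof.
rewrite -size_positions => h /=; have := mem_nth 0 h.
rewrite mem_positions => /andP[h1 h2]; split=> //.
by rewrite nbefore_positions 1?ltnW // count_lt_nth ?positions_sorted.
Qed.

Lemma nth_positions P p : p < size s -> P (at_ p) ->
  nth 0 (positions P s) (nbefore P p) = p.
Proof.
move=> ps pp; have h : nbefore P p < count P s by rewrite -nbefore_size; apply: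
  nbefore_lt.
have [qs pq e] := positionsP h.
set q := nth _ _ _ in qs pq e *; case: (ltngtP q p) => // l.
  by have := nbefore_lt l qs pq; rewrite e ltnn.
by have := nbefore_lt l ps pp; rewrite e ltnn.
Qed.

Section Gaps.
Variables A B : pred (deco + deco).
Hypothesis AB : forall x, B x -> ~~ A x.
(** Both [left_gaps] and [right_gaps] are instances: [A] selects the letters of the tree being cut
    and [B] the cutting letters of the other one. *)
Definition gaps := [seq nbefore A p | p <- positions B s].
Local Notation lo k := (lo gaps k).
Local Notation hi k := (nth (count A s) gaps k).

Lemma size_gaps : size gaps = count B s.
Proof. by rewrite size_map size_positions. Qed.

Lemma gaps_sorted : sorted leq gaps.
Proof.
rewrite sorted_map; apply: (sub_sorted (e := ltn)); last exact: positions_sorted.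
by move=> p q /= /ltnW; apply: leq_nbefore.
Qed.

Lemma gaps_le g : g \in gaps -> g <= count A s.
Proof. by case/mapP => p _ ->; apply: nbefore_le_count. Qed.

Lemma nth_gaps x0 k : k < count B s -> exists p,
  [/\ p < size s, B (at_ p), nbefore B p = k & nth x0 gaps k = nbefore A p].
Proof.
move=> h; have [h1 h2 h3] := positionsP h; exists (nth 0 (positions B s) k); split=> //.
by rewrite (nth_map 0) ?size_positions.
Qed.

Lemma gap_lo g : lo (nbefore B g) <= nbefore A g.
Proof.
rewrite /Defs.lo; case e : (nbefore B g) => [|k] //=.
have h : k < count B s by apply: leq_trans (nbefore_le_count B g); rewrite e.
have [p [h1 h2 h3 ->]] := nth_gaps 0 h; apply: leq_nbefore; apply: ltnW.
by apply: (@nbefore_ltW B); rewrite h3 e.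
Qed.

Lemma gap_hi g : nbefore A g <= hi (nbefore B g).
Proof.
case: (ltnP (nbefore B g) (count B s)) => h;
  last by rewrite nth_default ?size_gaps ?nbefore_le_count.
have [p [h1 h2 h3 ->]] := nth_gaps (count A s) h; apply: leq_nbefore.
by rewrite leqNgt; apply/negP => /nbefore_lt/(_ h1 h2); rewrite h3 ltnn.
Qed.

(** Converse to [gap_lo] and [gap_hi]. The witness is the first gap with at least [k] letters [B]
    and at least [g] letters [A] before it: by minimality the letter just before it makes one of the
    two counts exact, and the bounds of the piece make the other one exact. *)
Lemma gap_lift k g : k <= count B s -> lo k <= g <= hi k ->
  exists h, [/\ h <= size s, nbefore A h = g & nbefore B h = k].
Proof.
move=> kB /andP[lg gh].
have gA : g <= count A s.
  apply: leq_trans gh _; case: (ltnP k (count B s)) => h;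
    last by rewrite nth_default ?size_gaps.
  by have [p [_ _ _ ->]] := nth_gaps (count A s) h; apply: nbefore_le_count.
have : exists h, (k <= nbefore B h) && (g <= nbefore A h).
  by exists (size s); rewrite !nbefore_size kB gA.
case/ex_minnP => h /andP[kh gh'] hmin.
have hs : h <= size s by apply: hmin; rewrite !nbefore_size kB gA.
exists h; case: h kh gh' hmin hs => [|h] kh gh' hmin hs.
  by rewrite !nbefore0 in kh gh' *; split=> //; [case: g gh' {lg gh gA hmin} | case:
    k kh {lg gh kB hmin}].
have nh : ~~ ((k <= nbefore B h) && (g <= nbefore A h)) by apply/negP => /hmin;
  rewrite ltnn.
move: kh gh' nh; rewrite !nbeforeS //; case bh : (B _).
  rewrite (negbTE (AB bh)) addn0 addn1 => kh gh'; rewrite gh' andbT -ltnNge => hk.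
  have ek : (nbefore B h).+1 = k by apply/eqP; rewrite eqn_leq hk kh.
  split=> //; apply/eqP; rewrite eqn_leq.
  rewrite gh' andbT; move: lg; rewrite /Defs.lo -ek /= (nth_map 0).
    by rewrite nth_positions.
  by rewrite size_positions -nbefore_size; apply: nbefore_lt.
rewrite addn0 => kh; rewrite kh /=.
rewrite -ltnNge; case ah : (A _); last by rewrite addn0 leqNgt => /negbTE->.
rewrite addn1 => le hk; have eg : (nbefore A h).+1 = g by apply/eqP;
  rewrite eqn_leq hk le.
split=> //; apply/eqP; rewrite eqn_leq kh andbT leqNgt; apply/negP => lt.
have kc : k < count B s by apply: leq_trans (nbefore_le_count B h).
have [p [p1 p2 p3 ep]] := nth_gaps (count A s) kc.
have ph : p < h by apply: (@nbefore_ltW B); rewrite p3.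
by move: gh; rewrite ep -eg ltnNge (leq_nbefore A (ltnW ph)).
Qed.

Lemma piece_nbefore p k : p < size s -> A (at_ p) -> k <= count B s ->
  (lo k <= nbefore A p < hi k) = (k == nbefore B p).
Proof.
move=> ps pa kB; apply/idP/eqP => [/andP[l h]|->].
  case: (ltngtP k (nbefore B p)) => // lt.
    have kc : k < count B s by apply: leq_trans (nbefore_le_count B p).
    have [q [q1 q2 q3 eq]] := nth_gaps (count A s) kc.
    have qp : q < p by apply: (@nbefore_ltW B); rewrite q3.
    by move: h; rewrite eq ltnNge (leq_nbefore A (ltnW qp)).
  case: k kB l h lt => // k kB l h lt; rewrite /Defs.lo /= in l.
  have [q [q1 q2 q3 eq]] := nth_gaps 0 kB.
  have pq : p < q.
    have : p <= q.
      by rewrite leqNgt; apply/negP => /nbefore_lt/(_ q1 q2);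
        rewrite q3 ltnNge -ltnS lt.
    rewrite leq_eqVlt => /orP[/eqP e|//].
    by have := AB q2; rewrite -e pa.
  by have := nbefore_lt pq ps pa; rewrite -eq ltnNge l.
(* The gap after the letter [p] gives the strict bound: it has one more letter [A] before it and the
   same number of letters [B]. *)
rewrite gap_lo /=; have := gap_hi p.+1.
rewrite !nbeforeS // pa (negbTE (_ : ~~ B _)) ?addn0 ?addn1 //.
by apply/negP => /AB; rewrite pa.
Qed.

End Gaps.
End Merge.

Section Transfer.
Variables (N N0 : finType) (n n0 : nat) (S : sweep N n) (S0 : sweep N0 n0).
Variables (img : N -> N0 -> bool) (P : pred N0) (h g off : nat) (rng : pred nat).
Hypothesis imgP : forall z x, img z x ->
  tm S z = off + tm S0 x /\ visible S h z = P x && visible S0 g x.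
Hypothesis img_ex : forall z, visible S h z -> rng (tm S z) -> exists x, img z x.
Hypothesis ex_img : forall x, P x -> visible S0 g x -> rng (off + tm S0 x) ->
  exists z, img z x.

(** Shared by the two halves of the glued tree: [img] is [lower] or [upper], [off] the shift in
    time, and [rng] the times of that half in the sweep of the shuffle. *)
Lemma transfer_idle a b : (forall t, a < t < b -> rng (off + t)) ->
  (forall z, visible S h z -> off + a < tm S z -> tm S z < off + b -> False) <->
  (forall x, P x -> visible S0 g x -> a < tm S0 x -> tm S0 x < b -> False).
Proof.
move=> hr; split=> H.
  move=> x px vx ax xb; have [|z zx] := ex_img px vx; first by apply: hr; rewrite ax.
  have [e v] := imgP zx; apply: (H z); rewrite ?v ?px // e ltn_add2l //.
move=> z vz az zb; have [|x zx] := img_ex vz.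
  rewrite -(subnKC (ltnW (leq_ltn_trans (leq_addr a off) az))); apply: hr; lia.
have [e v] := imgP zx; move: vz; rewrite v => /andP[px vx].
by apply: (H x) => //; move: az zb; rewrite e !ltn_add2l.
Qed.
End Transfer.

Definition forget_side (x : deco + deco) : deco := match x with inl c => c | inr c =>
  c end.

(** * One factor inside the sweep of a shuffle *)

Section Part.
Variables (T : pretree) (s : seq (deco + deco)) (f : deco + deco -> option deco).
Variables (B : pred (deco + deco)) (sl su : seq nat) (off : nat).
Local Notation d := (decor T).
Local Notation at_ p := (nth (inl DecoN) s p).
Local Notation A := (isSome \o f).
Local Notation pos i := (nth 0 (positions A s) i).
Hypotheses (fs : pmap f s = d) (f_forget : forall x c, f x = Some c -> forget_side x =
  c)
  (AB : forall x, B x -> ~~ A x).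
Hypotheses (perm_sl : perm_eq sl (iota 0 (size d)))
  (perm_su : perm_eq su (iota 0 (size (word s)))).
Local Notation S := (nsweep perm_sl).
Local Notation Sw := (nsweep perm_su).
Hypothesis tmE : forall (i : 'I_(size d)) (p : 'I_(size (word s))), p = pos i :> nat ->
  tm Sw (Vert p) = off + tm S (Vert i).
Hypothesis wallB : forall p w : 'I_(size (word s)), A (at_ p) -> ~~ A (at_ w) ->
  wall Sw (Vert p) w = B (at_ w).

Lemma size_word : size (word s) = size s. Proof. exact: size_map. Qed.

Lemma countA : count A s = size d.
Proof. by rewrite -fs size_pmap. Qed.

Lemma take_pmap g : take (nbefore s A g) d = pmap f (take g s).
Proof.
rewrite -fs -[in pmap f s](cat_take_drop g s) pmap_cat take_size_cat //.
by rewrite size_pmap.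
Qed.

Lemma rank_nbefore Q g : rank Q d (nbefore s A g) = nbefore s (fun x =>
  oapp Q false (f x)) g.
Proof.
rewrite /rank take_pmap /nbefore; elim: (take g s) => //= x t IH.
by case: (f x) => //= c; rewrite IH.
Qed.

Lemma at_A p : p < size s -> A (at_ p) -> f (at_ p) = Some (letter d (nbefore s A p)).
Proof.
move=> ps; rewrite /letter -fs -[in pmap f s](cat_take_drop p s) (drop_nth (inl DecoN)
  ps).
rewrite pmap_cat nth_cat size_pmap ltnn subnn /=.
by case: (f _).
Qed.

Lemma letter_word p : p < size s -> letter (word s) p = forget_side (at_ p).
Proof. by move=> ps; rewrite /letter /word (nth_map (inl DecoN)). Qed.

Lemma posP (i : 'I_(size d)) :
  [/\ pos i < size s, A (at_ (pos i)) & nbefore s A (pos i) = i].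
Proof. by apply: positionsP; rewrite countA. Qed.

Lemma letter_pos (i : 'I_(size d)) : letter (word s) (pos i) = letter d i.
Proof.
have [h1 h2 h3] := posP i; rewrite letter_word //.
by apply: f_forget; rewrite at_A // h3.
Qed.

Lemma ltn_size_word (p : 'I_(size (word s))) : p < size s.
Proof. by rewrite -[X in _ < X]size_word. Qed.

Lemma pos_ex (p : 'I_(size (word s))) : A (at_ p) ->
  exists i : 'I_(size d), p = pos i :> nat.
Proof.
move=> ap; have ps := ltn_size_word p.
have id : nbefore s A p < size d by rewrite -countA -nbefore_size nbefore_lt.
by exists (Ordinal id); rewrite /= nth_positions.
Qed.

Lemma pos_lift (i : 'I_(size d)) : exists p : 'I_(size (word s)), p = pos i :> nat.
Proof.
have [h _ _] := posP i; have h' : pos i < size (word s) by rewrite size_word.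
by exists (Ordinal h').
Qed.

(** A Galois connection between gaps of the shuffle and labels of [T]; all comparisons of positions
    are transferred through it. *)
Lemma leq_pos g (i : 'I_(size d)) : (g <= pos i) = (nbefore s A g <= i).
Proof.
have [h1 h2 h3] := posP i; apply/idP/idP => [/(leq_nbefore s A)|]; first by rewrite h3.
by rewrite -{1}h3 => h; rewrite leqNgt; apply/negP => /nbefore_lt/(_ h1 h2);
  rewrite ltnNge h.
Qed.

Lemma blocked_pos g (i j : 'I_(size d)) (p q : 'I_(size (word s))) :
  p = pos i :> nat -> q = pos j :> nat ->
  blocked Sw g q (Vert p) = blocked S (nbefore s A g) j (Vert i).
Proof.
move=> ep eq; have [_ _ ip] := posP i; have [_ _ iq] := posP j.
have e1 : (g <= q) = (nbefore s A g <= j) by rewrite eq leq_pos.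
have e2 : (p <= q) = (i <= j) by rewrite eq leq_pos ep ip.
have e3 : (q <= p) = (j <= i) by rewrite ep leq_pos eq iq.
rewrite /blocked /=; move: e1 e2 e3; clear; lia.
Qed.

Lemma wall_pos (i j : 'I_(size d)) (p q : 'I_(size (word s))) :
  p = pos i :> nat -> q = pos j :> nat ->
  wall Sw (Vert p) q = wall S (Vert i) j.
Proof.
move=> ep eq; rewrite /wall (tmE ep) (tmE eq) ltn_add2l /=.
by rewrite [X in letter _ X]eq letter_pos.
Qed.

(** Among the letters of the other factor, the walls at the time of this vertex are the cutting
    letters [B]. None of them hides the vertex exactly when gap and vertex belong to the same piece;
    the letters of [T] itself block as they do in [T]. *)
Lemma visible_pos g (i : 'I_(size d)) (p : 'I_(size (word s))) :
  g <= size s -> p = pos i :> nat ->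
  visible Sw g (Vert p) = (nbefore s B g == nbefore s B p) &&
    visible S (nbefore s A g) (Vert i).
Proof.
move=> gs ep; have [ps ap ip] := posP i; rewrite -ep in ps ap ip.
have nbp : ~~ B (at_ p) by apply/negP => /AB; rewrite ap.
apply/visibleP/andP => [H|[/eqP e /visibleP H] w ww b].
  split; last first.
    apply/visibleP => j wj bj; have [q eq] := pos_lift j.
    by apply: (H q); rewrite ?(wall_pos ep eq) ?(blocked_pos _ ep eq).
  have wB (w : nat) : w < size s -> B (at_ w) -> between g p w -> False.
    move=> ws bw b; have ws' : w < size (word s) by rewrite size_word.
    apply: (H (Ordinal ws')); first by rewrite wallB //= AB.
    have : w != p by apply: contraTneq bw => ->.
    move: b; rewrite /blocked /between /=; clear; lia.
  apply/eqP; case: (ltngtP (nbefore s B g) (nbefore s B p)) => // lt.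
    have [w [h1 h2 _]] := nbefore_step (ltnW ps) lt.
    case: (wB w) => //; last by rewrite /between h1.
    by apply: leq_trans (ltnW ps); case/andP: h1.
  have [w [h1 h2 _]] := nbefore_step gs lt.
  case: (wB w) => //; last by rewrite /between h1 orbT.
  by apply: leq_trans gs; case/andP: h1.
have ws := ltn_size_word w.
have [aw|naw] := boolP (A (at_ w)).
  have [j ej] := pos_ex aw.
  by apply: (H j); rewrite -?(wall_pos ep ej) -?(blocked_pos _ ep ej).
move: ww; rewrite wallB // => bw; move: b; rewrite /blocked /= => /orP[]/andP[h1 h2].
  by have := leq_trans (nbefore_lt h2 ws bw) (eq_leq (esym e));
    rewrite ltnNge leq_nbefore.
have := nbefore_lt h2 ws bw; rewrite e ltnNge leq_nbefore //; exact: ltnW.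
Qed.

Lemma in_piece_pos k (i : 'I_(size d)) (p : 'I_(size (word s))) :
  k <= count B s -> p = pos i :> nat ->
  in_piece (gaps s A B) k (Vert i) = (k == nbefore s B p).
Proof.
move=> kB ep; have [ps ap ip] := posP i; rewrite -ep in ps ap ip.
by rewrite -(piece_nbefore AB ps ap kB) ip countA.
Qed.

Lemma gap_lo_hi g : lo (gaps s A B) (nbefore s B g) <= nbefore s A g <=
  hi T (gaps s A B) (nbefore s B g).
Proof. by rewrite gap_lo //= /hi -countA gap_hi. Qed.

End Part.

(** * The glued tree *)

Lemma index_map_in (X Y : eqType) (f : X -> Y) (s : seq X) x :
  {in s &, injective f} -> x \in s -> index (f x) (map f s) = index x s.
Proof.
elim: s => //= y s IH fi; rewrite inE => xs; case: (eqVneq y x) => [->|ne].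
  by rewrite eqxx.
have {}xs : x \in s by case/orP: xs => // /eqP e; rewrite e eqxx in ne.
rewrite ifN; last first.
  by apply: contraNneq ne => /fi->; rewrite // !inE ?eqxx ?xs ?orbT.
by rewrite IH // => a b ha hb; apply: fi; rewrite inE ?ha ?hb orbT.
Qed.

Section Shuffle.
Variables (T T' : pretree) (s : seq (deco + deco)) (sl sr : seq nat).
Local Notation d := (decor T).
Local Notation d' := (decor T').
Local Notation at_ p := (nth (inl DecoN) s p).
Local Notation isL := (isSome \o from_left).
Local Notation isR := (isSome \o from_right).
Local Notation rd := (fun x => oapp is_down false (from_right x)).
Local Notation lu := (fun x => oapp is_up false (from_left x)).
Local Notation posL i := (nth 0 (positions isL s) i).
Local Notation posR i := (nth 0 (positions isR s) i).
Hypotheses (leftE : pmap from_left s = d) (rightE : pmap from_right s = d').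
Hypotheses (perm_sl : perm_eq sl (iota 0 (size d)))
  (perm_sr : perm_eq sr (iota 0 (size d'))).

Definition shuffle_order := [seq posL i | i <- sl] ++ [seq posR i | i <- sr].
Local Notation su := shuffle_order.

Lemma perm_positions P t : perm_eq t (iota 0 (count P s)) ->
  perm_eq [seq nth 0 (positions P s) i | i <- t] (positions P s).
Proof.
move=> /(perm_map (nth 0 (positions P s))); rewrite -size_positions.
by rewrite -[map _ (iota _ _)]/(mkseq _ _) mkseq_nth.
Qed.

Lemma perm_shuffle_order : perm_eq su (iota 0 (size (word s))).
Proof.
rewrite size_word.
have := perm_filterC (fun p => isL (at_ p)) (iota 0 (size s)).
move=> /permPl/(perm_trans _); apply; apply: perm_cat.
  by apply: perm_positions; rewrite (countA leftE).
have -> : [seq x <- iota 0 (size s) | predC (fun p => isL (at_ p)) x] = positions isR s.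
  by apply: eq_filter => p /=; case: (at_ p).
by apply: perm_positions; rewrite (countA rightE).
Qed.

Lemma forget_left x c : from_left x = Some c -> forget_side x = c.
Proof. by case: x => //= ? [->]. Qed.
Lemma forget_right x c : from_right x = Some c -> forget_side x = c.
Proof. by case: x => //= ? [->]. Qed.
Lemma rd_notL x : rd x -> ~~ isL x. Proof. by case: x. Qed.
Lemma lu_notR x : lu x -> ~~ isR x. Proof. by case: x. Qed.
Lemma isRN x : isR x = ~~ isL x. Proof. by case: x. Qed.

Local Notation S := (nsweep perm_sl).
Local Notation S' := (nsweep perm_sr).
Local Notation Sw := (nsweep perm_shuffle_order).

Lemma pos_inj P t : perm_eq t (iota 0 (count P s)) ->
  {in t &, injective (fun i => nth 0 (positions P s) i)}.
Proof.
move=> pt i j; rewrite !(perm_mem pt) !mem_iota /= => hi hj e.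
by have [_ _ ei] := positionsP hi; have [_ _ ej] := positionsP hj; rewrite -ei e ej.
Qed.

Lemma index_posL (i : 'I_(size d)) : index (posL i) su = index (i : nat) sl.
Proof.
have is_ := mem_perm_s perm_sl i.
rewrite index_cat map_f // index_map_in // => a b ha hb.
by apply: pos_inj ha hb; rewrite (countA leftE).
Qed.

Lemma index_posR (i : 'I_(size d')) : index (posR i) su = size d + index (i : nat) sr.
Proof.
have is_ := mem_perm_s perm_sr i.
rewrite index_cat ifN; last first.
  apply/mapP => -[j jl e]; have [_ h _] := posP rightE i.
  have jd : j < count isL s.
    by rewrite (countA leftE); move: jl; rewrite (perm_mem perm_sl) mem_iota.
  by have [_ h' _] := positionsP jd; move: h; rewrite e isRN h'.
rewrite size_map (size_perm_s perm_sl) index_map_in // => a b ha hb.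
by apply: pos_inj ha hb; rewrite (countA rightE).
Qed.

Lemma tmL (i : 'I_(size d)) (p : 'I_(size (word s))) : p = posL i :> nat ->
  tm Sw (Vert p) = 0 + tm S (Vert i).
Proof. by move=> ep; rewrite /= ep index_posL. Qed.

Lemma tmR (i : 'I_(size d')) (p : 'I_(size (word s))) : p = posR i :> nat ->
  tm Sw (Vert p) = size d + tm S' (Vert i).
Proof. by move=> ep; rewrite /= ep index_posR addnS. Qed.

Lemma left_tm (p : 'I_(size (word s))) : isL (at_ p) = (tm Sw (Vert p) <= size d).
Proof.
have [ap|nap] := boolP (isL (at_ p)).
  have [i ei] := pos_ex leftE ap; rewrite (tmL ei) add0n.
  by have /andP[_] := tm_vx S i; rewrite ltnS => ->.
have ap : isR (at_ p) by rewrite isRN.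
have [i ei] := pos_ex rightE ap; rewrite (tmR ei) -[X in _ <= X]addn0 leq_add2l.
by [].
Qed.

(** While the letters of [T] are processed, those of [T'] are all still to come, so only their lower
    walls stand. *)
Lemma wallL (p w : 'I_(size (word s))) : isL (at_ p) -> ~~ isL (at_ w) ->
  wall Sw (Vert p) w = rd (at_ w).
Proof.
rewrite !left_tm -ltnNge => h1 h2.
rewrite /wall ltnNge (ltnW (leq_ltn_trans h1 h2)) /=.
rewrite letter_word ?ltn_size_word //.
by have := left_tm w; rewrite leqNgt h2; case: (at_ w).
Qed.

Lemma wallR (p w : 'I_(size (word s))) : isR (at_ p) -> ~~ isR (at_ w) ->
  wall Sw (Vert p) w = lu (at_ w).
Proof.
rewrite !isRN negbK !left_tm -ltnNge => h1 h2.
rewrite /wall (leq_ltn_trans h2 h1) /= letter_word ?ltn_size_word //.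
by have := left_tm w; rewrite h2; case: (at_ w).
Qed.

Lemma rank_word Q g : rank Q (word s) g =
  nbefore s (fun x => oapp Q false (from_left x)) g + nbefore s (fun x =>
    oapp Q false (from_right x)) g.
Proof.
rewrite /rank /nbefore /word -map_take; elim: (take g s) => //= x t ->.
by rewrite addnACA; congr addn; case: x => c //=; rewrite addn0.
Qed.

(** This agrees with [leaf_index]: the first summand is the number of the piece, the second that of
    the down leaf of [T]. *)
Lemma rank_down_word g : rank is_down (word s) g = nbefore s rd g +
  rank is_down d (nbefore s isL g).
Proof. by rewrite rank_word (rank_nbefore leftE) addnC. Qed.

Lemma rank_up_word g : rank is_up (word s) g = nbefore s lu g +
  rank is_up d' (nbefore s isR g).
Proof. by rewrite rank_word (rank_nbefore rightE). Qed.

Local Notation visL := (visible_pos leftE forget_left rd_notL tmL wallL).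
Local Notation visR := (visible_pos rightE forget_right lu_notR tmR wallR).
Local Notation G := (left_gaps s).
Local Notation G' := (right_gaps s).

Lemma nbefore_left_le g : nbefore s isL g <= size d.
Proof. by rewrite -(countA leftE) nbefore_le_count. Qed.

Lemma nbefore_right_le g : nbefore s isR g <= size d'.
Proof. by rewrite -(countA rightE) nbefore_le_count. Qed.

Lemma le_size_word g : g <= size s -> g <= size (word s).
Proof. by rewrite size_word. Qed.

Section AtGap.
Variable h : nat.
Hypothesis hs : h <= size s.
Local Notation k := (nbefore s rd h).
Local Notation k' := (nbefore s lu h).

Lemma lowerP (z : node (word s)) (x : node d) : lower z k x ->
  tm Sw z = 0 + tm S x /\ visible Sw h z = in_piece G k x &&
    visible S (nbefore s isL h) x.
Proof.
case: z => [m|p|m]; case: x => [l|i|l] //= /eqP e.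
  split=> //; rewrite !visible_Down ?nbefore_left_le ?le_size_word // rank_down_word e
    eqn_add2l.
  case: eqP; rewrite ?andbF // => <-; rewrite andbT.
  by have /andP[h1 h2] := gap_lo_hi rd leftE h; rewrite !leq_rank.
split; first exact: tmL.
by rewrite (visL hs e) -(in_piece_pos leftE rd_notL (nbefore_le_count _ _ _) e).
Qed.

Lemma lower_ex (z : node (word s)) : visible Sw h z -> tm Sw z <= size d ->
  exists x : node d, lower z k x.
Proof.
case: z => [m|p|m] vz tz.
- exists (Down (inord (rank is_down d (nbefore s isL h)))).
  rewrite /= /leaf_index inordK ?ltnS ?rank_le_count // -rank_down_word.
  by move: vz; rewrite visible_Down ?le_size_word // eq_sym.
- by move: tz; rewrite -left_tm => /(pos_ex leftE)[i ei]; exists (Vert i); apply/eqP.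
- by move: tz; rewrite /= size_word ltnNge -(countA leftE) count_size.
Qed.

Lemma ex_lower (x : node d) : in_piece G k x -> visible S (nbefore s isL h) x ->
  0 + tm S x <= size d -> exists z : node (word s), lower z k x.
Proof.
case: x => [l|i|l] px vx tx; last by rewrite /= ltnn in tx.
  have e : leaf_index k l = rank is_down (word s) h.
    by move: vx; rewrite visible_Down ?nbefore_left_le // => /eqP<-;
      rewrite rank_down_word.
  have lt : leaf_index k l < (count is_down (word s)).+1 by rewrite e ltnS
    rank_le_count.
  by exists (Down (Ordinal lt)) => /=.
by have [p ep] := pos_lift leftE i; exists (Vert p); apply/eqP.
Qed.

Lemma upperP (z : node (word s)) (x : node d') : upper z k' x ->
  tm Sw z = size d + tm S' x /\ visible Sw h z = in_piece G' k' x &&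
    visible S' (nbefore s isR h) x.
Proof.
case: z => [m|p|m]; case: x => [l|i|l] //= /eqP e; last first.
  split; first by rewrite size_word addnS -(countA leftE) -(countA rightE)
     -(count_predC isL s); congr (_ + _).+1; apply: eq_count => x; rewrite [RHS]isRN.
  rewrite !visible_Up ?nbefore_right_le ?le_size_word // rank_up_word e eqn_add2l.
  case: eqP; rewrite ?andbF // => <-; rewrite andbT.
  by have /andP[h1 h2] := gap_lo_hi lu rightE h; rewrite !leq_rank.
split; first exact: tmR.
by rewrite (visR hs e) -(in_piece_pos rightE lu_notR (nbefore_le_count _ _ _) e).
Qed.

Lemma upper_ex (z : node (word s)) : visible Sw h z -> size d < tm Sw z ->
  exists x : node d', upper z k' x.
Proof.
case: z => [m|p|m] vz tz //.
- move: tz; rewrite ltnNge -left_tm => tz.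
  have ap : isR (at_ p) by rewrite isRN.
  by have [i ei] := pos_ex rightE ap; exists (Vert i); apply/eqP.
- exists (Up (inord (rank is_up d' (nbefore s isR h)))).
  rewrite /= /leaf_index inordK ?ltnS ?rank_le_count // -rank_up_word.
  by move: vz; rewrite visible_Up ?le_size_word // eq_sym.
Qed.

Lemma ex_upper (x : node d') : in_piece G' k' x -> visible S' (nbefore s isR h) x ->
  size d < size d + tm S' x -> exists z : node (word s), upper z k' x.
Proof.
case: x => [l|i|l] px vx tx; first by rewrite addn0 ltnn in tx.
  by have [p ep] := pos_lift rightE i; exists (Vert p); apply/eqP.
have e : leaf_index k' l = rank is_up (word s) h.
  by move: vx; rewrite visible_Up ?nbefore_right_le // => /eqP<-; rewrite rank_up_word.
have lt : leaf_index k' l < (count is_up (word s)).+1 by rewrite e ltnS rank_le_count.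
by exists (Up (Ordinal lt)) => /=.
Qed.

(** The time ranges here and in [upper_idle] leave out the leaves that disappear in the gluing: the
    up leaves of [T] have time [(size d).+1], and the down leaves of [T'] have the shifted time
    [size d]. *)
Definition lower_idle a b hr :=
  @transfer_idle _ _ _ _ Sw S _ (in_piece G k) h _ 0 (fun t => t <= size d)
    lowerP lower_ex ex_lower a b hr.

Definition upper_idle a b hr :=
  @transfer_idle _ _ _ _ Sw S' _ (in_piece G' k') h _ (size d) (fun t => size d < t)
    upperP upper_ex ex_upper a b hr.

End AtGap.

Lemma lower_tm (z : node (word s)) k (x : node d) : lower z k x -> tm S x <= size d.
Proof. by case: z => [m|p|m]; case: x => [l|i|l] // _; have /andP[_] := tm_vx S i. Qed.

Lemma upper_tm (z : node (word s)) k (x : node d') : upper z k x -> 0 < tm S' x.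
Proof. by case: z => [m|p|m]; case: x. Qed.

Hypotheses (pT : permutree T) (pT' : permutree T').
Hypotheses (edgeE : forall x y, edge T x y = sweep_edge S x y)
  (edgeE' : forall x y, edge T' x y = sweep_edge S' x y).

Lemma forest_lowerP k x y : k <= size G ->
  reflect (exists h, [/\ h <= size s, nbefore s rd h = k &
    consecutive S (in_piece G k) (nbefore s isL h) x y])
          (forest_edge G k x y).
Proof.
move=> kG; have leG g : g \in G -> g <= size d by rewrite -(countA leftE); apply:
  gaps_le.
apply: (iffP (forest_edgeP pT edgeE (gaps_sorted _ _ _) leG kG _ _)) => [[g gb hn]|].
  have [||h [h1 h2 h3]] := @gap_lift s isL rd rd_notL k g.
  - by rewrite -(size_gaps s isL).
  - by rewrite (countA leftE).
  by exists h; rewrite h2.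
case=> h [h1 h2 h3]; exists (nbefore s isL h) => //.
by rewrite -h2; apply: (gap_lo_hi rd leftE).
Qed.

Lemma forest_upperP k x y : k <= size G' ->
  reflect (exists h, [/\ h <= size s, nbefore s lu h = k &
    consecutive S' (in_piece G' k) (nbefore s isR h) x y])
          (forest_edge G' k x y).
Proof.
move=> kG; have leG g : g \in G' -> g <= size d' by rewrite -(countA rightE); apply:
  gaps_le.
apply: (iffP (forest_edgeP pT' edgeE' (gaps_sorted _ _ _) leG kG _ _)) => [[g gb hn]|].
  have [||h [h1 h2 h3]] := @gap_lift s isR lu lu_notR k g.
  - by rewrite -(size_gaps s isR).
  - by rewrite (countA rightE).
  by exists h; rewrite h2.
case=> h [h1 h2 h3]; exists (nbefore s isR h) => //.
by rewrite -h2; apply: (gap_lo_hi lu rightE).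
Qed.

(* Between the lower and the upper letters, the walls are the up letters of [T]
   and the down letters of [T'], and the number of walls on the left of a gap
   identifies its interval. *)
Lemma middle_strand h1 h2 : h1 <= size s -> h2 <= size s ->
    nbefore s rd h1 + nbefore s lu h1 = nbefore s rd h2 + nbefore s lu h2 ->
  forall w : 'I_(size (word s)), between h1 h2 w -> ~~ wall_at Sw (size d) w.
Proof.
wlog: h1 h2 / h1 <= h2 => [H|h12].
  move=> l1 l2 e w b; case: (leqP h1 h2) => h; first exact: (H h1 h2).
  by apply: (H h2 h1) => //; [apply: ltnW | rewrite between_sym].
move=> l1 l2 e w b; have {b} /andP[b1 b2] : h1 <= w < h2.
  by move: b; rewrite /between => /orP[//|/andP[a b]]; have := leq_trans b h12;
    rewrite ltnNge a.
have ws := ltn_size_word w.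
have nmid : ~~ lu (at_ w) && ~~ rd (at_ w).
  have r1 := leq_nbefore s rd h12; have r2 := leq_nbefore s lu h12.
  have e1 : nbefore s rd h1 = nbefore s rd h2 by apply/eqP; rewrite eqn_leq r1; move:
    e r2; clear; lia.
  have e2 : nbefore s lu h1 = nbefore s lu h2 by apply/eqP; rewrite eqn_leq r2; move:
    e r1; clear; lia.
  apply/andP; split; apply/negP => pw.
    by have := @nbefore_lt s lu _ _ b2 ws pw; rewrite -e2 ltnNge leq_nbefore.
  by have := @nbefore_lt s rd _ _ b2 ws pw; rewrite -e1 ltnNge leq_nbefore.
rewrite /wall_at -left_tm /= letter_word //.
by case/andP: nmid; case: (at_ w).
Qed.

Lemma glue_edge_sweep_edge (z z' : node (word s)) : glue_edge T T' z z' ->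
  sweep_edge Sw z z'.
Proof.
case/or3P.
- case/existsP => k /existsP[x /existsP[y /and3P[fe lx ly]]].
  have kG : k <= size G by rewrite -ltnS.
  have [h [hs hk /consecutiveP[[px py vx vy] [xy id]]]] := forest_lowerP _ _ kG fe.
  rewrite -hk in lx ly px py id.
  have [ex wx] := lowerP hs lx; have [ey wy] := lowerP hs ly.
  apply/sweep_edgeP; exists h; first exact: le_size_word.
  apply/consecutiveP; split; first by split; rewrite // ?wx ?wy ?px ?py.
  split; first by rewrite ex ey.
  move=> u _; rewrite ex ey; apply: (lower_idle hs (a := tm S x) (b := tm S y) _).2 =>
    //.
  move=> t /andP[_ ty]; exact: leq_trans (ltnW ty) (lower_tm ly).
- case/existsP => k /existsP[x /existsP[y /and3P[fe lx ly]]].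
  have kG : k <= size G' by rewrite -ltnS.
  have [h [hs hk /consecutiveP[[px py vx vy] [xy id]]]] := forest_upperP _ _ kG fe.
  rewrite -hk in lx ly px py id.
  have [ex wx] := upperP hs lx; have [ey wy] := upperP hs ly.
  apply/sweep_edgeP; exists h; first exact: le_size_word.
  apply/consecutiveP; split; first by split; rewrite // ?wx ?wy ?px ?py.
  split; first by rewrite ex ey ltn_add2l.
  move=> u _; rewrite ex ey; apply: (upper_idle hs (a := tm S' x) (b :=
    tm S' y) _).2 => //.
  by move=> t /andP[xt _]; rewrite -[X in X < _]addn0 ltn_add2l (leq_ltn_trans _ xt).
case/existsP => k /existsP[x /existsP[l /existsP[k' /existsP[l' /existsP[y]]]]].
case/and5P => fe fe' /eqP ekl lx ly.
have kG : k <= size G by rewrite -ltnS.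
have kG' : k' <= size G' by rewrite -ltnS.
have [h [hs hk /consecutiveP[[px pU vx vU] [xU id]]]] := forest_lowerP _ _ kG fe.
have [h' [hs' hk' /consecutiveP[[pD py vD vy] [Dy id']]]] := forest_upperP _ _ kG' fe'.
rewrite -hk in lx px pU id; rewrite -hk' in ly py pD id'.
have [ex wx] := lowerP hs lx; have [ey wy] := upperP hs' ly.
(* A leaf visible from a gap has the rank of that gap. Hence the two leaf indices count the walls of
   the middle time to the left of [h] and of [h'], and their equality puts [h] and [h'] in the same
   interval. *)
have el : nbefore s lu h = l.
  by move: vU; rewrite visible_Up ?nbefore_left_le // (rank_nbefore leftE) => /eqP.
have el' : nbefore s rd h' = l'.
  by move: vD; rewrite visible_Down ?nbefore_right_le // (rank_nbefore rightE) => /eqP.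
have mid : forall w : 'I_(size (word s)), between h' h w -> ~~ wall_at Sw (size d) w.
  by apply: middle_strand => //; rewrite hk hk' el el' addnC.
rewrite add0n in ex.
have xn : tm Sw z <= size d by rewrite ex (lower_tm lx).
have yn : size d < tm Sw z' by rewrite ey -[X in X < _]addn0 ltn_add2l (upper_tm ly).
(* The upper half of the edge is known along [h'] only; no middle wall separates [h'] from [h], so
   the strand can be carried over to [h]. *)
have [vz' idu] : visible Sw h z' /\
    (forall u, visible Sw h u -> size d < tm Sw u -> tm Sw u < tm Sw z' -> False).
  apply: (strand_next mid yn); first by rewrite wy py.
  have := (upper_idle hs' (a := 0) (b := tm S' y) _).2; rewrite addn0 -ey; apply=> //.
  by move=> t /andP[t0 _]; rewrite -[X in X < _]addn0 ltn_add2l.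
apply/sweep_edgeP; exists h; first exact: le_size_word.
apply/consecutiveP; split; first by split; rewrite // ?wx ?px.
split; first exact: leq_ltn_trans xn yn.
move=> u _ vu zu uz'; case: (leqP (tm Sw u) (size d)) => un; last exact: (idu u).
apply: ((lower_idle hs (a := tm S x) (b := (size d).+1) _).2 _ u vu) => //.
  by move=> t /andP[].
by rewrite -ex.
Qed.

Lemma sweep_edge_glue_edge (z z' : node (word s)) : sweep_edge Sw z z' ->
  glue_edge T T' z z'.
Proof.
case/sweep_edgeP => h hn /consecutiveP[[_ _ vz vz'] [zz id]].
have hs : h <= size s by rewrite -size_word.
have kG : nbefore s rd h < (size G).+1 by rewrite ltnS (size_gaps s isL)
  nbefore_le_count.
have kG' : nbefore s lu h < (size G').+1 by rewrite ltnS (size_gaps s isR)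
  nbefore_le_count.
case: (leqP (tm Sw z') (size d)) => [z'n|z'n].
  have [x lx] := lower_ex hs vz (leq_trans (ltnW zz) z'n).
  have [y ly] := lower_ex hs vz' z'n.
  apply/or3P; apply: Or31; apply/existsP; exists (Ordinal kG).
  apply/existsP; exists x; apply/existsP; exists y; rewrite /= lx ly !andbT.
  have [ex wx] := lowerP hs lx; have [ey wy] := lowerP hs ly.
  apply/forest_lowerP => //; exists h; split=> //.
  move: vz vz'; rewrite wx wy => /andP[px vx] /andP[py vy].
  apply/consecutiveP; split; [by split | split; first by move: zz; rewrite ex ey].
  apply: (lower_idle hs (a := tm S x) (b := tm S y) _).1.
    by move=> t /andP[_ ty]; rewrite add0n (leq_trans (ltnW ty)) // -[tm S y]add0n -ey.
  by move=> u vu; rewrite -ex -ey; apply: id.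
case: (ltnP (size d) (tm Sw z)) => [zn|zn].
  have [x lx] := upper_ex hs vz zn.
  have [y ly] := upper_ex hs vz' z'n.
  apply/or3P; apply: Or32; apply/existsP; exists (Ordinal kG').
  apply/existsP; exists x; apply/existsP; exists y; rewrite /= lx ly !andbT.
  have [ex wx] := upperP hs lx; have [ey wy] := upperP hs ly.
  apply/forest_upperP => //; exists h; split=> //.
  move: vz vz'; rewrite wx wy => /andP[px vx] /andP[py vy].
  apply/consecutiveP; split; [by split | split; first by move: zz;
    rewrite ex ey ltn_add2l].
  apply: (upper_idle hs (a := tm S' x) (b := tm S' y) _).1.
    by move=> t /andP[xt _]; rewrite -[X in X < _]addn0 ltn_add2l (leq_ltn_trans _ xt).
  by move=> u vu; rewrite -ex -ey; apply: id.
have [x lx] := lower_ex hs vz zn; have [y ly] := upper_ex hs vz' z'n.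
have [ex wx] := lowerP hs lx; have [ey wy] := upperP hs ly.
(* At the gap [h], the up leaf of the lower forest and the down leaf of the upper one have the same
   two numbers with the roles of piece and leaf exchanged, so their leaf indices agree. *)
have uE : rank is_up d (nbefore s isL h) =
  nbefore s lu h by rewrite (rank_nbefore leftE).
have dE : rank is_down d' (nbefore s isR h) =
  nbefore s rd h by rewrite (rank_nbefore rightE).
have lU : nbefore s lu h < (count is_up d).+1 by rewrite -uE ltnS rank_le_count.
have lD : nbefore s rd h < (count is_down d').+1 by rewrite -dE ltnS rank_le_count.
have vU : visible S (nbefore s isL h) (Up (Ordinal lU)) by rewrite visible_Up
  ?nbefore_left_le // uE.
have vD : visible S' (nbefore s isR h) (Down (Ordinal lD)) by rewrite visible_Down
  ?nbefore_right_le // dE.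
apply/or3P; apply: Or33; apply/existsP; exists (Ordinal kG).
apply/existsP; exists x; apply/existsP; exists (Ordinal lU).
apply/existsP; exists (Ordinal kG'); apply/existsP; exists (Ordinal lD).
apply/existsP; exists y; rewrite /= lx ly /leaf_index addnC eqxx !andbT.
move: vz vz'; rewrite wx wy => /andP[px vx] /andP[py vy].
apply/andP; split.
  apply/forest_lowerP => //; exists h; split=> //.
  apply/consecutiveP; split.
    split=> //=; rewrite -uE.
    by have /andP[h1 h2] := gap_lo_hi rd leftE h; rewrite !leq_rank.
  split; first by rewrite /= ltnS (lower_tm lx).
  apply: (lower_idle hs (a := tm S x) (b := (size d).+1) _).1; first by move=>
    t /andP[].
  move=> u vu; rewrite -ex => zu un; apply: (id u) => //.
  by apply: leq_ltn_trans z'n; rewrite -ltnS.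
apply/forest_upperP => //; exists h; split=> //.
apply/consecutiveP; split.
  split=> //=; rewrite -dE.
  by have /andP[h1 h2] := gap_lo_hi lu rightE h; rewrite !leq_rank.
split; first exact: (upper_tm ly).
apply: (upper_idle hs (a := 0) (b := tm S' y) _).1.
  by move=> t /andP[xt _]; rewrite -[X in X < _]addn0 ltn_add2l.
move=> u vu; rewrite -ey addn0 => zu uz; apply: (id u) => //.
exact: leq_ltn_trans zn zu.
Qed.

Lemma glueE : glue T T' s = Pretree (sweep_edge Sw).
Proof.
congr Pretree; apply/funext => z; apply/funext => z'.
by apply/idP/idP; [apply: glue_edge_sweep_edge | apply: sweep_edge_glue_edge].
Qed.

End Shuffle.

(** * The product *)

Section LinearExtension.
Variable T : pretree.
Hypothesis pT : permutree T.
Local Notation d := (decor T).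
Local Notation e := (edge T).

Lemma tree_no_dicycle x y : e x y -> ~~ connect e y x.
Proof.
have [[_ asym ac] _ _ _ _] := pT; move=> xy; apply/negP =>
  /connectP[p0 /shortenP[p pp up _] ex].
have pa : path (@adj T) y p by apply: sub_path pp => a b; rewrite /adj => ->.
have {pp} : path e y p by [].
case: p up ex pa => [|a [|b p]] up ex pa.
- by move: xy (asym _ _ xy); rewrite ex /= => ->.
- by rewrite /= andbT => ya; have := asym _ _ xy; rewrite ex /= ya.
move=> _; have /negP[] := ac (y :: a :: b :: p) isT; apply/andP; split; last exact: up.
rewrite /cycle -[rcons _ _]/(rcons (a :: b :: p) y) rcons_path pa -ex.
by rewrite /adj xy.
Qed.

(** The vertices are sorted by the number of nodes from which they can be reached; along an edge
    this set grows strictly, as there is no directed cycle. *)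
Lemma linear_extension_ex : exists t, linear_extension T t.
Proof.
pose h (i : 'I_(size d)) := #|[pred z | connect e z (Vert i)]|.
pose l := sort (relpre h leq) (enum 'I_(size d)).
have pl : perm_eq [seq nat_of_ord i | i <- l] (iota 0 (size d)).
  by rewrite -val_enum_ord perm_map // perm_sort.
pose t0 := [seq (nat_of_ord i, letter d i) | i <- l].
have u0 : unzip1 t0 = [seq nat_of_ord i | i <- l] by rewrite /unzip1 -map_comp.
have s0 : size t0 = size d by rewrite size_map size_sort size_enum_ord.
have pt0 : perm_eq (unzip1 t0) (iota 0 (size t0)) by rewrite u0 s0.
exists (DPerm pt0); apply/and3P; split.
- by rewrite /= s0.
- by apply/allP => x /mapP[i _ ->] /=.
apply/forallP => i; apply/forallP => j; apply/implyP => ij.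
rewrite /= u0 !(index_map (@ord_inj _)) ltnNge; apply/negP => le.
have tr : transitive (relpre h leq) by move=> b a c; apply: leq_trans.
have rf : reflexive (relpre h leq) by move=> a /=.
have ss : sorted (relpre h leq) l by apply: sort_sorted => a b; apply: leq_total.
have := sorted_leq_index tr rf ss; move=> /(_ j i); rewrite !mem_sort !mem_enum.
move=> /(_ isT isT le) /=; rewrite leqNgt => /negP; apply; apply: proper_card.
apply/properP; split.
  by apply/subsetP => z; rewrite !inE => zi; apply: connect_trans zi (connect1 ij).
exists (Vert j); first by rewrite inE connect0.
by rewrite inE; apply: tree_no_dicycle.
Qed.

Section Given.
Variable t : dperm.
Hypothesis lt : linear_extension T t.

Lemma ext_perm : perm_eq (unzip1 t) (iota 0 (size d)).
Proof. by case/and3P: lt => /eqP sz _ _; rewrite -sz dpermP. Qed.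

Lemma ext_edge (x y : node d) : e x y = sweep_edge (nsweep ext_perm) x y.
Proof.
apply: edge_sweep_edge => // i j ij; have /and3P[_ _ /forallP/(_ i)/forallP/(_ j)] :=
  lt.
by rewrite ij.
Qed.

Lemma ext_letter x : x \in (t : seq _) -> x.2 = letter d x.1.
Proof. by have /and3P[_ /allP h _] := lt; move/h/eqP. Qed.
End Given.
End LinearExtension.

(** * Recovering a word from its standardization and its set of values *)

Section Std.
Variables (w : seq (nat * deco)) (l : seq nat).
Hypotheses (sl : sorted ltn l) (pl : perm_eq l (unzip1 w)).

Lemma std_count v : count (fun y => y.1 < v) w = count (fun q => q < v) l.
Proof. by rewrite (permP pl) count_map. Qed.

Lemma std_unsort : [seq (nth 0 l x.1, x.2) | x <- std w] = w.
Proof.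
rewrite /std -map_comp -[RHS]map_id; apply/eq_in_map => x xw /=.
rewrite [RHS]surjective_pairing; congr pair; rewrite std_count.
have xl : x.1 \in l by rewrite (perm_mem pl) map_f.
by rewrite -{1}(nth_index 0 xl) count_lt_nth ?nth_index ?index_mem.
Qed.

(** Used for each half of a word of the product: the list [l] holds the values of that half in
    increasing order, and the values of its standardization are indices into [l]. *)
Lemma std_letters (f : nat -> deco) (d : seq deco) :
    (forall x, x \in w -> x.2 = f x.1) ->
    (forall x, x \in std w -> x.2 = letter d x.1) -> size w = size d ->
  map f l = d.
Proof.
move=> wf wd sz; have szl : size l = size d by rewrite (perm_size pl) size_map.
apply: (@eq_from_nth _ DecoN); first by rewrite size_map.
move=> i; rewrite size_map => il; rewrite (nth_map 0) //.
have : nth 0 l i \in unzip1 w by rewrite -(perm_mem pl) mem_nth.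
case/mapP => x xw ex; rewrite ex -wf //.
have := wd _ (map_f (fun x => (count (fun y => y.1 < x.1) w, x.2)) xw).
by rewrite /= std_count -ex count_lt_nth.
Qed.
End Std.

Section Product.
Variables (T T' : pretree).
Hypotheses (pT : permutree T) (pT' : permutree T').
Local Notation d := (decor T).
Local Notation d' := (decor T').
Variables (t t' : dperm).
Hypotheses (lt : linear_extension T t) (lt' : linear_extension T' t').
Local Notation isL := (isSome \o from_left).
Local Notation isR := (isSome \o from_right).
Local Notation order s := (shuffle_order s (unzip1 t) (unzip1 t')).

Definition merge_word (s : seq (deco + deco)) : seq (nat * deco) :=
  [seq (nth 0 (positions isL s) x.1, x.2) | x <- t] ++
  [seq (nth 0 (positions isR s) x.1, x.2) | x <- t'].

Lemma unzip1_merge_word s : unzip1 (merge_word s) = order s.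
Proof. by rewrite /shuffle_order /unzip1 map_cat -!map_comp. Qed.

Lemma size_ext : size t = size d. Proof. by case/and3P: lt => /eqP. Qed.
Lemma size_ext' : size t' = size d'. Proof. by case/and3P: lt' => /eqP. Qed.

Lemma size_merge_word s : size (merge_word s) = size d + size d'.
Proof. by rewrite size_cat !size_map size_ext size_ext'. Qed.

Section Shuffle.
Variable s : seq (deco + deco).
Hypotheses (sl : pmap from_left s = d) (sr : pmap from_right s = d').

Lemma size_shuffle : size s = size d + size d'.
Proof.
rewrite -(countA sl) -(countA sr) -(count_predC isL s); congr addn.
by apply: eq_count => x /=; case: x.
Qed.

Local Notation perm_order := (perm_shuffle_order sl sr (ext_perm lt) (ext_perm lt')).

Lemma merge_word_perm : perm_eq (unzip1 (merge_word s)) (iota 0 (size (merge_word s))).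
Proof. by rewrite unzip1_merge_word size_merge_word -size_shuffle -(size_word s)
  perm_order. Qed.

Definition merge : dperm := DPerm merge_word_perm.

Lemma merge_word_letter x : x \in merge_word s -> x.2 = letter (word s) x.1.
Proof.
have mem_t (u : dperm) (n : nat) (y : nat * deco) : size u = n -> y \in (u : seq _) ->
  y.1 < n.
  move=> <- yu; have : y.1 \in unzip1 u by apply: map_f.
  by rewrite (perm_mem (dpermP u)) mem_iota.
rewrite mem_cat => /orP[]/mapP[y yt ->] /=.
  have yd := mem_t _ _ _ size_ext yt.
  by rewrite (letter_pos sl forget_left (Ordinal yd)) (ext_letter lt yt).
have yd := mem_t _ _ _ size_ext' yt.
by rewrite (letter_pos sr forget_right (Ordinal yd)) (ext_letter lt' yt).
Qed.

Lemma glue_sweep : glue T T' s = Pretree (sweep_edge (nsweep perm_order)).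
Proof. exact: (glueE _ _ pT pT' (ext_edge pT lt) (ext_edge pT' lt')). Qed.

Lemma permutree_glue : permutree (glue T T' s).
Proof. by rewrite glue_sweep; apply: permutree_sweep. Qed.

Lemma ext_glue : linear_extension (glue T T' s) merge.
Proof.
rewrite glue_sweep; apply/and3P; split.
- by rewrite /= size_merge_word -size_shuffle size_word.
- by apply/allP => x /merge_word_letter->.
apply/forallP => i; apply/forallP => j; apply/implyP => /sweep_edge_lt.
by rewrite /= unzip1_merge_word.
Qed.

Lemma take_merge_word : take (size t) (merge_word s) =
  [seq (nth 0 (positions isL s) x.1, x.2) | x <- t].
Proof. by rewrite take_size_cat // size_map. Qed.

Lemma drop_merge_word : drop (size t) (merge_word s) =
  [seq (nth 0 (positions isR s) x.1, x.2) | x <- t'].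
Proof. by rewrite drop_size_cat // size_map. Qed.

Lemma std_pos P (u : dperm) : count P s = size u ->
  std [seq (nth 0 (positions P s) x.1, x.2) | x <- u] = u.
Proof.
move=> cu; rewrite -[RHS]std_id /std -map_comp; apply/eq_in_map => x xu /=; congr pair.
have small y : y \in (u : seq _) -> y.1 < count P s.
  move=> yu; have : y.1 \in unzip1 u by apply: map_f.
  by rewrite (perm_mem (dpermP u)) mem_iota cu.
rewrite count_map; apply: eq_in_count => y yu /=.
have [_ _ ex] := positionsP (small x xu); have [y1 y2 ey] := positionsP (small y yu).
apply/idP/idP => [h|h]; first by rewrite -ex -ey nbefore_lt.
by apply: (@nbefore_ltW s P); rewrite ex ey.
Qed.

Lemma std_take_merge_word : std (take (size t) (merge_word s)) = t.
Proof. by rewrite take_merge_word std_pos // (countA sl) size_ext. Qed.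

Lemma std_drop_merge_word : std (drop (size t) (merge_word s)) = t'.
Proof. by rewrite drop_merge_word std_pos // (countA sr) size_ext'. Qed.
End Shuffle.

Definition deco_of (w : seq (nat * deco)) v := (nth (0,
  DecoN) w (index v (unzip1 w))).2.

Lemma deco_ofE w x : uniq (unzip1 w) -> x \in w -> deco_of w x.1 = x.2.
Proof.
move=> uw xw; rewrite /deco_of.
have := index_uniq 0 _ uw => h.
have iw : index x w < size w by rewrite index_mem.
have e : nth 0 (unzip1 w) (index x w) = x.1 by rewrite (nth_map (0,
  DecoN)) // nth_index.
by rewrite -e h ?size_map // nth_index.
Qed.

(** Inverse to [merge_word] on the words of the product: whether a value occurs in the first half
    tells from which factor its letter comes. *)
Definition unmerge (w : seq (nat * deco)) : seq (deco + deco) :=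
  mkseq (fun v => if index v (unzip1 w) < size d then inl (deco_of w v)
                  else inr (deco_of w v)) (size d + size d').

Lemma unmerge_merge_word s : pmap from_left s = d -> pmap from_right s = d' ->
  unmerge (merge_word s) = s.
Proof.
move=> sl sr; apply: (@eq_from_nth _ (inl DecoN)).
  by rewrite size_mkseq (size_shuffle sl sr).
move=> v; rewrite size_mkseq => vs; rewrite nth_mkseq //.
have vw : v < size (word s) by rewrite size_word (size_shuffle sl sr).
have -> : deco_of (merge_word s) v = forget_side (nth (inl DecoN) s v).
  have : v \in unzip1 (merge_word s).
    by rewrite (perm_mem (merge_word_perm sl sr)) mem_iota size_merge_word.
  case/mapP => x xr ->; rewrite deco_ofE //; last exact: dperm_uniq (merge sl sr).
  rewrite (merge_word_letter sl sr xr) letter_word // (size_shuffle sl sr).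
  have : x.1 \in unzip1 (merge_word s) by rewrite map_f.
  by rewrite (perm_mem (merge_word_perm sl sr)) mem_iota size_merge_word.
have := left_tm sl sr (ext_perm lt) (ext_perm lt') (Ordinal vw).
rewrite /= -unzip1_merge_word => <-.
by case: (nth _ s v).
Qed.

Lemma pmap_mkseq (f : deco + deco -> option deco) (L : pred nat) (F : nat -> deco +
  deco)
    (g : nat -> deco) r :
  (forall v, v \in r -> f (F v) = if L v then Some (g v) else None) ->
  pmap f (map F r) = map g (filter L r).
Proof.
elim: r => //= v r IH h; rewrite h ?mem_head // IH; last by move=> u ur;
  rewrite h // inE ur orbT.
by case: (L v).
Qed.

Section Unmerge.
Variable w : dperm.
Hypotheses (sz : size w = size d + size d') (wt : std (take (size t) w) = t)
  (wt' : std (drop (size t) w) = t').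
Let s := unmerge w.
Let l := [seq v <- iota 0 (size d + size d') | index v (unzip1 w) < size d].
Let r := [seq v <- iota 0 (size d + size d') | ~~ (index v (unzip1 w) < size d)].

Lemma positions_unmerge : positions isL s = l /\ positions isR s = r.
Proof.
by split; rewrite /positions size_mkseq; apply: eq_in_filter => v; rewrite mem_iota =>
  vs;
  rewrite nth_mkseq //=; case: ifP.
Qed.

Lemma unmerge_sub (P : pred nat) u : {subset u <= (w : seq _)} -> uniq (unzip1 u) ->
  (forall v, v \in unzip1 w -> P v = (v \in unzip1 u)) ->
  perm_eq [seq v <- iota 0 (size d + size d') | P v] (unzip1 u).
Proof.
move=> uw uu h; apply: uniq_perm => // [|v]; first by rewrite filter_uniq ?iota_uniq.
rewrite mem_filter -sz -(perm_mem (dpermP w)).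
apply/andP/idP => [[pv vw]|vu]; first by rewrite -h.
have vw : v \in unzip1 w by case/mapP: vu => x xu ->; rewrite map_f ?uw.
by rewrite h.
Qed.

Lemma perm_l : perm_eq l (unzip1 (take (size t) w)).
Proof.
apply: unmerge_sub => [x /mem_take//||v vw].
  by rewrite /unzip1 map_take take_uniq ?dperm_uniq.
by rewrite /unzip1 map_take in_take_leq ?size_map ?sz size_ext ?leq_addr.
Qed.

Lemma perm_r : perm_eq r (unzip1 (drop (size t) w)).
Proof.
apply: unmerge_sub => [x /mem_drop//||v vw].
  by rewrite /unzip1 map_drop drop_uniq ?dperm_uniq.
have -> : unzip1 (drop (size t) w) =
  drop (size t) (unzip1 w) by rewrite /unzip1 map_drop.
rewrite -size_ext -in_take_leq; last by rewrite size_map sz -size_ext leq_addr.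
move: vw (dperm_uniq w); rewrite -{1 2}(cat_take_drop (size t) (unzip1 w)).
rewrite mem_cat cat_uniq => vw /and3P[_ /hasPn nd _].
case: (boolP (v \in drop _ _)) vw => [vd _|_]; last by rewrite orbF => ->.
exact: nd.
Qed.

Lemma sorted_l : sorted ltn l.
Proof. by apply: sorted_filter (iota_ltn_sorted _ _); apply: ltn_trans. Qed.
Lemma sorted_r : sorted ltn r.
Proof. by apply: sorted_filter (iota_ltn_sorted _ _); apply: ltn_trans. Qed.

Lemma unmerge_left : pmap from_left s = d.
Proof.
rewrite /s /unmerge /mkseq (@pmap_mkseq _ (fun v =>
  index v (unzip1 w) < size d) _ (deco_of w)).
  apply: (std_letters sorted_l perm_l).
  - by move=> x /mem_take xw; rewrite deco_ofE ?dperm_uniq.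
  - by move=> x; rewrite wt; apply: ext_letter.
  - by rewrite size_takel ?size_ext // sz leq_addr.
by move=> v _; case: ifP.
Qed.

Lemma unmerge_right : pmap from_right s = d'.
Proof.
rewrite /s /unmerge /mkseq (@pmap_mkseq _ (fun v =>
  ~~ (index v (unzip1 w) < size d)) _ (deco_of w)).
  apply: (std_letters sorted_r perm_r).
  - by move=> x /mem_drop xw; rewrite deco_ofE ?dperm_uniq.
  - by move=> x; rewrite wt'; apply: ext_letter.
  - by rewrite size_drop size_ext sz addKn.
by move=> v _; case: ifP.
Qed.

Lemma merge_word_unmerge : merge_word s = w.
Proof.
have [el er] := positions_unmerge.
rewrite /merge_word el er -[RHS](cat_take_drop (size t)); congr cat.
  by rewrite -[RHS](std_unsort sorted_l perm_l) wt.
by rewrite -[RHS](std_unsort sorted_r perm_r) wt'.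
Qed.
End Unmerge.

Definition merge_shuffle (s : (size d + size d').-tuple (deco + deco)) : dperm :=
  insubd dperm0 (merge_word s).

Lemma val_merge_shuffle s : shuffle s -> merge_shuffle s = merge_word s :> seq _.
Proof.
case/andP => /eqP sl /eqP sr; rewrite /merge_shuffle insubdK //.
exact: (merge_word_perm sl sr).
Qed.

(** For fixed linear extensions, each shuffle accounts for exactly one word of the product: it says
    which values each half takes, and the standardizations say in which order. *)
Lemma perm_merge :
  perm_eq [seq merge_shuffle s | s <- enum (fun s : (size d + size d').-tuple (deco +
    deco) => shuffle s)]
    [seq w : dperm <- dperms (size t + size t') |
          (std (take (size t) w) == t) && (std (drop (size t) w) == t')].
Proof.
apply: uniq_perm.
- rewrite map_inj_in_uniq ?enum_uniq // => s1 s2; rewrite !mem_enum => h1 h2 e.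
  apply: val_inj => /=; have := val_merge_shuffle h1; rewrite e val_merge_shuffle // =>
    er.
  case/andP: h1 => /eqP l1 /eqP r1; case/andP: h2 => /eqP l2 /eqP r2.
  by rewrite -(unmerge_merge_word l1 r1) -(unmerge_merge_word l2 r2) er.
- by rewrite filter_uniq // dperms_uniq.
move=> w; rewrite mem_filter mem_dperms size_ext size_ext'.
apply/mapP/andP => [[s]|[/andP[/eqP wt /eqP wt'] /eqP sz]].
  rewrite mem_enum => hs ->; rewrite val_merge_shuffle //.
  case/andP: (hs) => /eqP sl /eqP sr; rewrite -{1 3}size_ext.
  by rewrite (std_take_merge_word sl) (std_drop_merge_word sr) !eqxx size_merge_word.
have su : size (unmerge w) == size d + size d' by rewrite size_mkseq.
have sh : shuffle (Tuple su).
  by apply/andP; split; apply/eqP; [apply: unmerge_left | apply: unmerge_right];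
    rewrite // size_ext.
exists (Tuple su); first by rewrite mem_enum.
by apply: val_inj; rewrite /= val_merge_shuffle //= merge_word_unmerge // size_ext.
Qed.

End Product.

Local Open Scope ring_scope.
Local Open Scope quotient_scope.

Lemma pi_pt_sum (k : comNzRingType) (I : Type) (r : seq I) (P : pred I) (F : I ->
  FQSym k) :
  \pi_(PT k) (\sum_(i <- r | P i) F i) = \sum_(i <- r | P i) \pi_(PT k) (F i).
Proof. by apply: big_morph; [apply: pi_ptD | rewrite !piE]. Qed.

Theorem proposition66 (k : comNzRingType) (T T' : pretree)
    (hT : permutree T) (hT' : permutree T') :
  (forall s : (size (decor T) + size (decor T')).-tuple (deco + deco),
     shuffle s -> permutree (glue T T' s)) /\
  ptQ k T * ptQ k T' =
    \sum_(s : (size (decor T) + size (decor T')).-tuple (deco + deco) |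
            shuffle s) ptQ k (glue T T' s).
Proof.
have [t lt] := linear_extension_ex hT; have [t' lt'] := linear_extension_ex hT'.
split=> [s /andP[/eqP sl /eqP sr]|].
  exact: (permutree_glue hT hT' lt lt' sl sr).
rewrite (ptQ_E k hT lt) (ptQ_E k hT' lt').
transitivity (\pi_(PT k) (fqG k t * fqG k t')); first by rewrite pi_ptM.
rewrite fqG_mul /fqGmul -big_filter -(perm_big _ (perm_merge lt lt')) /=
  big_map pi_pt_sum.
rewrite big_enum /=; apply: eq_bigr => s hs; case/andP: (hs) => /eqP sl /eqP sr.
(* Both sides are now indexed by shuffles, and the word attached to [s] is a linear extension of the
   glued tree, so the summands agree one by one. *)
rewrite (ptQ_E k (permutree_glue hT hT' lt lt' sl sr) (ext_glue hT hT' lt lt' sl sr)).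
by congr (\pi_(PT k) (fqG k _)); apply: val_inj; rewrite /=
  (val_merge_shuffle lt lt' hs).
Qed.
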